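(* Let $k\ge2$ be even and let $\Phi:(0,\infty)\to\mathbb C$ be a smooth function with compact support in $(0,\infty)$ such that $\int_0^\infty\Phi(u)u^2\frac{du}{u}\neq0$. Define, for $y\ge0$, \[ \mathcal{M}^k_\Phi(y):=\Big(\int_0^\infty\mathcal{M}_k(y/u)\Phi(u)u^2\frac{du}{u}\Big)\Big/\int_0^\infty\Phi(u)u^2\frac{du}{u}. \] Then $\mathcal{M}^k_\Phi$ is continuous on $(0,\infty)$, $\mathcal{M}^k_\Phi(0)=0$, and as $y\to\infty$, $\mathcal{M}^k_\Phi(y)=\frac12+o_k(1)$.
   Context: For $y>0$, \[\mathcal{M}_k(y)=\frac{\alpha(-1)^{k/2-1}}{k-1}\sum_{1\le r\le 2\sqrt y}\nu(r)\sqrt{4y-r^2}\,U_{k-2}\Big(\frac{r}{2\sqrt y}\Big)+\frac{\beta}{k-1}\sqrt y-\gamma\,\delta_{k=2}\,y,\] and $\mathcal{M}_k(0)=0$, where $U_n(\cos\theta)=\sin((n+1)\theta)/\sin\theta$ is the Chebyshev polynomial, $\delta_{k=2}$ is $1$ if $k=2$ and $0$ otherwise, $\alpha=2\pi\prod_p\frac{1-p-2p^2+p^4}{p^4-2p^2+p}$, $\beta=2\pi\prod_p\frac{-1+p^2+p^3}{p(-1+p+p^2)}$, $\gamma=12\prod_p\frac{p(1+p)}{-1+p+p^2}$ (products over all primes), and $\nu(r)=\prod_{p\mid r}\big(1+\frac{p^2}{p^4-2p^2-p+1}\big)$. *)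

(* Defs.v *)
From Stdlib Require Import Reals ZArith Znumtheory Lra Lia.
From Coquelicot Require Import Coquelicot.

Open Scope R_scope.

Fixpoint chebyshevU (n : nat) (x : R) : R :=
  match n with
  | O => 1
  | S m => match m with
           | O => 2 * x
           | S l => 2 * x * chebyshevU m x - chebyshevU l x
           end
  end.

Lemma chebyshevU_cos (n : nat) (t : R) :
  sin t <> 0 -> chebyshevU n (cos t) = sin ((INR n + 1) * t) / sin t.
Proof.
intros ht.
assert (H : chebyshevU n (cos t) * sin t = sin ((INR n + 1) * t) /\
            chebyshevU (S n) (cos t) * sin t = sin ((INR (S n) + 1) * t)).
{ induction n as [|n [IH1 IH2]].
  - split; simpl.
    + rewrite !Rplus_0_l, !Rmult_1_l; reflexivity.
    + replace ((1 + 1) * t) with (2 * t) by ring.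
      rewrite sin_2a; ring.
  - split; [exact IH2|].
    change (chebyshevU (S (S n)) (cos t)) with
      (2 * cos t * chebyshevU (S n) (cos t) - chebyshevU n (cos t)).
    replace ((2 * cos t * chebyshevU (S n) (cos t) - chebyshevU n (cos t)) * sin t)
      with (2 * cos t * (chebyshevU (S n) (cos t) * sin t)
            - chebyshevU n (cos t) * sin t) by ring.
    rewrite IH1, IH2, !S_INR.
    set (s := (INR n + 1 + 1) * t).
    replace ((INR n + 1) * t) with (s - t) by (unfold s; ring).
    replace ((INR n + 1 + 1 + 1) * t) with (s + t) by (unfold s; ring).
    rewrite sin_minus, sin_plus; ring. }
destruct H as [H _].
rewrite <- H; field; exact ht.
Qed.

Definition prime_product_upto (N : nat) (f : R -> R) : R :=
  prod_f_R0 (fun n => if prime_dec (Z.of_nat n) then f (INR n) else 1) N.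

Definition prime_product (f : R -> R) : R :=
  real (Lim_seq (fun N => prime_product_upto N f)).

Definition alpha : R :=
  2 * PI * prime_product (fun p =>
    (1 - p - 2 * p ^ 2 + p ^ 4) / (p ^ 4 - 2 * p ^ 2 + p)).

Definition beta : R :=
  2 * PI * prime_product (fun p =>
    (-1 + p ^ 2 + p ^ 3) / (p * (-1 + p + p ^ 2))).

Definition gamma : R :=
  12 * prime_product (fun p => p * (1 + p) / (-1 + p + p ^ 2)).

(* A prime divisor of r >= 1 is at most r; only r >= 1 is used. *)
Definition nu (r : nat) : R :=
  prod_f_R0 (fun n =>
    if prime_dec (Z.of_nat n) then
      if Zdivide_dec (Z.of_nat n) (Z.of_nat r) then
        let p := INR n in 1 + p ^ 2 / (p ^ 4 - 2 * p ^ 2 - p + 1)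
      else 1
    else 1) r.

(* Int_part is the floor function. The value for y < 0 is a dummy. *)
Definition murm (k : nat) (y : R) : R :=
  if Rlt_dec 0 y then
    alpha * (-1) ^ (k / 2 - 1) / (INR k - 1)
      * sum_n_m (fun r => nu r * sqrt (4 * y - INR r ^ 2)
                          * chebyshevU (k - 2) (INR r / (2 * sqrt y)))
          1 (Z.to_nat (Int_part (2 * sqrt y)))
    + beta / (INR k - 1) * sqrt y
    - gamma * (if Nat.eqb k 2 then 1 else 0) * y
  else 0.

(* Functions on (0, oo) are represented by functions on R of which only the
   values at positive arguments are used. *)

(* D n is the n-th derivative of Phi. *)
Definition smooth_on_pos (Phi : R -> C) : Prop :=
  exists D : nat -> R -> C,
    (forall u, 0 < u -> D O u = Phi u) /\
    (forall n u, 0 < u ->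
       @is_derive R_AbsRing C_R_NormedModule (D n) u (D (S n) u)).

Definition compact_support_in_pos (Phi : R -> C) : Prop :=
  exists a b : R, 0 < a /\ a <= b /\
    forall u, 0 < u -> Phi u <> RtoC 0 -> a <= u <= b.

Definition integral_pos (f : R -> C) : C :=
  @RInt_gen C_R_CompleteNormedModule f (at_right 0) (Rbar_locally p_infty).

Definition murm_avg (k : nat) (Phi : R -> C) (y : R) : C :=
  (integral_pos (fun u => RtoC (murm k (y / u)) * Phi u * RtoC (u ^ 2 / u))
   / integral_pos (fun u => Phi u * RtoC (u ^ 2 / u)))%C.

(* Main.v *)
(** Up to the factor [2 sqrt y], the sum in [murm k (y / u)], integrated against
    [Phi u * u], is [sum_r nu(r) H(r x)] with [x = 1 / (2 sqrt y)]. In the variable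
    [t = 1 / u] the function [H] is [K_n phi (x) = int phi(t) sqrt(t - x^2) V_n(x^2 / t) dt]
    with [k = 2 n + 2], [U_(2n)(x) = V_n(x^2)] and [phi] a test function. It is smooth, even
    and compactly supported because [K_0 phi] is a convolution in [x^2] and [K_(n+2)] is
    expressed by [K_(n+1)] and [K_n].
    Write [T_p f(x) = f(p x)]. Then [sum_r nu(r) H(r x)] is obtained from
    [D(x) = sum_(a, m) a^-2 H(a m x)] by applying
    [prod_p (1 + g(p) T_p) (1 - p^-2 T_p)], where [nu(r) = prod_(p | r) (1 + g(p))];
    this product converges absolutely on functions of size [O(x)], and its local factors
    on [x^-1], [1] and [x] turn [alpha] into [gamma], [beta] and [1 / zeta(2)].
    Euler-Maclaurin summation gives
    [D(x) = zeta(3) c / x - zeta(2) H(0) / 2 - kappa x / 12 + o(x)] with [c] the integral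
    of [H] and [kappa] that of [H'(v) / v]. The first two terms cancel against the
    [gamma] and [beta] terms of [murm], and the third one yields [1 / 2]:
    [(K_0 phi)'(x) = 2 x K_0 phi'(x)] evaluates [kappa] for [n = 0], the recurrence gives
    the other [n], and [zeta(2) = PI^2 / 6]. *)

Require Import Defs.
From Stdlib Require Import Reals ZArith Znumtheory Lra Lia.
From Coquelicot Require Import Coquelicot.

Open Scope R_scope.

(** * Calculus of real functions *)

(* [auto_derive] produces eta-expanded functions, which [rewrite] does not match. *)
Lemma is_derive_unique_eta (f : R -> R) (x l : R) :
  is_derive f x l -> Derive (fun t => f t) x = l.
Proof. exact (is_derive_unique f x l). Qed.

Lemma ex_derive_continuous_R (f : R -> R) (x : R) : ex_derive f x -> continuous f x.
Proof. apply (ex_derive_continuous (V := R_NormedModule)). Qed.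

Lemma continuous_Rplus (f g : R -> R) (x : R) :
  continuous f x -> continuous g x -> continuous (fun y => f y + g y) x.
Proof. apply (continuous_plus (V := R_NormedModule) f g). Qed.

Lemma continuous_Rmult (f g : R -> R) (x : R) :
  continuous f x -> continuous g x -> continuous (fun y => f y * g y) x.
Proof. apply (continuous_mult (K := R_AbsRing) f g). Qed.

Lemma filterlim_locally_Rabs {T : Type} (F : (T -> Prop) -> Prop) {FF : Filter F}
  (f : T -> R) (l : R) :
  filterlim f F (locally l) <-> forall e, 0 < e -> F (fun x => Rabs (f x - l) <= e).
Proof.
split.
- intros Hf e he. generalize (proj1 (filterlim_locally f l) Hf (mkposreal e he)).
  apply filter_imp. intros x hx. now left.
- intros Hf. apply filterlim_locally. intros e.
  generalize (Hf (e / 2) (is_pos_div_2 e)). apply filter_imp. intros x hx.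
  change (Rabs (f x - l) < e). pose proof (cond_pos e). lra.
Qed.

Lemma filterlim_Rplus {T : Type} (F : (T -> Prop) -> Prop) {FF : Filter F}
  (f g : T -> R) (l m : R) : filterlim f F (locally l) -> filterlim g F (locally m) ->
  filterlim (fun x => f x + g x) F (locally (l + m)).
Proof.
intros Hf Hg. apply (filterlim_comp_2 f g Rplus Hf Hg).
apply (filterlim_plus (V := R_NormedModule) l m).
Qed.

Lemma filterlim_Rscal {T : Type} (F : (T -> Prop) -> Prop) (k : R)
  (f : T -> R) (l : R) : filterlim f F (locally l) ->
  filterlim (fun x => k * f x) F (locally (k * l)).
Proof.
intros Hf. apply (filterlim_comp _ _ _ f (Rmult k) F (locally l)); [exact Hf|].
apply (filterlim_scal_r (V := R_NormedModule) k l).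
Qed.

Lemma filterlim_at_right_0_linear (f : R -> R) (l C : R) : 0 <= C ->
  (forall x, 0 < x <= 1 -> Rabs (f x - l) <= C * x) ->
  filterlim f (at_right 0) (locally l).
Proof.
intros hC Hf. apply filterlim_locally_Rabs; [typeclasses eauto|]. intros e he.
assert (hd : 0 < Rmin 1 (e / (C + 1))).
{ apply Rmin_pos; [lra|]. apply Rdiv_lt_0_compat; lra. }
unfold at_right, within. generalize (open_lt _ 0 hd). apply filter_imp. intros x hx h0.
pose proof (Rmin_l 1 (e / (C + 1))). pose proof (Rmin_r 1 (e / (C + 1))).
refine (Rle_trans _ _ _ (Hf x ltac:(lra)) _).
assert (x * (C + 1) <= e) by (apply Rle_div_r; lra). lra.
Qed.

Lemma continuous_zero_from_right (f : R -> R) (a : R) :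
  continuous f a -> (forall x, a < x -> f x = 0) -> f a = 0.
Proof.
intros Hf Hz.
apply (filterlim_locally_unique (V := R_NormedModule) (F := at_right a) f).
- apply filterlim_filter_le_1 with (2 := Hf). apply filter_le_within.
- apply filterlim_ext_loc with (fun _ => 0); [|apply filterlim_const].
  unfold at_right, within. apply filter_forall. intros x hx. now rewrite Hz.
Qed.

Lemma ex_RInt_continuous_R (f : R -> R) (a b : R) :
  (forall x, continuous f x) -> ex_RInt f a b.
Proof. intros Hf. apply (ex_RInt_continuous (V := R_CompleteNormedModule)). auto. Qed.

Lemma is_derive_RInt_R (f : R -> R) (a x : R) :
  (forall t, continuous f t) -> is_derive (RInt f a) x (f x).
Proof.
intros Hf. apply (is_derive_RInt (V := R_NormedModule) f (RInt f a) a x); [|apply Hf].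
apply filter_forall. intros t. apply (RInt_correct (V := R_CompleteNormedModule)).
now apply ex_RInt_continuous_R.
Qed.

Lemma RInt_of_derivative (f df : R -> R) (a b : R) :
  (forall x : R, is_derive f x (df x)) -> (forall x, continuous df x) ->
  RInt df a b = f b - f a :> R.
Proof.
intros Hf Hdf. apply (is_RInt_unique (V := R_CompleteNormedModule)).
apply (is_RInt_derive (V := R_CompleteNormedModule)); auto.
Qed.

Lemma RInt_point_R (f : R -> R) (a : R) : RInt f a a = 0 :> R.
Proof. apply (RInt_point (V := R_CompleteNormedModule)). Qed.

Lemma RInt_ext_le (f g : R -> R) (a b : R) : a <= b ->
  (forall t, a < t < b -> f t = g t) -> RInt f a b = RInt g a b :> R.
Proof.
intros hab Hfg. apply RInt_ext. now rewrite Rmin_left, Rmax_right.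
Qed.

Lemma RInt_zero (f : R -> R) (a b : R) : a <= b ->
  (forall t, a < t < b -> f t = 0) -> RInt f a b = 0 :> R.
Proof.
intros hab Hf. rewrite (RInt_ext_le f (fun _ => 0)) by easy.
rewrite RInt_const. apply Rmult_0_r.
Qed.

Lemma RInt_scal_R (k : R) (f : R -> R) (a b : R) : (forall x, continuous f x) ->
  RInt (fun x => k * f x) a b = k * RInt f a b :> R.
Proof.
intros Hf. apply (RInt_scal (V := R_CompleteNormedModule)).
now apply ex_RInt_continuous_R.
Qed.

Lemma RInt_linear (f g : R -> R) (u v a b : R) :
  (forall x, continuous f x) -> (forall x, continuous g x) ->
  RInt (fun x => u * f x + v * g x) a b = u * RInt f a b + v * RInt g a b :> R.
Proof.
intros Hf Hg. apply (is_RInt_unique (V := R_CompleteNormedModule)).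
apply (is_RInt_plus (V := R_NormedModule)); apply (is_RInt_scal (V := R_NormedModule));
  apply (RInt_correct (V := R_CompleteNormedModule)); now apply ex_RInt_continuous_R.
Qed.

Lemma RInt_support (f : R -> R) (a b a' b' : R) : a' <= a -> b <= b' ->
  (forall t, continuous f t) ->
  (forall t, a' < t < a -> f t = 0) -> (forall t, b < t < b' -> f t = 0) ->
  RInt f a' b' = RInt f a b :> R.
Proof.
intros haa' hbb' Hc Ha Hb.
rewrite <- (RInt_Chasles f a' a b'), <- (RInt_Chasles f a b b')
  by now apply ex_RInt_continuous_R.
rewrite (RInt_zero f a' a), (RInt_zero f b b') by easy.
unfold plus; simpl. now rewrite Rplus_0_l, Rplus_0_r.
Qed.

(** * Smooth functions *)

Fixpoint derivable_upto (P : R -> Prop) (n : nat) (f : R -> R) : Prop :=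
  match n with
  | O => True
  | S m => exists f' : R -> R,
      (forall x, P x -> is_derive f x (f' x)) /\ derivable_upto P m f'
  end.

Definition smooth_on (P : R -> Prop) (f : R -> R) : Prop :=
  forall n, derivable_upto P n f.

Definition smooth (f : R -> R) : Prop := smooth_on (fun _ => True) f.

Lemma derivable_upto_ext (P : R -> Prop) (n : nat) (f g : R -> R) :
  open P -> (forall x, P x -> f x = g x) ->
  derivable_upto P n f -> derivable_upto P n g.
Proof.
intros oP. destruct n as [|n]; [easy|].
intros e [f' [Df Hf']]. exists f'. split; [|exact Hf'].
intros x Px. apply is_derive_ext_loc with f; [|now apply Df].
generalize (oP x Px). apply filter_imp. exact e.
Qed.

Lemma derivable_upto_S (P : R -> Prop) (n : nat) (f : R -> R) :
  derivable_upto P (S n) f -> derivable_upto P n f.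
Proof.
revert f. induction n as [|n IH]; intros f; [easy|].
intros [f' [Df Hf']]. exists f'. split; [exact Df|]. now apply IH.
Qed.

Lemma derivable_upto_subset (P Q : R -> Prop) (n : nat) (f : R -> R) :
  (forall x, P x -> Q x) -> derivable_upto Q n f -> derivable_upto P n f.
Proof.
intros PQ. revert f. induction n as [|n IH]; intros f; [easy|].
intros [f' [Df Hf']]. exists f'. split; auto.
Qed.

Lemma derivable_upto_const (P : R -> Prop) (n : nat) (c : R) :
  derivable_upto P n (fun _ => c).
Proof.
revert c. induction n as [|n IH]; intros c; [exact I|].
exists (fun _ => 0). split; [|apply IH].
intros x _. apply (is_derive_const (V := R_NormedModule)).
Qed.

Lemma derivable_upto_id (P : R -> Prop) (n : nat) :
  derivable_upto P n (fun x => x).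
Proof.
destruct n as [|n]; [exact I|].
exists (fun _ => 1). split; [|apply derivable_upto_const].
intros x _. apply (is_derive_id (K := R_AbsRing)).
Qed.

Lemma derivable_upto_plus (P : R -> Prop) (n : nat) (f g : R -> R) :
  derivable_upto P n f -> derivable_upto P n g ->
  derivable_upto P n (fun x => f x + g x).
Proof.
revert f g. induction n as [|n IH]; intros f g; [easy|].
intros [f' [Df Hf']] [g' [Dg Hg']].
exists (fun x => f' x + g' x). split; [|now apply IH].
intros x Px. apply (is_derive_plus (V := R_NormedModule)); auto.
Qed.

Lemma derivable_upto_mult (P : R -> Prop) (n : nat) (f g : R -> R) :
  derivable_upto P n f -> derivable_upto P n g ->
  derivable_upto P n (fun x => f x * g x).
Proof.
revert f g. induction n as [|n IH]; intros f g; [easy|].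
intros Hf Hg. pose proof (derivable_upto_S _ _ _ Hf) as Hf0.
pose proof (derivable_upto_S _ _ _ Hg) as Hg0.
destruct Hf as [f' [Df Hf']], Hg as [g' [Dg Hg']].
exists (fun x => f' x * g x + f x * g' x).
split; [|now apply derivable_upto_plus; apply IH].
intros x Px. apply (is_derive_mult f g); auto. intros; apply Rmult_comm.
Qed.

Lemma derivable_upto_comp (P Q : R -> Prop) (n : nat) (f g : R -> R) :
  (forall x, P x -> Q (g x)) ->
  derivable_upto Q n f -> derivable_upto P n g ->
  derivable_upto P n (fun x => f (g x)).
Proof.
intros PQ. revert f. induction n as [|n IH]; intros f; [easy|].
intros [f' [Df Hf']] Hg. pose proof (derivable_upto_S _ _ _ Hg) as Hg0.
destruct Hg as [g' [Dg Hg']].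
exists (fun x => g' x * f' (g x)).
split; [|now apply derivable_upto_mult; [|apply IH]].
intros x Px. apply (is_derive_comp (V := R_NormedModule)); auto.
Qed.

Lemma smooth_on_inv : smooth_on (fun x => 0 < x) Rinv.
Proof.
intros n. induction n as [|n IH]; [exact I|].
exists (fun x => (-1) * (/ x * / x)). split.
- intros x hx. auto_derive; [lra|]. field. lra.
- apply derivable_upto_mult; [apply derivable_upto_const|].
  now apply derivable_upto_mult.
Qed.

Lemma smooth_on_ext (P : R -> Prop) (f g : R -> R) :
  open P -> (forall x, P x -> f x = g x) -> smooth_on P f -> smooth_on P g.
Proof. intros oP e Hf n. now apply derivable_upto_ext with f. Qed.

Lemma smooth_on_mult (P : R -> Prop) (f g : R -> R) :
  smooth_on P f -> smooth_on P g -> smooth_on P (fun x => f x * g x).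
Proof. intros Hf Hg n. now apply derivable_upto_mult. Qed.

Lemma smooth_on_subset (P Q : R -> Prop) (f : R -> R) :
  (forall x, P x -> Q x) -> smooth_on Q f -> smooth_on P f.
Proof. intros PQ Hf n. now apply derivable_upto_subset with Q. Qed.

Lemma smooth_ext (f g : R -> R) : (forall x, f x = g x) -> smooth f -> smooth g.
Proof. intros e. apply smooth_on_ext; [apply open_true|auto]. Qed.

Lemma smooth_const (c : R) : smooth (fun _ => c).
Proof. intros n. apply derivable_upto_const. Qed.

Lemma smooth_id : smooth (fun x => x).
Proof. intros n. apply derivable_upto_id. Qed.

Lemma smooth_plus (f g : R -> R) : smooth f -> smooth g -> smooth (fun x => f x + g x).
Proof. intros Hf Hg n. now apply derivable_upto_plus. Qed.

Lemma smooth_mult (f g : R -> R) : smooth f -> smooth g -> smooth (fun x => f x * g x).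
Proof. apply smooth_on_mult. Qed.

Lemma smooth_scal (c : R) (f : R -> R) : smooth f -> smooth (fun x => c * f x).
Proof. apply smooth_mult, smooth_const. Qed.

Lemma smooth_pow (n : nat) : smooth (fun x => x ^ n).
Proof.
induction n as [|n IH]; [exact (smooth_const 1)|].
apply smooth_mult; [apply smooth_id|exact IH].
Qed.

Lemma smooth_comp (f g : R -> R) : smooth f -> smooth g -> smooth (fun x => f (g x)).
Proof. intros Hf Hg n. now apply derivable_upto_comp with (fun _ => True). Qed.

Lemma smooth_ex_derive (f : R -> R) (x : R) : smooth f -> ex_derive f x.
Proof. intros Hf. destruct (Hf 1%nat) as [f' [Df _]]. exists (f' x). now apply Df. Qed.

Lemma smooth_is_derive (f : R -> R) (x : R) : smooth f -> is_derive f x (Derive f x).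
Proof. intros Hf. now apply Derive_correct, smooth_ex_derive. Qed.

Lemma smooth_continuous (f : R -> R) (x : R) : smooth f -> continuous f x.
Proof. intros Hf. now apply ex_derive_continuous_R, smooth_ex_derive. Qed.

Lemma smooth_Derive (f : R -> R) : smooth f -> smooth (Derive f).
Proof.
intros Hf n. destruct (Hf (S n)) as [f' [Df Hf']].
apply derivable_upto_ext with f'; [apply open_true| |exact Hf'].
intros x _. symmetry. now apply is_derive_unique, Df.
Qed.

Lemma smooth_Derive_n (f : R -> R) (n : nat) : smooth f -> smooth (Derive_n f n).
Proof. intros Hf. induction n as [|n IH]; [exact Hf|]. now apply smooth_Derive. Qed.

Lemma smooth_antiderivative (f g : R -> R) :
  (forall x, is_derive g x (f x)) -> smooth f -> smooth g.
Proof. intros Dg Hf [|n]; [exact I|]. exists f. split; auto. Qed.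

Lemma RInt_id_mult_Derive (f : R -> R) (a b : R) : smooth f ->
  RInt (fun x => x * Derive f x) a b = b * f b - a * f a - RInt f a b :> R.
Proof.
intros Hf. pose proof (smooth_Derive f Hf) as Hf'.
assert (parts : RInt (fun x => 1 * f x + 1 * (x * Derive f x)) a b
                = b * f b - a * f a :> R).
{ apply (RInt_of_derivative (fun x => x * f x)).
  - intros x. auto_derive; [now apply smooth_ex_derive|].
    rewrite (is_derive_unique_eta _ _ _ (smooth_is_derive f x Hf)). ring.
  - intros x. apply smooth_continuous.
    apply smooth_plus; apply smooth_scal; [exact Hf|].
    now apply smooth_mult; [apply smooth_id|]. }
rewrite (RInt_linear f (fun x => x * Derive f x)) in parts.
- lra.
- intros x. now apply smooth_continuous.
- intros x. apply smooth_continuous. now apply smooth_mult; [apply smooth_id|].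
Qed.

Lemma smooth_glue (f : R -> R) (e : R) : 0 < e ->
  (forall x, x < e -> f x = 0) -> smooth_on (fun x => 0 < x) f -> smooth f.
Proof.
intros he Hz Hf n. specialize (Hf n). revert f Hz Hf.
induction n as [|n IH]; intros f Hz; [easy|]. intros [f' [Df Hf']].
assert (Df0 : forall x, x < e -> is_derive f x 0).
{ intros x hx. apply is_derive_ext_loc with (fun _ => 0).
  - generalize (open_lt e x hx). apply filter_imp. intros t ht. now rewrite Hz.
  - apply (is_derive_const (V := R_NormedModule)). }
exists (fun x => if Rlt_dec 0 x then f' x else 0). split.
- intros x _. destruct (Rlt_dec 0 x); [now apply Df|]. apply Df0. lra.
- apply IH.
  + intros x hx. destruct (Rlt_dec 0 x); [|reflexivity].
    rewrite <- (is_derive_unique _ _ _ (Df0 x hx)). symmetry.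
    now apply is_derive_unique, Df.
  + apply derivable_upto_ext with f'; [apply open_gt| |exact Hf'].
    intros x hx. destruct (Rlt_dec 0 x); [reflexivity|lra].
Qed.

Definition vanishes_beyond (L : R) (f : R -> R) : Prop := forall x, L <= x -> f x = 0.

Lemma continuous_bounded_vanishing (f : R -> R) (L : R) :
  (forall x, continuous f x) -> vanishes_beyond L f ->
  exists M, 0 <= M /\ forall x, 0 <= x -> Rabs (f x) <= M.
Proof.
intros Hc Hz.
destruct (continuity_ab_maj (fun x => Rabs (f x)) 0 (Rmax 0 L)) as [m [Hm _]].
- apply Rmax_l.
- intros c _. apply continuity_pt_filterlim.
  apply (continuous_comp f Rabs); [apply Hc|apply continuous_Rabs].
- exists (Rabs (f m)). split; [apply Rabs_pos|].
  intros x hx. destruct (Rle_dec x (Rmax 0 L)); [apply Hm; lra|].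
  rewrite Hz; [rewrite Rabs_R0; apply Rabs_pos|].
  pose proof (Rmax_r 0 L). lra.
Qed.

Definition tapered (L : R) (f : R -> R) : Prop := smooth f /\ vanishes_beyond L f.

Lemma tapered_continuous (L : R) (f : R -> R) (x : R) : tapered L f -> continuous f x.
Proof. intros [Hf _]. now apply smooth_continuous. Qed.

Lemma tapered_plus (L : R) (f g : R -> R) :
  tapered L f -> tapered L g -> tapered L (fun x => f x + g x).
Proof.
intros [Sf Zf] [Sg Zg]. split; [now apply smooth_plus|].
intros x hx. rewrite Zf, Zg by easy. ring.
Qed.

Lemma tapered_mult (L : R) (f g : R -> R) :
  smooth f -> tapered L g -> tapered L (fun x => f x * g x).
Proof.
intros Sf [Sg Zg]. split; [now apply smooth_mult|].
intros x hx. rewrite Zg by easy. ring.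
Qed.

Lemma tapered_scal (L c : R) (f : R -> R) : tapered L f -> tapered L (fun x => c * f x).
Proof. apply tapered_mult, smooth_const. Qed.

Lemma tapered_Derive (L : R) (f : R -> R) : tapered L f -> tapered L (Derive f).
Proof.
intros [Sf Zf]. pose proof (smooth_Derive f Sf) as Sf'. split; [exact Sf'|].
assert (Hlt : forall x, L < x -> Derive f x = 0).
{ intros x hx. apply is_derive_unique. apply is_derive_ext_loc with (fun _ => 0).
  - generalize (open_gt L x hx). apply filter_imp. intros t ht. rewrite Zf; lra.
  - apply (is_derive_const (V := R_NormedModule)). }
intros x [hx|hx]; [now apply Hlt|]. rewrite <- hx.
apply continuous_zero_from_right; [now apply smooth_continuous|exact Hlt].
Qed.

Lemma tapered_Derive_n (L : R) (f : R -> R) (n : nat) :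
  tapered L f -> tapered L (Derive_n f n).
Proof. intros Hf. induction n as [|n IH]; [exact Hf|]. now apply tapered_Derive. Qed.

(** * The value of zeta at 2 *)

Definition zeta (s : nat) : R := Series (fun n => / INR (S n) ^ s).

Definition wallis_integral (n : nat) : R := RInt (fun x => cos x ^ (2 * n)) 0 (PI / 2).

Definition wallis_moment (n : nat) : R :=
  RInt (fun x => x ^ 2 * cos x ^ (2 * n)) 0 (PI / 2).

Definition wallis_ratio (n : nat) : R := wallis_moment n / wallis_integral n.

Lemma continuous_cos_pow (n : nat) (x : R) : continuous (fun x => cos x ^ n) x.
Proof. apply ex_derive_continuous_R. auto_derive. exact I. Qed.

Lemma continuous_sqr_cos_pow (n : nat) (x : R) :
  continuous (fun x => x ^ 2 * cos x ^ n) x.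
Proof. apply ex_derive_continuous_R. auto_derive. exact I. Qed.

Lemma wallis_integral_S (m : nat) :
  2 * (INR m + 1) * wallis_integral (S m) = (2 * INR m + 1) * wallis_integral m.
Proof.
assert (H : RInt (fun x => 2 * (INR m + 1) * cos x ^ (2 * S m)
                    + - (2 * INR m + 1) * cos x ^ (2 * m)) 0 (PI / 2) = 0 :> R).
{ rewrite (RInt_of_derivative (fun x => sin x * cos x ^ (2 * m + 1))).
  - rewrite cos_PI2, sin_0, pow_ne_zero by lia. ring.
  - intros x. auto_derive; [exact I|].
    replace (2 * S m)%nat with (S (S (2 * m))) by lia.
    replace (pred (m + (m + 0) + 1)) with (2 * m)%nat by lia.
    replace (m + (m + 0) + 1)%nat with (S (2 * m)) by lia.
    rewrite S_INR, mult_INR; simpl (INR 2); simpl pow.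
    pose proof (sin2 x) as e. unfold Rsqr in e. generalize (cos x ^ (m + (m + 0))).
    intros c. ring [e].
  - intros x. apply ex_derive_continuous_R. auto_derive. exact I. }
rewrite RInt_linear in H by (intros; apply continuous_cos_pow).
unfold wallis_integral. lra.
Qed.

Lemma wallis_moment_S (m : nat) :
  2 * (INR m + 1) ^ 2 * wallis_moment (S m)
  = (INR m + 1) * (2 * INR m + 1) * wallis_moment m - wallis_integral (S m).
Proof.
assert (H : RInt (fun x => 1 * (1 * cos x ^ (2 * S m)
     + 2 * (INR m + 1) ^ 2 * (x ^ 2 * cos x ^ (2 * S m)))
     + - ((INR m + 1) * (2 * INR m + 1)) * (x ^ 2 * cos x ^ (2 * m))) 0 (PI / 2) = 0 :> R).
{ rewrite (RInt_of_derivative (fun x => x * cos x ^ (2 * m + 2)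
      + (INR m + 1) * x ^ 2 * sin x * cos x ^ (2 * m + 1))).
  - rewrite cos_PI2, sin_0, !pow_ne_zero by lia. ring.
  - intros x. auto_derive; [exact I|].
    replace (2 * S m)%nat with (S (S (2 * m))) by lia.
    replace (pred (m + (m + 0) + 1)) with (2 * m)%nat by lia.
    replace (pred (m + (m + 0) + 2)) with (S (2 * m)) by lia.
    replace (m + (m + 0) + 1)%nat with (S (2 * m)) by lia.
    replace (m + (m + 0) + 2)%nat with (S (S (2 * m))) by lia.
    rewrite !S_INR, mult_INR; simpl (INR 2); simpl pow.
    pose proof (sin2 x) as e. unfold Rsqr in e. generalize (cos x ^ (m + (m + 0))).
    intros c. ring [e].
  - intros x. apply ex_derive_continuous_R. auto_derive. exact I. }
rewrite RInt_linear in H; [rewrite RInt_linear in H| |].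
- unfold wallis_integral, wallis_moment. lra.
- intros; apply continuous_cos_pow.
- intros; apply continuous_sqr_cos_pow.
- intros x. apply ex_derive_continuous_R. auto_derive. exact I.
- intros; apply continuous_sqr_cos_pow.
Qed.

Lemma wallis_integral_0 : wallis_integral 0 = PI / 2.
Proof.
unfold wallis_integral. rewrite (RInt_of_derivative (fun x => x)).
- lra.
- intros x. apply (is_derive_id (K := R_AbsRing)).
- intros x. apply continuous_cos_pow.
Qed.

Lemma wallis_moment_0 : wallis_moment 0 = PI ^ 3 / 24.
Proof.
unfold wallis_moment. rewrite (RInt_of_derivative (fun x => x ^ 3 / 3)).
- field.
- intros x. auto_derive; [exact I|]. simpl. field.
- intros x. apply continuous_sqr_cos_pow.
Qed.

Lemma wallis_integral_pos (n : nat) : 0 < wallis_integral n.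
Proof.
induction n as [|m IH]; [rewrite wallis_integral_0; pose proof PI_RGT_0; lra|].
pose proof (wallis_integral_S m). pose proof (pos_INR m). nra.
Qed.

Lemma mult_cos_le_sin (x : R) : 0 <= x <= PI / 2 -> x * cos x <= sin x.
Proof.
intros hx. destruct (MVT_gen (fun x => sin x - x * cos x) 0 x (fun x => x * sin x))
  as [c [hc e]].
- intros t _. auto_derive; [exact I|]. ring.
- intros t _. apply derivable_continuous_pt, ex_derive_Reals_0. auto_derive. exact I.
- rewrite Rmin_left, Rmax_right in hc by lra. rewrite sin_0 in e.
  pose proof PI_RGT_0. assert (0 <= sin c) by (apply sin_ge_0; lra).
  assert (0 <= c * sin c * (x - 0)) by (repeat apply Rmult_le_pos; lra). lra.
Qed.

Lemma wallis_moment_bounds (m : nat) :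
  0 <= wallis_moment (S m) <= wallis_integral m - wallis_integral (S m).
Proof.
pose proof PI_RGT_0.
assert (even_pow_nonneg : forall x, 0 <= cos x ^ (2 * m))
  by (intros; rewrite pow_mult; apply pow_le, pow2_ge_0).
split.
- apply RInt_ge_0; [lra|apply ex_RInt_continuous_R, continuous_sqr_cos_pow|].
  intros x _. apply Rmult_le_pos; [apply pow2_ge_0|].
  rewrite pow_mult. apply pow_le, pow2_ge_0.
- replace (wallis_integral m - wallis_integral (S m))
    with (1 * wallis_integral m + -1 * wallis_integral (S m)) by ring.
  unfold wallis_integral, wallis_moment. rewrite <- RInt_linear by apply continuous_cos_pow.
  apply RInt_le; [lra|apply ex_RInt_continuous_R, continuous_sqr_cos_pow| |].
  + apply ex_RInt_continuous_R. intros x. apply ex_derive_continuous_R. auto_derive. exact I.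
  + intros x hx. pose proof (mult_cos_le_sin x ltac:(lra)).
    assert (0 <= x * cos x) by (apply Rmult_le_pos; [|apply cos_ge_0]; lra).
    pose proof (sin2 x) as e. unfold Rsqr in e.
    replace (2 * S m)%nat with (2 + 2 * m)%nat by lia. rewrite pow_add.
    replace (1 * cos x ^ (2 * m) + -1 * (cos x ^ 2 * cos x ^ (2 * m)))
      with (sin x * sin x * cos x ^ (2 * m)) by (rewrite e; ring).
    rewrite <- Rmult_assoc. apply Rmult_le_compat_r; [apply even_pow_nonneg|]. nra.
Qed.

(* Matsuoka's telescoping of the partial sums of [zeta 2]. *)
Lemma wallis_ratio_step (m : nat) :
  / INR (S m) ^ 2 = 2 * (wallis_ratio m - wallis_ratio (S m)).
Proof.
pose proof (pos_INR m). pose proof (wallis_integral_pos m).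
assert (eI : wallis_integral (S m)
  = (2 * INR m + 1) * wallis_integral m / (2 * (INR m + 1))).
{ rewrite <- wallis_integral_S. field. lra. }
assert (eM : wallis_moment (S m)
  = ((INR m + 1) * (2 * INR m + 1) * wallis_moment m - wallis_integral (S m))
      / (2 * (INR m + 1) ^ 2)).
{ rewrite <- wallis_moment_S. field. lra. }
unfold wallis_ratio. rewrite eM, eI, S_INR. field. repeat split; lra.
Qed.

Lemma wallis_ratio_bounds (m : nat) : 0 <= wallis_ratio (S m) <= / INR (S m).
Proof.
pose proof (wallis_moment_bounds m). pose proof (wallis_integral_pos (S m)).
pose proof (wallis_integral_S m). pose proof (pos_INR m).
split; [apply Rdiv_le_0_compat; lra|].
apply Rle_div_l; [lra|]. apply Rle_trans with (wallis_integral m - wallis_integral (S m));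
  [lra|].
rewrite S_INR, Rmult_comm. apply Rle_div_r; [lra|]. nra.
Qed.

Lemma is_lim_seq_inv_INR_S : is_lim_seq (fun n => / INR (S n)) 0.
Proof.
apply (is_lim_seq_incr_1 (fun n => / INR n)).
apply (is_lim_seq_inv INR p_infty); [apply is_lim_seq_INR|easy].
Qed.

Lemma is_series_inv_squares : is_series (fun n => / INR (S n) ^ 2) (PI ^ 2 / 6).
Proof.
assert (partial : forall M, 2 * (PI ^ 2 / 12 - wallis_ratio (S M))
  = sum_n (fun n => / INR (S n) ^ 2) M).
{ assert (ratio_0 : wallis_ratio 0 = PI ^ 2 / 12).
  { unfold wallis_ratio. rewrite wallis_integral_0, wallis_moment_0.
    pose proof PI_RGT_0. field. lra. }
  rewrite <- ratio_0. induction M as [|M IH].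
  - now rewrite sum_O, wallis_ratio_step.
  - rewrite sum_Sn, <- IH, wallis_ratio_step. unfold plus; simpl. ring. }
apply (is_lim_seq_ext _ _ (PI ^ 2 / 6) partial).
replace (PI ^ 2 / 6) with (2 * (PI ^ 2 / 12 - 0)) by field.
apply (is_lim_seq_scal_l _ 2 (Finite (PI ^ 2 / 12 - 0))).
apply is_lim_seq_minus'; [apply is_lim_seq_const|].
apply is_lim_seq_le_le with (2 := is_lim_seq_const 0) (3 := is_lim_seq_inv_INR_S).
exact wallis_ratio_bounds.
Qed.

Lemma zeta_2 : zeta 2 = PI ^ 2 / 6.
Proof. apply is_series_unique, is_series_inv_squares. Qed.

Lemma inv_INR_S_pow_pos (n s : nat) : 0 < / INR (S n) ^ s.
Proof. apply Rinv_0_lt_compat, pow_lt, lt_0_INR. lia. Qed.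

Lemma ex_series_inv_pow (s : nat) : (2 <= s)%nat ->
  ex_series (fun n => / INR (S n) ^ s).
Proof.
intros hs. apply (ex_series_le (V := R_CompleteNormedModule)
  _ (fun n => / INR (S n) ^ 2)); [|eexists; apply is_series_inv_squares].
intros n. change (norm ?u) with (Rabs u).
rewrite Rabs_pos_eq by (left; apply inv_INR_S_pow_pos).
assert (1 <= INR (S n)) by (rewrite S_INR; pose proof (pos_INR n); lra).
apply Rinv_le_contravar; [apply pow_lt; lra|]. now apply Rle_pow.
Qed.

(** * Euler-Maclaurin summation *)

Lemma sum_n_S (u : nat -> R) (n : nat) : sum_n u (S n) = sum_n u n + u (S n) :> R.
Proof. exact (sum_Sn u n). Qed.

Lemma is_series_finite_support (u : nat -> R) (M : nat) :
  (forall m, (M < m)%nat -> u m = 0) -> is_series u (sum_n u M).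
Proof.
intros Hz. change (is_lim_seq (sum_n u) (sum_n u M)).
apply (is_lim_seq_ext_loc (fun _ => sum_n u M)); [|apply is_lim_seq_const].
exists M. intros n hn. induction hn as [|n hn IH]; [reflexivity|].
rewrite sum_n_S, <- IH, Hz by lia. symmetry. apply Rplus_0_r.
Qed.

Lemma Series_finite_support (u : nat -> R) (M : nat) :
  (forall m, (M < m)%nat -> u m = 0) -> Series u = sum_n u M.
Proof. intros Hz. now apply is_series_unique, is_series_finite_support. Qed.

Lemma Rabs_Series_le (u : nat -> R) (K : R) : ex_series u ->
  (forall M, Rabs (sum_n u M) <= K) -> Rabs (Series u) <= K.
Proof.
intros hu hK.
apply (is_lim_seq_le (fun M => Rabs (sum_n u M)) (fun _ => K) (Rabs (Series u)) K hK).
- apply (is_lim_seq_abs (sum_n u) (Series u)). exact (Series_correct u hu).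
- apply is_lim_seq_const.
Qed.

Definition dilated_sum (f : R -> R) (x : R) : R :=
  Series (fun m => f (INR (S m) * x)).

Lemma exists_cutoff (L x : R) : 0 < x -> exists M : nat, L <= INR (S M) * x.
Proof.
intros hx. destruct (INR_archimed x L hx) as [M hM].
exists M. rewrite S_INR. lra.
Qed.

Lemma vanishes_beyond_dilated (f : R -> R) (L x : R) (M m : nat) :
  vanishes_beyond L f -> 0 < x -> L <= INR M * x -> (M <= m)%nat ->
  f (INR m * x) = 0.
Proof. intros Hz hx hM hm. apply Hz. apply le_INR in hm. nra. Qed.

Lemma dilated_sum_finite (f : R -> R) (L x : R) (M : nat) :
  vanishes_beyond L f -> 0 < x -> L <= INR (S M) * x ->
  dilated_sum f x = sum_n (fun m => f (INR (S m) * x)) M.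
Proof.
intros Hz hx hM. apply Series_finite_support. intros m hm.
apply (vanishes_beyond_dilated f L x (S M)); trivial. lia.
Qed.

Lemma ex_series_Rabs_dilated (f : R -> R) (L x : R) : vanishes_beyond L f -> 0 < x ->
  ex_series (fun m => Rabs (f (INR (S m) * x))).
Proof.
intros Hz hx. destruct (exists_cutoff L x hx) as [M hM].
eexists. apply (is_series_finite_support _ M). intros m hm.
rewrite (vanishes_beyond_dilated f L x (S M)); trivial; [apply Rabs_R0|lia].
Qed.

Lemma dilated_sum_plus (f g : R -> R) (L x : R) : 0 < x ->
  vanishes_beyond L f -> vanishes_beyond L g ->
  dilated_sum (fun v => f v + g v) x = dilated_sum f x + dilated_sum g x.
Proof.
intros hx Hf Hg. apply Series_plus;
  apply ex_series_Rabs; now apply ex_series_Rabs_dilated with L.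
Qed.

Lemma dilated_sum_bounded (L : R) (f : R -> R) :
  (forall v, continuous f v) -> vanishes_beyond L f ->
  exists K, 0 <= K /\ forall x, 1 <= x -> Rabs (dilated_sum f x) <= K.
Proof.
intros Hc Hz. destruct (continuous_bounded_vanishing f L Hc Hz) as [A [hA HA]].
destruct (exists_cutoff L 1) as [M hM]; [lra|].
exists (INR (S M) * A). split; [apply Rmult_le_pos; [apply pos_INR|easy]|].
intros x hx. pose proof (pos_INR (S M)).
rewrite (dilated_sum_finite f L x M) by (trivial; nra).
refine (Rle_trans _ _ _ (norm_sum_n_m (V := R_NormedModule) _ 0 M) _).
rewrite <- sum_n_const. apply sum_n_m_le. intros m.
apply HA. apply Rmult_le_pos; [apply pos_INR|lra].
Qed.

Lemma Rabs_le_pow_S_of_derive (g g' : R -> R) (C : R) (n : nat) :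
  (forall t, 0 <= t -> is_derive g t (g' t)) -> g 0 = 0 -> 0 <= C ->
  (forall t, 0 <= t -> Rabs (g' t) <= C * t ^ n) ->
  forall t, 0 <= t -> Rabs (g t) <= C * t ^ S n.
Proof.
intros Dg g0 hC Bg' t ht. destruct (MVT_gen g 0 t g') as [c [hc e]].
- intros x. rewrite Rmin_left by lra. intros hx. apply Dg. lra.
- intros x. rewrite Rmin_left by lra. intros hx.
  apply derivable_continuous_pt, ex_derive_Reals_0. exists (g' x). apply Dg. lra.
- rewrite Rmin_left, Rmax_right in hc by lra.
  rewrite g0, !Rminus_0_r in e. rewrite e, Rabs_mult, (Rabs_pos_eq t) by lra.
  simpl. rewrite (Rmult_comm t), <- Rmult_assoc. apply Rmult_le_compat_r; [lra|].
  apply Rle_trans with (C * c ^ n); [apply Bg'; lra|].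
  apply Rmult_le_compat_l; [lra|]. apply pow_incr. lra.
Qed.

Section EulerMaclaurinSum.

Variables (f : R -> R) (K : R).
Hypothesis f_smooth : smooth f.
Hypothesis K_nonneg : 0 <= K.
Hypothesis f4_bound : forall x, 0 <= x -> Rabs (Derive_n f 4 x) <= K.

(* As a function of [t] the error vanishes to third order at [0], and its third
   derivative is [- t^2 / 12 * f''''(a + t)]. *)
Lemma trapezoid_error (a t : R) : 0 <= a -> 0 <= t ->
  Rabs (t / 2 * (f a + f (a + t)) - RInt f a (a + t)
        - t ^ 2 / 12 * (Derive f (a + t) - Derive f a)) <= K * t ^ 5.
Proof.
intros ha ht.
assert (DI : forall x, is_derive (RInt f a) x (f x)).
{ intros x. apply is_derive_RInt_R. intros; now apply smooth_continuous. }
change (Derive f) with (Derive_n f 1).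
assert (Df : forall k x, is_derive (Derive_n f k) x (Derive_n f (S k) x)).
{ intros k x. now apply smooth_is_derive, smooth_Derive_n. }
assert (D0 : forall x, is_derive f x (Derive_n f 1 x)) by exact (Df O).
pose proof (Df 1%nat) as D1. pose proof (Df 2%nat) as D2. pose proof (Df 3%nat) as D3.
pose proof (RInt_point_R f a) as I0.
revert f4_bound D0 D1 D2 D3 DI I0.
generalize (Derive_n f 1) (Derive_n f 2) (Derive_n f 3) (Derive_n f 4) (RInt f a).
intros f1 f2 f3 f4 F B4 D0 D1 D2 D3 DI I0.
apply (Rabs_le_pow_S_of_derive
  (fun t => t / 2 * (f a + f (a + t)) - F (a + t) - t ^ 2 / 12 * (f1 (a + t) - f1 a))
  (fun t => (f a + f (a + t)) / 2 + t / 2 * f1 (a + t) - f (a + t)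
     - t / 6 * (f1 (a + t) - f1 a) - t ^ 2 / 12 * f2 (a + t))); trivial.
{ intros s hs. auto_derive.
  - repeat split; eexists; eauto.
  - rewrite (is_derive_unique _ _ _ (DI _)), (is_derive_unique _ _ _ (D0 _)),
      (is_derive_unique _ _ _ (D1 _)). field. }
{ rewrite Rplus_0_r, I0. field. }
apply (Rabs_le_pow_S_of_derive
  _ (fun t => t / 6 * f2 (a + t) - (f1 (a + t) - f1 a) / 6
              - t ^ 2 / 12 * f3 (a + t))); trivial.
{ intros s hs. auto_derive.
  - repeat split; eexists; eauto.
  - rewrite (is_derive_unique _ _ _ (D0 _)), (is_derive_unique _ _ _ (D1 _)),
      (is_derive_unique _ _ _ (D2 _)). field. }
{ rewrite Rplus_0_r. field. }
apply (Rabs_le_pow_S_of_derive _ (fun t => - (t ^ 2 / 12) * f4 (a + t))); trivial.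
{ intros s hs. auto_derive.
  - repeat split; eexists; eauto.
  - rewrite (is_derive_unique _ _ _ (D1 _)), (is_derive_unique _ _ _ (D2 _)),
      (is_derive_unique _ _ _ (D3 _)). field. }
{ rewrite Rplus_0_r. field. }
intros s hs. rewrite Rabs_mult, Rabs_Ropp, Rabs_pos_eq by nra.
specialize (B4 (a + s) ltac:(lra)). pose proof (Rabs_pos (f4 (a + s))). nra.
Qed.

Lemma euler_maclaurin_sum (x : R) (M : nat) : 0 <= x ->
  Rabs (x * (f 0 / 2 + sum_n (fun m => f (INR (S m) * x)) M - f (INR (S M) * x) / 2)
        - RInt f 0 (INR (S M) * x)
        - x ^ 2 / 12 * (Derive f (INR (S M) * x) - Derive f 0))
  <= INR (S M) * (K * x ^ 5).
Proof.
intros hx. induction M as [|M IH].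
- rewrite sum_O. simpl INR. rewrite !Rmult_1_l.
  pose proof (trapezoid_error 0 x (Rle_refl 0) hx) as H.
  rewrite Rplus_0_l in H. refine (Rle_trans _ _ _ _ H). right. f_equal. field.
- rewrite sum_n_S.
  assert (ha : 0 <= INR (S M) * x) by (apply Rmult_le_pos; [apply pos_INR|lra]).
  pose proof (trapezoid_error _ x ha hx) as H.
  rewrite (S_INR (S M)).
  replace ((INR (S M) + 1) * x) with (INR (S M) * x + x) by ring.
  set (a := INR (S M) * x) in *.
  rewrite <- (RInt_Chasles f 0 a (a + x)); [|apply ex_RInt_continuous_R;
    intros; now apply smooth_continuous ..].
  rewrite (Rmult_plus_distr_r (INR (S M)) 1), Rmult_1_l.
  refine (Rle_trans _ _ _ _ (Rplus_le_compat _ _ _ _ IH H)).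
  refine (Rle_trans _ _ _ _ (Rabs_triang _ _)). right. f_equal.
  unfold plus; simpl. field.
Qed.

End EulerMaclaurinSum.

Definition euler_remainder (L : R) (f : R -> R) (x : R) : R :=
  dilated_sum f x - RInt f 0 L / x + f 0 / 2.

Lemma euler_remainder_ext (L : R) (f g : R -> R) (x : R) : (forall v, f v = g v) ->
  euler_remainder L f x = euler_remainder L g x.
Proof.
intros e. unfold euler_remainder, dilated_sum. rewrite (e 0), (RInt_ext f g) by auto.
now rewrite (Series_ext _ _ (fun m => e (INR (S m) * x))).
Qed.

Section EulerRemainder.

Variable L : R.
Hypothesis L_pos : 0 < L.

Lemma euler_remainder_plus (f g : R -> R) (x : R) : tapered L f -> tapered L g -> 0 < x ->
  euler_remainder L (fun v => f v + g v) x = euler_remainder L f x + euler_remainder L g x.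
Proof.
intros Hf Hg hx. unfold euler_remainder.
rewrite (dilated_sum_plus f g L) by (easy || apply Hf || apply Hg).
rewrite (RInt_ext_le (fun v => f v + g v) (fun v => 1 * f v + 1 * g v)), RInt_linear.
- field. lra.
- intros; now apply tapered_continuous with L.
- intros; now apply tapered_continuous with L.
- lra.
- intros; ring.
Qed.

Lemma is_derive_dilated_sum (f : R -> R) (x : R) : tapered L f -> 0 < x ->
  is_derive (dilated_sum f) x (dilated_sum (fun v => v * Derive f v) x / x).
Proof.
intros Hf hx. destruct (exists_cutoff L (x / 2)) as [M hM]; [lra|].
pose proof (pos_INR (S M)).
apply is_derive_ext_loc with (fun t => sum_n (fun m => f (INR (S m) * t)) M).
- assert (hx2 : x / 2 < x) by lra. generalize (open_gt (x / 2) x hx2).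
  apply filter_imp. intros t ht. symmetry.
  apply (dilated_sum_finite f L); [apply Hf|lra|nra].
- rewrite (dilated_sum_finite _ L x M);
    [|apply tapered_mult; [apply smooth_id|now apply tapered_Derive]|easy|nra].
  unfold Rdiv. rewrite Rmult_comm. rewrite <- (sum_n_mult_l (K := R_Ring)).
  apply (is_derive_sum_n (V := R_NormedModule) (fun m t => f (INR (S m) * t))).
  intros k _. generalize (INR (S k)); intros q. auto_derive; [now apply smooth_ex_derive, Hf|].
  rewrite (is_derive_unique_eta _ _ _ (smooth_is_derive f (q * x) (proj1 Hf))).
  unfold mult; simpl. field. lra.
Qed.

Lemma is_derive_euler_remainder (f : R -> R) (x : R) : tapered L f -> 0 < x ->
  is_derive (euler_remainder L f) x (euler_remainder L (fun v => v * Derive f v) x / x).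
Proof.
intros Hf hx. pose proof (is_derive_dilated_sum f x Hf hx) as D.
unfold euler_remainder. rewrite RInt_id_mult_Derive by apply Hf.
rewrite (proj2 Hf L) by lra. generalize (RInt f 0 L). intros c.
auto_derive; [split; [eexists; exact D|split; [lra|exact I]]|].
rewrite (is_derive_unique_eta _ _ _ D). field. lra.
Qed.

Lemma euler_maclaurin (f : R -> R) : tapered L f ->
  exists C, 0 <= C /\ forall x, 0 < x <= 1 ->
    Rabs (euler_remainder L f x + x / 12 * Derive f 0) <= C * x ^ 3.
Proof.
intros Hf. assert (Cf : forall v, continuous f v)
  by (intros; now apply tapered_continuous with L).
destruct (tapered_Derive_n L f 4 Hf) as [S4 Z4].
destruct (continuous_bounded_vanishing (Derive_n f 4) L) as [K [hK BK]];
  [intros; now apply smooth_continuous|exact Z4|].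
exists ((L + 1) * K). split; [nra|]. intros x hx.
destruct (nfloor_ex (L / x)) as [M [hM1 hM2]]; [apply Rdiv_le_0_compat; lra|].
apply Rle_div_r in hM1; [|lra]. apply Rlt_div_l in hM2; [|lra].
rewrite <- S_INR in hM2. set (b := INR (S M) * x) in *.
pose proof (euler_maclaurin_sum f K (proj1 Hf) hK BK x M ltac:(lra)) as H. fold b in H.
rewrite (proj2 Hf b), (proj2 (tapered_Derive L f Hf) b) in H by lra.
rewrite (RInt_support f 0 L 0 b) in H; [|lra|lra|exact Cf|intros t ht; lra|].
2: { intros t ht. apply Hf. lra. }
rewrite <- (dilated_sum_finite f L) in H; [|apply Hf|lra|fold b; lra].
apply Rmult_le_reg_l with x; [lra|].
rewrite <- (Rabs_pos_eq x) at 1 by lra. rewrite <- Rabs_mult.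
apply Rle_trans with (INR (S M) * (K * x ^ 5)).
- refine (Rle_trans _ _ _ _ H). right. f_equal. unfold euler_remainder. field. lra.
- replace (INR (S M) * (K * x ^ 5)) with (b * (K * x ^ 4)) by (unfold b; ring).
  replace (x * ((L + 1) * K * x ^ 3)) with ((L + 1) * (K * x ^ 4)) by ring.
  apply Rmult_le_compat_r; [apply Rmult_le_pos; [easy|apply pow_le; lra]|].
  unfold b. rewrite S_INR. lra.
Qed.

Lemma euler_remainder_bounded (f : R -> R) : tapered L f ->
  exists K, 0 <= K /\ forall x, 1 <= x -> Rabs (euler_remainder L f x) <= K.
Proof.
intros Hf. destruct (dilated_sum_bounded L f) as [K [hK BK]];
  [intros; now apply tapered_continuous with L|apply Hf|].
pose proof (Rabs_pos (RInt f 0 L)) as hI. pose proof (Rabs_pos (f 0)) as h0.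
exists (K + Rabs (RInt f 0 L) + Rabs (f 0)). split; [lra|]. intros x hx.
unfold euler_remainder, Rminus, Rdiv.
refine (Rle_trans _ _ _ (Rabs_triang _ _) _). apply Rplus_le_compat.
- refine (Rle_trans _ _ _ (Rabs_triang _ _) _).
  apply Rplus_le_compat; [now apply BK|].
  rewrite Rabs_Ropp, Rabs_mult, (Rabs_pos_eq (/ x)) by (left; apply Rinv_0_lt_compat; lra).
  apply Rle_div_l; [lra|]. nra.
- rewrite Rabs_mult, (Rabs_pos_eq (/ 2)); lra.
Qed.

Lemma euler_remainder_decay (f : R -> R) : tapered L f -> Derive f 0 = 0 ->
  exists C, 0 <= C /\
    forall x, 0 < x -> Rabs (euler_remainder L f x) <= C * (x / (1 + x)) ^ 3.
Proof.
intros Hf f'0. destruct (euler_maclaurin f Hf) as [C [hC BC]].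
destruct (euler_remainder_bounded f Hf) as [K [hK BK]].
exists (8 * (C + K)). split; [lra|]. intros x hx.
destruct (Rle_dec x 1) as [h|h].
- specialize (BC x (conj hx h)). rewrite f'0, Rmult_0_r, Rplus_0_r in BC.
  assert (hr : 0 <= x / 2 <= x / (1 + x)).
  { split; [lra|]. apply Rmult_le_compat_l; [lra|]. apply Rinv_le_contravar; lra. }
  apply pow_incr with (n := 3%nat) in hr.
  replace (C * x ^ 3) with (8 * C * (x / 2) ^ 3) in BC by field.
  refine (Rle_trans _ _ _ BC _). pose proof (pow_le (x / 2) 3 ltac:(lra)).
  apply Rmult_le_compat; lra.
- assert (hr : 0 <= / 2 <= x / (1 + x)) by (split; [lra|apply Rle_div_r; lra]).
  apply pow_incr with (n := 3%nat) in hr.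
  specialize (BK x ltac:(lra)). apply (Rmult_le_compat_l (8 * (C + K))) in hr; lra.
Qed.

End EulerRemainder.

(** * Riemann sums and the double sum *)

Lemma scaled_sum_le (g : nat -> R) (C x : R) : 0 < x -> 0 <= C ->
  (forall a, Rabs (g a) <= C / (1 + INR (S a) * x) ^ 2) ->
  forall M, Rabs (sum_n (fun a => x * g a) M) <= C.
Proof.
intros hx hC Hg.
assert (telescope : forall a, Rabs (x * g a)
    <= C * (/ (1 + INR a * x) - / (1 + INR (S a) * x))).
{ intros a. rewrite Rabs_mult, (Rabs_pos_eq x) by lra.
  apply Rle_trans with (x * (C / (1 + INR (S a) * x) ^ 2));
    [apply Rmult_le_compat_l; [lra|auto]|].
  pose proof (pos_INR a). assert (0 <= INR a * x) by nra. rewrite S_INR.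
  replace (x * (C / (1 + (INR a + 1) * x) ^ 2))
    with (C * (x * / (1 + (INR a + 1) * x) * / (1 + (INR a + 1) * x)))
    by (field; nra).
  replace (/ (1 + INR a * x) - / (1 + (INR a + 1) * x))
    with (x * / (1 + (INR a + 1) * x) * / (1 + INR a * x)) by (field; nra).
  apply Rmult_le_compat_l; [easy|]. apply Rmult_le_compat_l.
  - apply Rmult_le_pos; [lra|]. left. apply Rinv_0_lt_compat. nra.
  - apply Rinv_le_contravar; nra. }
assert (sharp : forall M, Rabs (sum_n (fun a => x * g a) M)
    <= C * (1 - / (1 + INR (S M) * x))).
{ induction M as [|M IH].
  - rewrite sum_O. refine (Rle_trans _ _ _ (telescope O) _).
    simpl (INR 0). rewrite Rmult_0_l, Rplus_0_r, Rinv_1. lra.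
  - rewrite sum_n_S. refine (Rle_trans _ _ _ (Rabs_triang _ _) _).
    specialize (telescope (S M)). lra. }
intros M. refine (Rle_trans _ _ _ (sharp M) _).
assert (0 < / (1 + INR (S M) * x)); [|nra].
apply Rinv_0_lt_compat. pose proof (pos_INR (S M)). nra.
Qed.

Lemma INR_S_mult_pos (a : nat) (x : R) : 0 < x -> 0 < INR (S a) * x.
Proof. intros hx. apply Rmult_lt_0_compat; [apply lt_0_INR; lia|easy]. Qed.

Section RiemannSum.

Variables (f f' F : R -> R) (C : R).
Hypothesis F_derive : forall t, 0 < t -> is_derive F t (- f t).
Hypothesis f_derive : forall t, 0 < t -> is_derive f t (f' t).
Hypothesis C_nonneg : 0 <= C.
Hypothesis f_bound : forall t, 0 < t -> Rabs (f t) <= C / (1 + t) ^ 2.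
Hypothesis f'_bound : forall t, 0 < t -> Rabs (f' t) <= C / (1 + t) ^ 2.
Hypothesis F_limit : is_lim F p_infty 0.

Lemma ex_series_riemann_sum (x : R) : 0 < x -> ex_series (fun a => f (INR (S a) * x)).
Proof.
intros hx. apply (ex_series_le (V := R_CompleteNormedModule)
  _ (fun a => C / x ^ 2 * / INR (S a) ^ 2)).
- intros a. pose proof (INR_S_mult_pos a x hx) as ha. refine (Rle_trans _ _ _ (f_bound _ ha) _).
  replace (C / x ^ 2 * / INR (S a) ^ 2) with (C / (INR (S a) * x) ^ 2).
  + apply Rmult_le_compat_l; [easy|].
    apply Rinv_le_contravar; [apply pow_lt; lra|]. apply pow_incr. lra.
  + field. split; [apply not_0_INR; lia|lra].
- apply (ex_series_scal_l (V := R_NormedModule)). now apply ex_series_inv_pow.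
Qed.

Lemma riemann_sum_bounded (x : R) : 0 < x -> Rabs (x * dilated_sum f x) <= C.
Proof.
intros hx. unfold dilated_sum. rewrite <- Series_scal_l. apply Rabs_Series_le.
- apply (ex_series_scal_l (V := R_NormedModule)). now apply ex_series_riemann_sum.
- apply scaled_sum_le; trivial. intros a. now apply f_bound, INR_S_mult_pos.
Qed.

Lemma riemann_cell_error (s x : R) : 0 < s -> 0 < x ->
  Rabs (F s - F (s + x) - x * f s) <= C / (1 + s) ^ 2 * x ^ 2.
Proof.
intros hs hx. assert (hp : 0 < (1 + s) ^ 2) by (apply pow_lt; lra).
assert (hC : 0 <= C / (1 + s) ^ 2) by (apply Rdiv_le_0_compat; lra).
apply (Rabs_le_pow_S_of_derive (fun t => F s - F (s + t) - t * f s)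
         (fun t => f (s + t) - f s)); trivial; [| | |lra].
- intros t ht. pose proof (F_derive (s + t) ltac:(lra)) as D.
  auto_derive; [eexists; exact D|]. rewrite (is_derive_unique_eta _ _ _ D). ring.
- rewrite Rplus_0_r. ring.
- apply (Rabs_le_pow_S_of_derive _ (fun t => f' (s + t))); trivial.
  + intros t ht. pose proof (f_derive (s + t) ltac:(lra)) as D.
    auto_derive; [eexists; exact D|]. rewrite (is_derive_unique_eta _ _ _ D). ring.
  + rewrite Rplus_0_r. ring.
  + intros t ht. rewrite pow_O, Rmult_1_r.
    refine (Rle_trans _ _ _ (f'_bound (s + t) ltac:(lra)) _).
    apply Rmult_le_compat_l; [easy|].
    apply Rinv_le_contravar; [easy|]. apply pow_incr. lra.
Qed.

Lemma is_series_telescoping (x : R) : 0 < x ->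
  is_series (fun a => F (INR (S a) * x) - F (INR (S (S a)) * x)) (F x).
Proof.
intros hx. assert (partial : forall M,
  F x - F (INR (S (S M)) * x) = sum_n (fun a => F (INR (S a) * x) - F (INR (S (S a)) * x)) M).
{ induction M as [|M IH]; [rewrite sum_O; simpl INR; now rewrite Rmult_1_l|].
  rewrite sum_n_S, <- IH. ring. }
apply (is_lim_seq_ext _ _ (F x) partial).
replace (F x) with (F x - 0) at 1 by ring.
apply is_lim_seq_minus'; [apply is_lim_seq_const|].
apply (is_lim_comp_seq F (fun M => INR (S (S M)) * x) p_infty 0 F_limit).
- now exists 0%nat.
- apply (is_lim_seq_incr_1 (fun M => INR (S M) * x)), (is_lim_seq_incr_1 (fun M => INR M * x)).
  replace p_infty with (Rbar_mult p_infty x)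
    by (simpl; destruct (Rle_dec 0 x); [|lra]; now destruct (Rle_lt_or_eq_dec 0 x r); [|lra]).
  apply is_lim_seq_scal_r, is_lim_seq_INR.
Qed.

Lemma riemann_sum_error (x : R) : 0 < x -> Rabs (x * dilated_sum f x - F x) <= C * x.
Proof.
intros hx.
set (g := fun a => (x * f (INR (S a) * x)
  - (F (INR (S a) * x) - F (INR (S (S a)) * x))) / x ^ 2).
assert (sum_g : is_series (fun a => x * g a) ((x * dilated_sum f x - F x) / x)).
{ assert (eg : forall a, / x * (x * f (INR (S a) * x)
    - (F (INR (S a) * x) - F (INR (S (S a)) * x))) = x * g a)
    by (intros a; unfold g; field; lra).
  apply (is_series_ext _ _ _ eg).
  replace ((x * dilated_sum f x - F x) / x) with (/ x * (x * dilated_sum f x - F x))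
    by (field; lra).
  apply (is_series_scal (V := R_NormedModule)).
  apply (is_series_minus (V := R_NormedModule)); [|now apply is_series_telescoping].
  apply (is_series_scal (V := R_NormedModule)).
  now apply Series_correct, ex_series_riemann_sum. }
replace (x * dilated_sum f x - F x) with ((x * dilated_sum f x - F x) / x * x)
  by (field; lra).
rewrite Rabs_mult, (Rabs_pos_eq x) by lra. apply Rmult_le_compat_r; [lra|].
rewrite <- (is_series_unique _ _ sum_g). apply Rabs_Series_le; [eexists; exact sum_g|].
apply scaled_sum_le; trivial. intros a. pose proof (INR_S_mult_pos a x hx) as ha.
pose proof (pow_lt x 2 hx).
unfold g, Rdiv at 1. rewrite Rabs_mult, (Rabs_pos_eq (/ x ^ 2))
  by (left; now apply Rinv_0_lt_compat).
apply Rle_div_l; [easy|]. rewrite Rabs_minus_sym, (S_INR (S a)), Rmult_plus_distr_r, Rmult_1_l.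
now apply riemann_cell_error.
Qed.

End RiemannSum.

(* [H' v / v] extends smoothly to [0], as for even [H]. *)
Record even_profile (L : R) (H h : R -> R) : Prop := {
  profile_tapered : tapered L H;
  profile_slope_tapered : tapered L h;
  profile_Derive : forall v, Derive H v = v * h v
}.

Definition has_slope_integral (L : R) (H : R -> R) (kappa : R) : Prop :=
  exists h, even_profile L H h /\ RInt h 0 L = kappa :> R.

Definition double_sum (H : R -> R) (x : R) : R :=
  Series (fun a => dilated_sum H (INR (S a) * x) / INR (S a) ^ 2).

Section DoubleSum.

Variables (L : R) (H h : R -> R).
Hypothesis L_pos : 0 < L.
Hypothesis H_profile : even_profile L H h.

Let slope_tail (v : R) : R := RInt h v L.

Let moment (v : R) : R := H v + v * slope_tail v.

Let density (x : R) : R := euler_remainder L H x / x ^ 2.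

Let density' (x : R) : R :=
  euler_remainder L (fun v => v * Derive H v) x / x ^ 3 - 2 * euler_remainder L H x / x ^ 3.

Let density_tail (x : R) : R := euler_remainder L moment x / x.

Local Lemma is_derive_slope_tail (v : R) : is_derive slope_tail v (- h v).
Proof.
assert (Ch : forall t, continuous h t)
  by (intros t; apply tapered_continuous with L, H_profile).
apply (is_derive_RInt' (V := R_NormedModule) h slope_tail v L); [|apply Ch].
apply filter_forall. intros t. apply (RInt_correct (V := R_CompleteNormedModule)).
now apply ex_RInt_continuous_R.
Qed.

Local Lemma tapered_slope_tail : tapered L slope_tail.
Proof.
destruct (profile_slope_tapered _ _ _ H_profile) as [Sh Zh]. split.
- apply smooth_antiderivative with (fun v => -1 * h v); [|now apply smooth_scal].
  intros v. replace (-1 * h v) with (- h v) by ring. apply is_derive_slope_tail.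
- intros v hv. unfold slope_tail.
  rewrite <- (opp_RInt_swap h L v), RInt_zero; [apply Ropp_0|easy|intros t ht; apply Zh; lra|].
  apply ex_RInt_continuous_R. intros; now apply smooth_continuous.
Qed.

Local Lemma tapered_moment : tapered L moment.
Proof.
apply tapered_plus; [apply H_profile|].
apply tapered_mult; [apply smooth_id|apply tapered_slope_tail].
Qed.

Local Lemma Derive_moment (v : R) : Derive moment v = slope_tail v.
Proof.
assert (is_derive_H : is_derive H v (v * h v)).
{ rewrite <- (profile_Derive _ _ _ H_profile). apply smooth_is_derive, H_profile. }
unfold moment. apply is_derive_unique. auto_derive.
- split; [eexists; exact is_derive_H|].
  split; [eexists; apply is_derive_slope_tail|exact I].
- rewrite (is_derive_unique_eta _ _ _ (is_derive_slope_tail v)).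
  rewrite (is_derive_unique_eta _ _ _ is_derive_H). ring.
Qed.

Local Lemma tapered_id_mult_Derive : tapered L (fun v => v * Derive H v).
Proof. apply tapered_mult; [apply smooth_id|apply tapered_Derive, H_profile]. Qed.

Local Lemma is_derive_density (x : R) : 0 < x -> is_derive density x (density' x).
Proof.
intros hx. pose proof (is_derive_euler_remainder L L_pos H x
  (profile_tapered _ _ _ H_profile) hx) as D.
unfold density. auto_derive; [split; [eexists; exact D|split; [nra|exact I]]|].
rewrite (is_derive_unique_eta _ _ _ D). unfold density'. field. lra.
Qed.

Local Lemma is_derive_density_tail (x : R) : 0 < x ->
  is_derive density_tail x (- density x).
Proof.
intros hx. pose proof (is_derive_euler_remainder L L_pos moment x tapered_moment hx) as D.
assert (e : euler_remainder L moment x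
  = euler_remainder L H x + euler_remainder L (fun v => v * Derive moment v) x).
{ rewrite <- euler_remainder_plus; trivial; [|apply H_profile|].
  - apply euler_remainder_ext. intros v. now rewrite Derive_moment.
  - apply tapered_mult; [apply smooth_id|apply tapered_Derive, tapered_moment]. }
unfold density_tail. auto_derive; [split; [eexists; exact D|split; [lra|exact I]]|].
rewrite (is_derive_unique_eta _ _ _ D), e. unfold density. field. lra.
Qed.

Local Lemma density_bounds : exists C, 0 <= C /\ forall x, 0 < x ->
  Rabs (density x) <= C / (1 + x) ^ 2 /\ Rabs (density' x) <= C / (1 + x) ^ 2.
Proof.
destruct (euler_remainder_decay L L_pos H) as [CH [hCH BH]];
  [apply H_profile|rewrite (profile_Derive _ _ _ H_profile); ring|].
destruct (euler_remainder_decay L L_pos (fun v => v * Derive H v) tapered_id_mult_Derive)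
  as [CD [hCD BD]].
{ rewrite (Derive_mult (fun v => v)), (profile_Derive _ _ _ H_profile); [ring| |].
  - apply ex_derive_id.
  - apply smooth_ex_derive, smooth_Derive, H_profile. }
exists (CD + 2 * CH). split; [lra|]. intros x hx. specialize (BH x hx). specialize (BD x hx).
assert (hq : 0 < / (1 + x) <= 1).
{ split; [apply Rinv_0_lt_compat; lra|]. rewrite <- Rinv_1. apply Rinv_le_contravar; lra. }
assert (hxq : x * / (1 + x) <= 1) by (apply Rle_div_l; lra).
unfold Rdiv in BH, BD |- *. rewrite <- !pow_inv. set (q := / (1 + x)) in *.
assert (hr : 0 < / x) by now apply Rinv_0_lt_compat.
assert (bound : forall u c, 0 <= c -> Rabs u <= c * (x * q) ^ 3 ->
  Rabs (u * / x ^ 3) <= c * q ^ 2 /\ Rabs (u * / x ^ 2) <= c * q ^ 2).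
{ intros u c hc hu. rewrite !Rabs_mult, <- !pow_inv, !(Rabs_pos_eq ((/ x) ^ _))
    by (apply pow_le; lra).
  apply (Rmult_le_compat_r ((/ x) ^ 2)) in hu; [|apply pow_le; lra].
  assert (e : c * (x * q) ^ 3 * (/ x) ^ 2 = c * q ^ 2 * (x * q)) by (field; lra).
  assert (hcq : 0 <= c * q ^ 2) by (apply Rmult_le_pos; [|apply pow_le]; lra).
  split; [|nra]. replace (Rabs u * (/ x) ^ 3) with (Rabs u * (/ x) ^ 2 * / x) by ring.
  apply Rle_trans with (c * q ^ 2 * (x * q) * / x).
  - apply Rmult_le_compat_r; lra.
  - replace (c * q ^ 2 * (x * q) * / x) with (c * q ^ 2 * q) by (field; lra). nra. }
destruct (bound _ _ hCH BH) as [BH3 BH2]. destruct (bound _ _ hCD BD) as [BD3 _].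
pose proof (Rabs_pos (euler_remainder L (fun v => v * Derive H v) x * / x ^ 3)).
pose proof (Rabs_pos (euler_remainder L H x * / x ^ 3)).
unfold density, density'. split.
- unfold Rdiv. nra.
- refine (Rle_trans _ _ _ (Rabs_triang _ _) _). unfold Rdiv.
  rewrite Rabs_Ropp, Rmult_assoc, (Rabs_mult 2), (Rabs_pos_eq 2) by lra. lra.
Qed.

Local Lemma density_tail_near_0 : exists C, 0 <= C /\ forall x, 0 < x <= 1 ->
  Rabs (density_tail x + RInt h 0 L / 12) <= C * x.
Proof.
destruct (euler_maclaurin L L_pos moment tapered_moment) as [C [hC BC]].
exists C. split; [exact hC|]. intros x hx. specialize (BC x hx).
rewrite Derive_moment in BC. change (slope_tail 0) with (RInt h 0 L : R) in BC.
unfold density_tail. apply Rmult_le_reg_l with x; [lra|].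
rewrite <- (Rabs_pos_eq x) at 1 by lra. rewrite <- Rabs_mult.
replace (x * (euler_remainder L moment x / x + RInt h 0 L / 12))
  with (euler_remainder L moment x + x / 12 * RInt h 0 L) by (field; lra).
refine (Rle_trans _ _ _ BC _). replace (C * x ^ 3) with (x * (C * x) * x) by ring.
assert (0 <= x * (C * x)) by (apply Rmult_le_pos; nra). nra.
Qed.

Local Lemma is_lim_density_tail : is_lim density_tail p_infty 0.
Proof.
destruct (euler_remainder_bounded L moment tapered_moment) as [K [hK BK]].
assert (lim : forall c, is_lim (fun x => c * / x) p_infty 0).
{ intros c. replace (Finite 0) with (Rbar_mult c 0) by (simpl; f_equal; ring).
  apply is_lim_scal_l. apply (is_lim_inv (fun x => x) p_infty p_infty); [apply is_lim_id|easy]. }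
apply (is_lim_le_le_loc (fun x => - K * / x) (fun x => K * / x)); [|apply lim|apply lim].
exists 1. intros x hx. specialize (BK x ltac:(lra)). apply Rabs_le_between in BK.
assert (0 < / x) by (apply Rinv_0_lt_compat; lra). unfold density_tail, Rdiv. split; nra.
Qed.

(* [eta x] is a Riemann sum of [density], whose tail integrals are [density_tail]. *)
Lemma double_sum_expansion : exists eta C,
  (forall x, 0 < x -> Rabs (eta x) <= C) /\
  filterlim eta (at_right 0) (locally (- (RInt h 0 L / 12))) /\
  (forall x, 0 < x ->
     double_sum H x = zeta 3 * RInt H 0 L / x - zeta 2 * H 0 / 2 + x * eta x).
Proof.
destruct density_bounds as [C [hC bounds]]. destruct density_tail_near_0 as [Ct [hCt near_0]].
exists (fun x => x * dilated_sum density x), (C + Ct).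
split; [|split].
- intros x hx. pose proof (riemann_sum_bounded density C hC
    (fun t ht => proj1 (bounds t ht)) x hx). lra.
- apply (filterlim_at_right_0_linear _ _ (C + Ct)); [lra|].
  intros x hx. specialize (near_0 x hx).
  pose proof (riemann_sum_error density density' density_tail C is_derive_density_tail
    is_derive_density hC (fun t ht => proj1 (bounds t ht)) (fun t ht => proj2 (bounds t ht))
    is_lim_density_tail x (proj1 hx)) as error.
  replace (x * dilated_sum density x - - (RInt h 0 L / 12))
    with ((x * dilated_sum density x - density_tail x) + (density_tail x + RInt h 0 L / 12))
    by ring.
  refine (Rle_trans _ _ _ (Rabs_triang _ _) _). lra.
- intros x hx. apply is_series_unique.
  set (c := RInt H 0 L : R).
  assert (e : forall a, (c / x * / INR (S a) ^ 3 + - (H 0 / 2) * / INR (S a) ^ 2)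
      + x ^ 2 * density (INR (S a) * x) = dilated_sum H (INR (S a) * x) / INR (S a) ^ 2).
  { intros a. unfold density, euler_remainder. fold c. field.
    split; [apply not_0_INR; lia|lra]. }
  apply (is_series_ext _ _ _ e).
  replace (zeta 3 * c / x - zeta 2 * H 0 / 2 + x * (x * dilated_sum density x))
    with ((c / x * zeta 3 + - (H 0 / 2) * zeta 2) + x ^ 2 * dilated_sum density x)
    by (field; lra).
  repeat apply (is_series_plus (V := R_NormedModule));
    apply (is_series_scal (V := R_NormedModule)), Series_correct.
  + now apply ex_series_inv_pow; lia.
  + now apply ex_series_inv_pow.
  + now apply (ex_series_riemann_sum density C hC (fun t ht => proj1 (bounds t ht))).
Qed.

End DoubleSum.

(** * Weights supported on prime divisors *)

Definition prime_factor (c : R -> R) (n r : nat) : R :=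
  if prime_dec (Z.of_nat n) then
    if Zdivide_dec (Z.of_nat n) (Z.of_nat r) then 1 + c (INR n) else 1
  else 1.

Definition prime_weight (c : R -> R) (N r : nat) : R :=
  prod_f_R0 (fun n => prime_factor c n r) N.

Lemma prime_nat_ge_2 (n : nat) : prime (Z.of_nat n) -> (2 <= n)%nat.
Proof. intros hn. apply prime_ge_2 in hn. lia. Qed.

Lemma prime_INR_ge_2 (n : nat) : prime (Z.of_nat n) -> 2 <= INR n.
Proof. intros hn. apply prime_nat_ge_2 in hn. now apply le_INR in hn. Qed.

Lemma prime_factor_divisor (c : R -> R) (n r : nat) : prime (Z.of_nat n) ->
  (Z.of_nat n | Z.of_nat r)%Z -> prime_factor c n r = 1 + c (INR n).
Proof.
intros hp hd. unfold prime_factor.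
destruct (prime_dec _); [|easy]. now destruct (Zdivide_dec _ _).
Qed.

Lemma prime_factor_not_divisor (c : R -> R) (n r : nat) :
  ~ (Z.of_nat n | Z.of_nat r)%Z -> prime_factor c n r = 1.
Proof.
intros hd. unfold prime_factor.
destruct (prime_dec _); [|easy]. now destruct (Zdivide_dec _ _).
Qed.

Lemma prime_factor_not_prime (c : R -> R) (n r : nat) : ~ prime (Z.of_nat n) ->
  prime_factor c n r = 1.
Proof. intros hp. unfold prime_factor. now destruct (prime_dec _). Qed.

Lemma prime_weight_0 (c : R -> R) (r : nat) : prime_weight c 0 r = 1.
Proof. exact (prime_factor_not_prime c 0 r not_prime_0). Qed.

Lemma prime_weight_S (c : R -> R) (N r : nat) :
  prime_weight c (S N) r = prime_weight c N r * prime_factor c (S N) r.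
Proof. reflexivity. Qed.

Lemma prime_weight_bounded (c : R -> R) (N : nat) :
  exists K, forall r, Rabs (prime_weight c N r) <= K.
Proof.
induction N as [|N [K IH]].
- exists 1. intros r. rewrite prime_weight_0, Rabs_R1. lra.
- exists (K * (1 + Rabs (c (INR (S N))))). intros r.
  rewrite prime_weight_S, Rabs_mult.
  apply Rmult_le_compat; try apply Rabs_pos; [apply IH|].
  pose proof (Rabs_pos (c (INR (S N)))). unfold prime_factor.
  destruct (prime_dec _); [destruct (Zdivide_dec _ _)|]; rewrite ?Rabs_R1; try lra.
  refine (Rle_trans _ _ _ (Rabs_triang _ _) _). rewrite Rabs_R1. lra.
Qed.

Lemma prime_weight_ext (c : R -> R) (N r s : nat) :
  (forall n, (n <= N)%nat -> prime (Z.of_nat n) ->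
     ((Z.of_nat n | Z.of_nat r) <-> (Z.of_nat n | Z.of_nat s))%Z) ->
  prime_weight c N r = prime_weight c N s.
Proof.
induction N as [|N IH]; intros H; [now rewrite !prime_weight_0|].
rewrite !prime_weight_S, IH by (intros; apply H; [lia|easy]). f_equal.
unfold prime_factor. destruct (prime_dec _) as [h|h]; [|reflexivity].
specialize (H (S N) (le_n _) h). destruct (Zdivide_dec _ _), (Zdivide_dec _ _); tauto.
Qed.

Lemma prime_weight_mult_prime (c : R -> R) (N p r : nat) : (N < p)%nat ->
  prime (Z.of_nat p) -> prime_weight c N (p * r) = prime_weight c N r.
Proof.
intros hN hp. apply prime_weight_ext. intros n hn pn. rewrite Nat2Z.inj_mul. split.
- intros h. destruct (prime_mult _ pn _ _ h) as [h'|h']; [|exact h'].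
  apply (prime_div_prime _ _ pn hp) in h'. lia.
- intros h. now apply Z.divide_mul_r.
Qed.

Lemma prime_weight_stable (c : R -> R) (N r : nat) : (1 <= r <= N)%nat ->
  prime_weight c N r = prime_weight c r r.
Proof.
intros [hr hN]. induction hN as [|N hN IH]; [reflexivity|].
rewrite prime_weight_S, IH, prime_factor_not_divisor; [ring|].
intros h. apply Z.divide_pos_le in h; lia.
Qed.

Lemma prime_weight_1 (c : R -> R) (N : nat) : prime_weight c N 1 = 1.
Proof.
induction N as [|N IH]; [apply prime_weight_0|]. rewrite prime_weight_S, IH.
destruct (prime_dec (Z.of_nat (S N))) as [h|h].
- rewrite prime_factor_not_divisor; [ring|]. apply prime_nat_ge_2 in h.
  intros hd. apply Z.divide_pos_le in hd; lia.
- rewrite prime_factor_not_prime by easy. ring.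
Qed.

Lemma exists_prime_divisor (r : nat) : (2 <= r)%nat ->
  exists p, (p <= r)%nat /\ prime (Z.of_nat p) /\ (Z.of_nat p | Z.of_nat r)%Z.
Proof.
induction r as [r IH] using (well_founded_induction lt_wf). intros hr.
destruct (prime_dec (Z.of_nat r)) as [h|h].
- exists r. split; [lia|]. split; [easy|]. apply Z.divide_refl.
- destruct (not_prime_divide (Z.of_nat r)) as [d [hd hdr]]; [lia|easy|].
  destruct (IH (Z.to_nat d)) as [p [hpd [hp hdiv]]]; [lia|lia|].
  exists p. split; [lia|]. split; [easy|].
  rewrite Z2Nat.id in hdiv by lia. now apply Z.divide_trans with d.
Qed.

(* The indicator of the integers without prime divisor up to [N]. *)
Definition sieve_weight : nat -> nat -> R := prime_weight (fun _ => -1).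

Lemma sieve_weight_0 (N r : nat) : (2 <= r <= N)%nat -> sieve_weight N r = 0.
Proof.
intros [hr hN]. destruct (exists_prime_divisor r hr) as [p [hpr [hp hdiv]]].
assert (hpN : (p <= N)%nat) by lia. clear hN hpr.
unfold sieve_weight. induction hpN as [|N _ IH].
- destruct p as [|p]; [now apply not_prime_0 in hp|].
  rewrite prime_weight_S, prime_factor_divisor by easy. ring.
- rewrite prime_weight_S, IH. ring.
Qed.

Lemma sieve_weight_bounds (N r : nat) : 0 <= sieve_weight N r <= 1.
Proof.
unfold sieve_weight. induction N as [|N IH]; [rewrite prime_weight_0; lra|].
rewrite prime_weight_S. unfold prime_factor.
destruct (prime_dec _); [destruct (Zdivide_dec _ _)|]; lra.
Qed.

(** * Series over multiples *)

Lemma sum_n_m_last (u : nat -> R) (a b : nat) : (a <= b)%nat ->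
  (forall i, (a <= i < b)%nat -> u i = 0) -> sum_n_m u a b = u b :> R.
Proof.
intros hab Hz. destruct (Nat.eq_dec a b) as [->|ne]; [apply sum_n_n|].
destruct b as [|b]; [lia|]. rewrite sum_n_Sm by lia.
rewrite (sum_n_m_ext_loc u (fun _ => zero)) by (intros; apply Hz; lia).
rewrite sum_n_m_const_zero. apply Rplus_0_l.
Qed.

Definition restrict_multiples (p : nat) (G : nat -> R) (r : nat) : R :=
  if Zdivide_dec (Z.of_nat p) (Z.of_nat r) then G r else 0.

Lemma restrict_multiples_mult (p : nat) (G : nat -> R) (r : nat) :
  restrict_multiples p G (p * r) = G (p * r)%nat.
Proof.
unfold restrict_multiples. destruct (Zdivide_dec _ _) as [_|h]; [easy|].
exfalso. apply h. exists (Z.of_nat r). lia.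
Qed.

Lemma restrict_multiples_between (p : nat) (G : nat -> R) (r m : nat) :
  (p * m < r < p * S m)%nat -> restrict_multiples p G r = 0.
Proof.
intros hr. unfold restrict_multiples. destruct (Zdivide_dec _ _) as [[z hz]|_]; [|easy].
assert (Z.of_nat m < z)%Z by nia. assert (z < Z.of_nat (S m))%Z by nia. lia.
Qed.

Lemma sum_n_multiples (p : nat) (G : nat -> R) (M : nat) : (1 <= p)%nat ->
  sum_n (fun r => restrict_multiples p G (S r)) (p * S M - 1)
  = sum_n (fun r => G (p * S r)%nat) M :> R.
Proof.
intros hp.
assert (block : forall m, sum_n_m (fun r => restrict_multiples p G (S r))
  (p * m) (p * S m - 1) = G (p * S m)%nat :> R).
{ intros m. rewrite sum_n_m_last; [|lia|].
  - replace (S (p * S m - 1)) with (p * S m)%nat by lia. apply restrict_multiples_mult.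
  - intros i hi. apply (restrict_multiples_between p G (S i) m). lia. }
induction M as [|M IH].
- rewrite sum_O. unfold sum_n. rewrite <- (block 0%nat). now rewrite Nat.mul_0_r.
- rewrite sum_n_S, <- IH, <- block. unfold sum_n.
  rewrite (sum_n_m_Chasles _ 0 (p * S M - 1) (p * S (S M) - 1)) by lia.
  now replace (S (p * S M - 1)) with (p * S M)%nat by lia.
Qed.

Lemma ex_series_Rabs_bounded_mult (w u : nat -> R) (K : R) :
  (forall n, Rabs (w n) <= K) -> ex_series (fun n => Rabs (u n)) ->
  ex_series (fun n => Rabs (w n * u n)).
Proof.
intros hw hu. apply (ex_series_le (V := R_CompleteNormedModule) _ (fun n => K * Rabs (u n))).
- intros n. change (norm ?t) with (Rabs t). rewrite Rabs_Rabsolu, Rabs_mult.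
  apply Rmult_le_compat_r; [apply Rabs_pos|apply hw].
- now apply (ex_series_scal_l (V := R_NormedModule)).
Qed.

Lemma ex_series_Rabs_restrict_multiples (p : nat) (G : nat -> R) :
  ex_series (fun r => Rabs (G (S r))) ->
  ex_series (fun r => Rabs (restrict_multiples p G (S r))).
Proof.
intros hG. apply ex_series_ext with (fun r =>
  Rabs ((if Zdivide_dec (Z.of_nat p) (Z.of_nat (S r)) then 1 else 0) * G (S r))).
- intros r. f_equal. unfold restrict_multiples.
  destruct (Zdivide_dec _ _); [apply Rmult_1_l|apply Rmult_0_l].
- apply (ex_series_Rabs_bounded_mult _ _ 1); [|easy]. intros r.
  destruct (Zdivide_dec _ _); [rewrite Rabs_R1|rewrite Rabs_R0]; lra.
Qed.

Lemma Series_multiples (p : nat) (G : nat -> R) : (1 <= p)%nat ->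
  ex_series (fun r => Rabs (G (S r))) ->
  Series (fun r => restrict_multiples p G (S r)) = Series (fun r => G (p * S r)%nat).
Proof.
intros hp hG.
pose proof (ex_series_Rabs _ (ex_series_Rabs_restrict_multiples p G hG)) as hu.
symmetry. apply is_series_unique.
apply (is_lim_seq_ext _ _ (Series (fun r => restrict_multiples p G (S r)))
  (fun M => sum_n_multiples p G M hp)).
apply (is_lim_seq_subseq _ _ (fun M => (p * S M - 1)%nat)).
- apply eventually_subseq. intros n. nia.
- exact (Series_correct _ hu).
Qed.

Lemma Series_prime_weight_S (c : R -> R) (N : nat) (G : nat -> R) :
  prime (Z.of_nat (S N)) -> ex_series (fun r => Rabs (G (S r))) ->
  Series (fun r => prime_weight c (S N) (S r) * G (S r))
  = Series (fun r => prime_weight c N (S r) * G (S r))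
    + c (INR (S N)) * Series (fun r => prime_weight c N (S r) * G (S N * S r)%nat).
Proof.
intros hp hG. destruct (prime_weight_bounded c N) as [K BK].
set (W := fun r => prime_weight c N r * G r).
assert (hW : ex_series (fun r => Rabs (W (S r))))
  by now apply (ex_series_Rabs_bounded_mult (fun r => prime_weight c N (S r)) _ K).
transitivity (Series (fun r =>
  W (S r) + c (INR (S N)) * restrict_multiples (S N) W (S r))).
- apply Series_ext. intros r. unfold W, restrict_multiples.
  rewrite prime_weight_S. unfold prime_factor.
  destruct (prime_dec _); [|easy]. destruct (Zdivide_dec _ _); ring.
- rewrite Series_plus, Series_scal_l, Series_multiples; [|lia|easy| |].
  + f_equal. f_equal. apply Series_ext. intros r. unfold W.
    now rewrite prime_weight_mult_prime by (easy || lia).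
  + now apply ex_series_Rabs.
  + apply (ex_series_scal_l (V := R_NormedModule)).
    now apply ex_series_Rabs, ex_series_Rabs_restrict_multiples.
Qed.

(** * Products over primes *)

Definition inv_square_bounded (A : R) (f : R -> R) : Prop :=
  forall p, 2 <= p -> Rabs (f p) <= A * / p ^ 2.

(* The term of index [0] of [sum 1 / n^2] vanishes, since [/ 0 = 0]. *)
Lemma inv_square_nonneg (n : nat) : 0 <= / INR n ^ 2.
Proof.
destruct n as [|n]; [simpl; rewrite Rmult_0_l, Rinv_0; lra|].
left. apply inv_INR_S_pow_pos.
Qed.

Lemma ex_series_inv_square : ex_series (fun n => / INR n ^ 2).
Proof. apply (ex_series_incr_1 (V := R_NormedModule)). now apply ex_series_inv_pow. Qed.

Lemma sum_n_le_Series (u : nat -> R) (M : nat) : (forall n, 0 <= u n) ->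
  ex_series u -> sum_n u M <= Series u.
Proof.
intros hu hs.
apply (is_lim_seq_incr_compare (sum_n u) (Series u) (Series_correct u hs)).
intros n. rewrite sum_n_S. specialize (hu (S n)). lra.
Qed.

Lemma exp_le (x y : R) : x <= y -> exp x <= exp y.
Proof. intros [h|h]; [left; now apply exp_increasing|rewrite h; lra]. Qed.

Lemma prime_product_upto_0 (f : R -> R) : prime_product_upto 0 f = 1.
Proof.
unfold prime_product_upto; simpl. destruct (prime_dec 0) as [h|h]; [|reflexivity].
now apply not_prime_0 in h.
Qed.

Lemma prime_product_upto_S (f : R -> R) (N : nat) :
  prime_product_upto (S N) f = prime_product_upto N f
    * (if prime_dec (Z.of_nat (S N)) then f (INR (S N)) else 1).
Proof. reflexivity. Qed.

Lemma prime_product_upto_ext (f g : R -> R) (N : nat) :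
  (forall p, 2 <= p -> f p = g p) -> prime_product_upto N f = prime_product_upto N g.
Proof.
intros e. induction N as [|N IH]; [now rewrite !prime_product_upto_0|].
rewrite !prime_product_upto_S, IH. f_equal.
destruct (prime_dec (Z.of_nat (S N))) as [h|h]; [|reflexivity].
apply e. now apply prime_INR_ge_2.
Qed.

Lemma prime_product_upto_mult (f g : R -> R) (N : nat) :
  prime_product_upto N f * prime_product_upto N g
  = prime_product_upto N (fun p => f p * g p).
Proof.
induction N as [|N IH]; [rewrite !prime_product_upto_0; ring|].
rewrite !prime_product_upto_S, <- IH.
destruct (prime_dec (Z.of_nat (S N))); ring.
Qed.

Section PrimeProduct.

Variables (f : R -> R) (A : R).
Hypothesis A_nonneg : 0 <= A.
Hypothesis f_near_1 : inv_square_bounded A (fun p => f p - 1).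

Lemma prime_product_upto_le_exp (N : nat) :
  Rabs (prime_product_upto N f) <= exp (A * sum_n (fun n => / INR n ^ 2) N).
Proof.
induction N as [|N IH].
- rewrite prime_product_upto_0, Rabs_R1, <- exp_0.
  rewrite sum_O. simpl. rewrite Rmult_0_l, Rinv_0, Rmult_0_r. lra.
- rewrite prime_product_upto_S, sum_n_S, Rmult_plus_distr_l, exp_plus, Rabs_mult.
  pose proof (inv_square_nonneg (S N)).
  apply Rmult_le_compat; try apply Rabs_pos; [exact IH|].
  apply Rle_trans with (1 + A * / INR (S N) ^ 2); [|apply exp_ineq1_le].
  destruct (prime_dec (Z.of_nat (S N))) as [h|h].
  + specialize (f_near_1 _ (prime_INR_ge_2 _ h)).
    replace (f (INR (S N))) with (1 + (f (INR (S N)) - 1)) by ring.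
    refine (Rle_trans _ _ _ (Rabs_triang _ _) _). rewrite Rabs_R1. lra.
  + rewrite Rabs_R1. nra.
Qed.

Lemma prime_product_upto_bounded :
  exists K, 0 < K /\ forall N, Rabs (prime_product_upto N f) <= K.
Proof.
exists (exp (A * Series (fun n => / INR n ^ 2))). split; [apply exp_pos|]. intros N.
refine (Rle_trans _ _ _ (prime_product_upto_le_exp N) _).
apply exp_le, Rmult_le_compat_l; [easy|].
apply sum_n_le_Series; [apply inv_square_nonneg|apply ex_series_inv_square].
Qed.

Lemma is_lim_seq_prime_product :
  is_lim_seq (fun N => prime_product_upto N f) (prime_product f).
Proof.
apply Lim_seq_correct'. destruct prime_product_upto_bounded as [K [hK BK]].
set (P := fun N => prime_product_upto N f).
assert (increments : ex_series (fun n => P (S n) - P n)).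
{ apply (ex_series_le (V := R_CompleteNormedModule) _ (fun n => K * A * / INR (S n) ^ 2)).
  - intros n. change (norm ?t) with (Rabs t). unfold P. rewrite prime_product_upto_S.
    destruct (prime_dec (Z.of_nat (S n))) as [h|h].
    + replace (prime_product_upto n f * f (INR (S n)) - prime_product_upto n f)
        with (prime_product_upto n f * (f (INR (S n)) - 1)) by ring.
      rewrite Rabs_mult, Rmult_assoc.
      apply Rmult_le_compat; try apply Rabs_pos; [apply BK|].
      now apply f_near_1, prime_INR_ge_2.
    + rewrite Rmult_1_r, Rminus_diag, Rabs_R0.
      pose proof (inv_square_nonneg (S n)). apply Rmult_le_pos; nra.
  - apply (ex_series_scal_l (V := R_NormedModule)). now apply ex_series_inv_pow. }
destruct increments as [l hl]. exists (P 0%nat + l). apply is_lim_seq_incr_1.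
apply is_lim_seq_ext with (fun N => P 0%nat + sum_n (fun n => P (S n) - P n) N).
- induction n as [|n IH]; [rewrite sum_O; ring|].
  rewrite sum_n_S, <- Rplus_assoc, IH. ring.
- apply is_lim_seq_plus'; [apply is_lim_seq_const|exact hl].
Qed.

End PrimeProduct.

(** * Dilation operators *)

(* The product over the primes [p <= N] of [1 + t1(p) T_p + t2(p) T_p^2], where
   [T_p f(x) = f(p x)]. *)
Fixpoint dilation_op (t1 t2 : R -> R) (N : nat) (f : R -> R) (x : R) : R :=
  match N with
  | O => f x
  | S M =>
    if prime_dec (Z.of_nat (S M)) then
      let p := INR (S M) in
      dilation_op t1 t2 M f x + t1 p * dilation_op t1 t2 M f (p * x)
      + t2 p * dilation_op t1 t2 M f (p * (p * x))
    else dilation_op t1 t2 M f x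
  end.

Lemma dilation_op_S_prime (t1 t2 : R -> R) (N : nat) (f : R -> R) (x : R) :
  prime (Z.of_nat (S N)) -> let p := INR (S N) in
  dilation_op t1 t2 (S N) f x = dilation_op t1 t2 N f x
    + t1 p * dilation_op t1 t2 N f (p * x) + t2 p * dilation_op t1 t2 N f (p * (p * x)).
Proof. intros h p. cbn [dilation_op]. now destruct (prime_dec _). Qed.

Lemma dilation_op_S_not_prime (t1 t2 : R -> R) (N : nat) (f : R -> R) (x : R) :
  ~ prime (Z.of_nat (S N)) -> dilation_op t1 t2 (S N) f x = dilation_op t1 t2 N f x.
Proof. intros h. cbn [dilation_op]. now destruct (prime_dec _). Qed.

Lemma dilation_op_ext (P : R -> Prop) (t1 t2 : R -> R) (N : nat) (f g : R -> R) :
  (forall p x, 2 <= p -> P x -> P (p * x)) -> (forall x, P x -> f x = g x) ->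
  forall x, P x -> dilation_op t1 t2 N f x = dilation_op t1 t2 N g x.
Proof.
intros stable e. induction N as [|N IH]; intros x hx; [now apply e|].
destruct (prime_dec (Z.of_nat (S N))) as [h|h].
- rewrite !dilation_op_S_prime by easy. apply prime_INR_ge_2 in h. rewrite !IH; auto.
- rewrite !dilation_op_S_not_prime; auto.
Qed.

Lemma dilation_op_linear (t1 t2 : R -> R) (N : nat) (f g : R -> R) (a b x : R) :
  dilation_op t1 t2 N (fun y => a * f y + b * g y) x
  = a * dilation_op t1 t2 N f x + b * dilation_op t1 t2 N g x.
Proof.
revert x. induction N as [|N IH]; intros x; [reflexivity|].
cbn [dilation_op]. destruct (prime_dec _) as [_|_]; [|apply IH].
cbv zeta. rewrite !IH. ring.
Qed.

Lemma dilation_op_dilate (t1 t2 : R -> R) (N : nat) (f : R -> R) (a x : R) :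
  dilation_op t1 t2 N (fun y => f (a * y)) x = dilation_op t1 t2 N f (a * x).
Proof.
revert x. induction N as [|N IH]; intros x; [reflexivity|].
cbn [dilation_op]. destruct (prime_dec _) as [_|_]; [|apply IH].
cbv zeta. rewrite !IH. set (p := INR (S N)).
replace (a * (p * (p * x))) with (p * (p * (a * x))) by ring.
now replace (a * (p * x)) with (p * (a * x)) by ring.
Qed.

Lemma dilation_op_comp (a b : R -> R) (N : nat) (f : R -> R) (x : R) :
  dilation_op a (fun _ => 0) N (dilation_op b (fun _ => 0) N f) x
  = dilation_op (fun p => a p + b p) (fun p => a p * b p) N f x.
Proof.
revert x. induction N as [|N IH]; intros x; [reflexivity|].
set (g := dilation_op b (fun _ => 0) N f) in *.
destruct (prime_dec (Z.of_nat (S N))) as [h|h].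
- set (p := INR (S N)).
  assert (first_order : forall y, dilation_op a (fun _ => 0) N
      (dilation_op b (fun _ => 0) (S N) f) y
    = dilation_op a (fun _ => 0) N g y + b p * dilation_op a (fun _ => 0) N g (p * y)).
  { intros y. rewrite <- (dilation_op_dilate a _ N g p y).
    rewrite <- (Rmult_1_l (dilation_op a (fun _ => 0) N g y)), <- dilation_op_linear.
    apply (dilation_op_ext (fun _ => True)); [easy| |exact I].
    intros z _. rewrite dilation_op_S_prime by easy. fold g p. ring. }
  rewrite !dilation_op_S_prime by easy. fold p. rewrite !first_order, !IH. ring.
- rewrite !dilation_op_S_not_prime, <- IH by easy.
  apply (dilation_op_ext (fun _ => True)); [easy| |exact I].
  intros z _. now apply dilation_op_S_not_prime.
Qed.

Lemma dilation_op_const (t1 t2 : R -> R) (N : nat) (k x : R) :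
  dilation_op t1 t2 N (fun _ => k) x
  = k * prime_product_upto N (fun p => 1 + t1 p + t2 p).
Proof.
revert x. induction N as [|N IH]; intros x.
- rewrite prime_product_upto_0. simpl. ring.
- rewrite prime_product_upto_S. cbn [dilation_op].
  destruct (prime_dec _); cbv zeta; rewrite !IH; ring.
Qed.

Lemma dilation_op_homogeneous (t1 t2 m q f : R -> R) (N : nat) (x : R) : 0 < x ->
  (forall p y, 2 <= p -> 0 < y -> m (p * y) = q p * m y) ->
  dilation_op t1 t2 N (fun y => m y * f y) x
  = m x * dilation_op (fun p => q p * t1 p) (fun p => q p ^ 2 * t2 p) N f x.
Proof.
intros hx hm. revert x hx. induction N as [|N IH]; intros x hx; [reflexivity|].
destruct (prime_dec (Z.of_nat (S N))) as [h|h].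
- rewrite !dilation_op_S_prime by easy. apply prime_INR_ge_2 in h. set (p := INR (S N)) in *.
  assert (0 < p * x) by nra. assert (0 < p * (p * x)) by nra.
  rewrite !IH, !hm by easy. ring.
- rewrite !dilation_op_S_not_prime by easy. now apply IH.
Qed.

Lemma Series_prime_weight (c e : R -> R) (F : R -> nat -> R) :
  (forall x, 0 < x -> ex_series (fun r => Rabs (F x (S r)))) ->
  (forall (p r : nat) x, (2 <= p)%nat -> (1 <= r)%nat -> 0 < x ->
     F x (p * r)%nat = e (INR p) * F (INR p * x) r) ->
  forall N x, 0 < x ->
  Series (fun r => prime_weight c N (S r) * F x (S r))
  = dilation_op (fun p => c p * e p) (fun _ => 0) N (fun y => Series (fun r => F y (S r))) x.
Proof.
intros summable homogeneous. induction N as [|N IH]; intros x hx.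
- apply Series_ext. intros r. rewrite prime_weight_0. ring.
- destruct (prime_dec (Z.of_nat (S N))) as [h|h].
  + rewrite dilation_op_S_prime, Series_prime_weight_S by auto.
    pose proof (prime_INR_ge_2 _ h). pose proof (prime_nat_ge_2 _ h).
    rewrite <- !IH by (repeat apply Rmult_lt_0_compat; lra).
    rewrite (Series_ext (fun r => prime_weight c N (S r) * F x (S N * S r)%nat)
      (fun r => e (INR (S N)) * (prime_weight c N (S r) * F (INR (S N) * x) (S r)))).
    * rewrite Series_scal_l. ring.
    * intros r. rewrite homogeneous by (easy || lia). ring.
  + rewrite dilation_op_S_not_prime, <- IH by easy. apply Series_ext. intros r.
    rewrite prime_weight_S, prime_factor_not_prime by easy. ring.
Qed.

Lemma filterlim_Rmult_at_right_0 (p : R) : 0 < p ->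
  filterlim (Rmult p) (at_right 0) (at_right 0).
Proof.
intros hp P [d Hd]. assert (hdp : 0 < d / p) by (apply Rdiv_lt_0_compat; [apply cond_pos|easy]).
exists (mkposreal _ hdp). intros x hx h0. change (Rabs (x - 0) < d / p) in hx.
apply Hd; [|now apply Rmult_lt_0_compat]. change (Rabs (p * x - 0) < d).
apply Rlt_div_r in hx; [|easy]. rewrite Rminus_0_r in hx |- *.
rewrite Rabs_mult, (Rabs_pos_eq p) by lra. lra.
Qed.

Section DilationBounds.

Variables (t1 t2 : R -> R) (A : R).
Hypothesis A_nonneg : 0 <= A.
Hypothesis coefficients_bound : inv_square_bounded A (fun p => Rabs (t1 p) + Rabs (t2 p)).

Lemma Rabs_dilation_step_le (p u v B : R) : 2 <= p -> Rabs u <= B -> Rabs v <= B ->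
  Rabs (t1 p * u + t2 p * v) <= B * (A * / p ^ 2).
Proof.
intros hp hu hv. specialize (coefficients_bound p hp). cbv beta in coefficients_bound.
pose proof (Rabs_pos (t1 p)). pose proof (Rabs_pos (t2 p)). pose proof (Rabs_pos u).
rewrite Rabs_pos_eq in coefficients_bound by lra.
refine (Rle_trans _ _ _ (Rabs_triang _ _) _). rewrite !Rabs_mult.
apply Rle_trans with (B * (Rabs (t1 p) + Rabs (t2 p))); [nra|].
apply Rmult_le_compat_l; lra.
Qed.

Lemma dilation_op_bounded : exists K, 0 < K /\
  forall (f : R -> R) (M : R), 0 <= M -> (forall x, 0 < x -> Rabs (f x) <= M) ->
  forall N x, 0 < x -> Rabs (dilation_op t1 t2 N f x) <= M * K.
Proof.
set (s := sum_n (fun n => / INR n ^ 2)).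
assert (growth : forall f M, 0 <= M -> (forall x, 0 < x -> Rabs (f x) <= M) ->
  forall N x, 0 < x -> Rabs (dilation_op t1 t2 N f x) <= M * exp (A * s N)).
{ intros f M hM hf. induction N as [|N IH]; intros x hx.
  - unfold s. rewrite sum_O. simpl. rewrite Rmult_0_l, Rinv_0, Rmult_0_r, exp_0, Rmult_1_r.
    now apply hf.
  - unfold s. rewrite sum_n_S. fold s. rewrite Rmult_plus_distr_l, exp_plus, <- Rmult_assoc.
    pose proof (inv_square_nonneg (S N)). pose proof (exp_ineq1_le (A * / INR (S N) ^ 2)).
    assert (hB : 0 <= M * exp (A * s N))
      by (apply Rmult_le_pos; [easy|left; apply exp_pos]).
    apply Rle_trans with (M * exp (A * s N) * (1 + A * / INR (S N) ^ 2));
      [|now apply Rmult_le_compat_l].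
    destruct (prime_dec (Z.of_nat (S N))) as [h|h].
    + rewrite dilation_op_S_prime, Rplus_assoc by easy. apply prime_INR_ge_2 in h.
      refine (Rle_trans _ _ _ (Rabs_triang _ _) _). rewrite Rmult_plus_distr_l, Rmult_1_r.
      apply Rplus_le_compat; [now apply IH|].
      apply Rabs_dilation_step_le; [easy|apply IH; nra|apply IH].
      repeat apply Rmult_lt_0_compat; lra.
    + rewrite dilation_op_S_not_prime by easy. specialize (IH x hx).
      assert (0 <= A * / INR (S N) ^ 2) by nra. nra. }
exists (exp (A * Series (fun n => / INR n ^ 2))). split; [apply exp_pos|].
intros f M hM hf N x hx. refine (Rle_trans _ _ _ (growth f M hM hf N x hx) _).
apply Rmult_le_compat_l; [easy|]. apply exp_le, Rmult_le_compat_l; [easy|].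
apply sum_n_le_Series; [apply inv_square_nonneg|apply ex_series_inv_square].
Qed.

Lemma dilation_op_vanishing (f : R -> R) (N : nat) :
  filterlim f (at_right 0) (locally 0) ->
  filterlim (dilation_op t1 t2 N f) (at_right 0) (locally 0).
Proof.
intros hf. induction N as [|N IH]; [exact hf|].
destruct (prime_dec (Z.of_nat (S N))) as [h|h].
- apply (filterlim_ext (fun x => dilation_op t1 t2 N f x
    + t1 (INR (S N)) * dilation_op t1 t2 N f (INR (S N) * x)
    + t2 (INR (S N)) * dilation_op t1 t2 N f (INR (S N) * (INR (S N) * x)))).
  { intros x. symmetry. now apply dilation_op_S_prime. }
  apply prime_INR_ge_2 in h. set (p := INR (S N)) in *.
  pose proof (filterlim_Rmult_at_right_0 p ltac:(lra)) as dilate.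
  pose proof (filterlim_comp _ _ _ _ _ _ _ _ dilate IH) as IHp.
  pose proof (filterlim_comp _ _ _ _ _ _ _ _ dilate IHp) as IHpp.
  replace 0 with (0 + t1 p * 0 + t2 p * 0) at 2 by ring.
  apply filterlim_Rplus; [typeclasses eauto| |].
  + apply filterlim_Rplus; [typeclasses eauto|exact IH|].
    now apply filterlim_Rscal.
  + now apply filterlim_Rscal.
- apply (filterlim_ext (dilation_op t1 t2 N f)); [|exact IH].
  intros x. symmetry. now apply dilation_op_S_not_prime.
Qed.

Lemma dilation_op_tail (f : R -> R) (B : R) : 0 <= B ->
  (forall N x, 0 < x -> Rabs (dilation_op t1 t2 N f x) <= B) ->
  forall N0 N x, (N0 <= N)%nat -> 0 < x ->
  Rabs (dilation_op t1 t2 N f x - dilation_op t1 t2 N0 f x)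
  <= B * A * (sum_n (fun n => / INR n ^ 2) N - sum_n (fun n => / INR n ^ 2) N0).
Proof.
intros hB BB N0 N x hN hx. induction hN as [|N hN IH].
- rewrite !Rminus_diag, Rabs_R0. lra.
- rewrite sum_n_S. set (s := sum_n _) in *. pose proof (inv_square_nonneg (S N)).
  assert (hBA : 0 <= B * A) by nra.
  destruct (prime_dec (Z.of_nat (S N))) as [h|h].
  + rewrite dilation_op_S_prime by easy. apply prime_INR_ge_2 in h.
    set (p := INR (S N)) in *.
    pose proof (Rabs_dilation_step_le p _ _ B h (BB N (p * x) ltac:(nra))
      (BB N (p * (p * x)) ltac:(repeat apply Rmult_lt_0_compat; lra))) as step.
    match goal with |- Rabs (?u + ?v + ?w - ?z) <= _ =>
      replace (u + v + w - z) with ((u - z) + (v + w)) by ring end.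
    refine (Rle_trans _ _ _ (Rabs_triang _ _) _). lra.
  + rewrite dilation_op_S_not_prime by easy.
    assert (0 <= B * A * / INR (S N) ^ 2) by now apply Rmult_le_pos. lra.
Qed.

Lemma dilation_op_vanishing_uniform (f : R -> R) (M : R) : 0 <= M ->
  (forall x, 0 < x -> Rabs (f x) <= M) -> filterlim f (at_right 0) (locally 0) ->
  forall e, 0 < e -> exists N0, at_right 0 (fun x =>
    forall N, (N0 <= N)%nat -> Rabs (dilation_op t1 t2 N f x) <= e).
Proof.
intros hM hf hv e he. destruct dilation_op_bounded as [K [hK BK]].
specialize (BK f M hM hf). set (Q := M * K * A).
assert (hMK : 0 <= M * K) by nra. assert (hQ : 0 <= Q) by now apply Rmult_le_pos.
set (s := sum_n (fun n => / INR n ^ 2)).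
assert (hs : exists N0, forall N, s N - s N0 <= e / 2 / (Q + 1)).
{ assert (he' : 0 < e / 2 / (Q + 1)) by (apply Rdiv_lt_0_compat; lra).
  destruct (proj1 (filterlim_locally_Rabs _ _ _)
    (Series_correct _ ex_series_inv_square) _ he') as [N0 HN0].
  exists N0. intros N. specialize (HN0 N0 (le_n _)). apply Rabs_le_between in HN0.
  change (sum_n _ N0) with (s N0) in HN0.
  assert (s N <= Series (fun n => / INR n ^ 2)); [|lra].
  apply sum_n_le_Series; [apply inv_square_nonneg|apply ex_series_inv_square]. }
destruct hs as [N0 hs]. exists N0.
assert (head := proj1 (filterlim_locally_Rabs (at_right 0) _ _)
  (dilation_op_vanishing f N0 hv) (e / 2) ltac:(lra)).
assert (right : at_right 0 (Rlt 0)) by (unfold at_right, within; now apply filter_forall).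
generalize (filter_and _ _ head right). apply filter_imp. intros x [hx0 hx] N hN.
pose proof (dilation_op_tail f _ hMK BK N0 N x hN hx) as tail. fold s Q in tail.
rewrite Rminus_0_r in hx0. specialize (hs N).
apply (Rmult_le_compat_l Q) in hs; [|easy].
assert (Q * (e / 2 / (Q + 1)) <= e / 2).
{ unfold Rdiv at 1. rewrite <- Rmult_assoc. apply Rle_div_l; [lra|]. nra. }
replace (dilation_op t1 t2 N f x) with
  ((dilation_op t1 t2 N f x - dilation_op t1 t2 N0 f x) + dilation_op t1 t2 N0 f x) by ring.
refine (Rle_trans _ _ _ (Rabs_triang _ _) _). lra.
Qed.

End DilationBounds.

(** * Euler products and local factors *)

Lemma zeta_pos (s : nat) : (2 <= s)%nat -> 0 < zeta s.
Proof.
intros hs. apply Rlt_le_trans with (sum_n (fun n => / INR (S n) ^ s) 0).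
- rewrite sum_O. apply inv_INR_S_pow_pos.
- apply sum_n_le_Series; [|now apply ex_series_inv_pow].
  intros n. left. apply inv_INR_S_pow_pos.
Qed.

Lemma sieve_series_bounds (u : nat -> R) (N : nat) : (forall r, 0 <= u r) -> ex_series u ->
  u 0%nat <= Series (fun r => sieve_weight (S N) (S r) * u r)
          <= u 0%nat + (Series u - sum_n u N).
Proof.
intros hu su. set (v := fun r => sieve_weight (S N) (S r) * u r).
assert (hv : forall r, 0 <= v r <= u r).
{ intros r. specialize (hu r). pose proof (sieve_weight_bounds (S N) (S r)).
  unfold v. nra. }
assert (v0 : v 0%nat = u 0%nat) by (unfold v, sieve_weight; rewrite prime_weight_1; ring).
assert (sv : ex_series v).
{ apply (ex_series_le (V := R_CompleteNormedModule) v u); [|exact su].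
  intros r. change (norm ?t) with (Rabs t). rewrite Rabs_pos_eq; apply hv. }
split.
- rewrite <- v0, <- (sum_O v). apply sum_n_le_Series; [apply hv|exact sv].
- assert (gap : sum_n (fun r => u r - v r) N = sum_n u N - u 0%nat :> R).
  { assert (prefix : forall M, (M <= N)%nat ->
      sum_n (fun r => u r - v r) M = sum_n u M - u 0%nat :> R).
    { induction M as [|M IH]; intros hM; [rewrite !sum_O, v0; ring|].
      rewrite !sum_n_S, IH by lia. unfold v. rewrite sieve_weight_0 by lia. ring. }
    now apply prefix. }
  assert (sum_n u N - u 0%nat <= Series u - Series v); [|lra].
  rewrite <- gap, <- Series_minus by easy. apply sum_n_le_Series.
  + intros r. specialize (hv r). lra.
  + now apply (ex_series_minus (V := R_NormedModule)).
Qed.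

Lemma Series_sieve_weight (s N : nat) : (2 <= s)%nat ->
  Series (fun r => sieve_weight N (S r) * / INR (S r) ^ s)
  = zeta s * prime_product_upto N (fun p => 1 - / p ^ s).
Proof.
intros hs. unfold sieve_weight.
rewrite (Series_prime_weight (fun _ => -1) (fun p => / p ^ s)
  (fun _ r => / INR r ^ s)) with (x := 1).
- rewrite (dilation_op_const _ _ N (zeta s)). f_equal.
  apply prime_product_upto_ext. intros p _. ring.
- intros x _. apply ex_series_ext with (fun r => / INR (S r) ^ s).
  + intros r. symmetry. apply Rabs_pos_eq. left. apply inv_INR_S_pow_pos.
  + now apply ex_series_inv_pow.
- intros p r x hp hr _. now rewrite mult_INR, Rpow_mult_distr, Rinv_mult.
- lra.
Qed.

Lemma euler_product (s : nat) : (2 <= s)%nat ->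
  is_lim_seq (fun N => prime_product_upto N (fun p => 1 - / p ^ s)) (/ zeta s).
Proof.
intros hs. pose proof (zeta_pos s hs) as hz. pose proof (ex_series_inv_pow s hs) as su.
assert (sieved : is_lim_seq
  (fun N => Series (fun r => sieve_weight N (S r) * / INR (S r) ^ s)) 1).
{ apply is_lim_seq_incr_1.
  apply is_lim_seq_le_le with (fun _ => 1)
    (fun N => 1 + (zeta s - sum_n (fun n => / INR (S n) ^ s) N)).
  - intros N. pose proof (sieve_series_bounds (fun r => / INR (S r) ^ s) N
      (fun r => Rlt_le _ _ (inv_INR_S_pow_pos r s)) su) as H.
    cbv beta in H. change (INR 1) with 1 in H. rewrite pow1, Rinv_1 in H. exact H.
  - apply is_lim_seq_const.
  - replace (Finite 1) with (Finite (1 + (zeta s - zeta s))) by (f_equal; ring).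
    apply is_lim_seq_plus'; [apply is_lim_seq_const|].
    apply is_lim_seq_minus'; [apply is_lim_seq_const|].
    exact (Series_correct _ su). }
apply is_lim_seq_ext with
  (fun N => / zeta s * Series (fun r => sieve_weight N (S r) * / INR (S r) ^ s)).
- intros N. rewrite Series_sieve_weight by easy. field. lra.
- replace (Finite (/ zeta s)) with (Rbar_mult (/ zeta s) 1) by (simpl; f_equal; ring).
  now apply is_lim_seq_scal_l.
Qed.

Definition nu_excess (p : R) : R := p ^ 2 / (p ^ 4 - 2 * p ^ 2 - p + 1).

Definition alpha_factor (p : R) : R :=
  (1 - p - 2 * p ^ 2 + p ^ 4) / (p ^ 4 - 2 * p ^ 2 + p).

Definition beta_factor (p : R) : R := (-1 + p ^ 2 + p ^ 3) / (p * (-1 + p + p ^ 2)).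

Definition gamma_factor (p : R) : R := p * (1 + p) / (-1 + p + p ^ 2).

(* The coefficients of [T_p] and [T_p^2] in [(1 + nu_excess p T_p) (1 - p^-2 T_p)]. *)
Definition local_coef1 (p : R) : R := nu_excess p * 1 + (-1) * / p ^ 2.

Definition local_coef2 (p : R) : R := nu_excess p * 1 * ((-1) * / p ^ 2).

Lemma prime_weight_nu_excess (N r : nat) : (1 <= r <= N)%nat ->
  prime_weight nu_excess N r = nu r.
Proof. intros hr. now rewrite prime_weight_stable. Qed.

Lemma local_denominators (p : R) : 2 <= p ->
  p ^ 4 / 4 <= p ^ 4 - 2 * p ^ 2 - p + 1 /\ 0 < p ^ 4 - 2 * p ^ 2 + p /\
  p ^ 2 <= -1 + p + p ^ 2.
Proof.
intros hp. assert (4 <= p ^ 2) by nra. replace (p ^ 4) with (p ^ 2 * p ^ 2) by ring.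
repeat split; nra.
Qed.

Lemma Rdiv_le_inv_square (a b A p : R) : 0 < b -> 0 < p -> a * p ^ 2 <= A * b ->
  a / b <= A * / p ^ 2.
Proof.
intros hb hp h. assert (0 < p ^ 2) by (apply pow_lt; lra).
apply Rle_div_l; [easy|]. apply Rmult_le_reg_r with (p ^ 2); [easy|].
replace (A * / p ^ 2 * b * p ^ 2) with (A * b) by (field; lra). exact h.
Qed.

Lemma alpha_factor_near_1 : inv_square_bounded 4 (fun p => alpha_factor p - 1).
Proof.
intros p hp. destruct (local_denominators p hp) as [_ [alpha_den _]].
replace (alpha_factor p - 1) with (- ((2 * p - 1) / (p ^ 4 - 2 * p ^ 2 + p)))
  by (unfold alpha_factor; field; lra).
rewrite Rabs_Ropp, Rabs_pos_eq by (apply Rdiv_le_0_compat; lra).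
apply Rdiv_le_inv_square; try lra. nra.
Qed.

Lemma beta_factor_near_1 : inv_square_bounded 4 (fun p => beta_factor p - 1).
Proof.
intros p hp. assert (0 < p * (-1 + p + p ^ 2)) by nra.
replace (beta_factor p - 1) with ((p - 1) / (p * (-1 + p + p ^ 2)))
  by (unfold beta_factor; field; nra).
rewrite Rabs_pos_eq by (apply Rdiv_le_0_compat; lra).
apply Rdiv_le_inv_square; try lra. nra.
Qed.

Lemma gamma_factor_near_1 : inv_square_bounded 4 (fun p => gamma_factor p - 1).
Proof.
intros p hp. replace (gamma_factor p - 1) with (1 / (-1 + p + p ^ 2))
  by (unfold gamma_factor; field; nra).
rewrite Rabs_pos_eq by (apply Rdiv_le_0_compat; nra).
apply Rdiv_le_inv_square; nra.
Qed.

Lemma local_coefs_bounded :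
  inv_square_bounded 10 (fun p => Rabs (p * local_coef1 p) + Rabs (p ^ 2 * local_coef2 p)).
Proof.
intros p hp. destruct (local_denominators p hp) as [nu_den _].
assert (hp4 : 16 <= p ^ 4)
  by (assert (4 <= p ^ 2) by nra; replace (p ^ 4) with (p ^ 2 * p ^ 2) by ring; nra).
assert (coef1_eq : p * local_coef1 p
  = (2 * p ^ 2 + p - 1) / (p * (p ^ 4 - 2 * p ^ 2 - p + 1)))
  by (unfold local_coef1, nu_excess; field; lra).
assert (coef2_eq : p ^ 2 * local_coef2 p = - (p ^ 2 / (p ^ 4 - 2 * p ^ 2 - p + 1)))
  by (unfold local_coef2, nu_excess; field; lra).
set (d := p ^ 4 - 2 * p ^ 2 - p + 1) in *.
assert (coef1_bounds : 0 <= p * local_coef1 p <= 6 * / p ^ 2).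
{ rewrite coef1_eq. split; [apply Rdiv_le_0_compat; nra|].
  apply Rdiv_le_inv_square; [nra|lra|].
  apply Rle_trans with (6 * (p * (p ^ 4 / 4))); [|nra].
  replace (6 * (p * (p ^ 4 / 4))) with (3 / 2 * p ^ 3 * p ^ 2) by field.
  apply Rmult_le_compat_r; nra. }
assert (coef2_bounds : 0 <= - (p ^ 2 * local_coef2 p) <= 4 * / p ^ 2).
{ rewrite coef2_eq, Ropp_involutive. split; [apply Rdiv_le_0_compat; nra|].
  apply Rdiv_le_inv_square; [lra|lra|].
  replace (p ^ 2 * p ^ 2) with (p ^ 4) by ring. lra. }
rewrite <- (Rabs_Ropp (p ^ 2 * local_coef2 p)), !Rabs_pos_eq by (rewrite ?Rabs_pos_eq; lra).
lra.
Qed.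

Lemma local_identity_linear (p : R) : 2 <= p ->
  alpha_factor p * (1 + p * local_coef1 p + p ^ 2 * local_coef2 p) = 1 - / p ^ 2.
Proof.
intros hp. destruct (local_denominators p hp) as [nu_den [alpha_den _]].
unfold alpha_factor, local_coef1, local_coef2, nu_excess. field. repeat split; nra.
Qed.

Lemma local_identity_const (p : R) : 2 <= p ->
  alpha_factor p * (1 + 1 * local_coef1 p + 1 ^ 2 * local_coef2 p)
  = beta_factor p * (1 - / p ^ 2).
Proof.
intros hp. destruct (local_denominators p hp) as [nu_den [alpha_den beta_den]].
unfold alpha_factor, beta_factor, local_coef1, local_coef2, nu_excess.
field. repeat split; nra.
Qed.

Lemma local_identity_inverse (p : R) : 2 <= p ->
  alpha_factor p * (1 + / p * local_coef1 p + (/ p) ^ 2 * local_coef2 p)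
  = gamma_factor p * ((1 - / p ^ 2) * (1 - / p ^ 3)).
Proof.
intros hp. destruct (local_denominators p hp) as [nu_den [alpha_den beta_den]].
unfold alpha_factor, gamma_factor, local_coef1, local_coef2, nu_excess.
field. repeat split; nra.
Qed.

(** * The weighted sum *)

Definition nu_sum (f : R -> R) (x : R) : R :=
  Series (fun r => nu (S r) * f (INR (S r) * x)).

Lemma nu_sum_finite (f : R -> R) (L x : R) (M : nat) : vanishes_beyond L f -> 0 < x ->
  L <= INR (S M) * x ->
  nu_sum f x = sum_n (fun r => nu (S r) * f (INR (S r) * x)) M.
Proof.
intros Hz hx hM. apply Series_finite_support. intros m hm.
rewrite (vanishes_beyond_dilated f L x (S M)); trivial; [ring|lia].
Qed.

Lemma vanishes_beyond_dilated_sum (L : R) (f : R -> R) : 0 < L ->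
  vanishes_beyond L f -> vanishes_beyond L (dilated_sum f).
Proof.
intros hL Hz x hx. rewrite (dilated_sum_finite f L x 0); trivial; try (simpl; lra).
rewrite sum_O. apply Hz. simpl. lra.
Qed.

Section Dilations.

Variables (L : R) (H : R -> R).
Hypothesis L_pos : 0 < L.
Hypothesis H_vanishes : vanishes_beyond L H.

Lemma nu_sum_dilation_op (N : nat) (x : R) : 0 < x -> L <= INR (S N) * x ->
  nu_sum H x
  = dilation_op (fun p => nu_excess p * 1) (fun _ => 0) N (dilated_sum H) x.
Proof.
intros hx hN.
rewrite <- (Series_prime_weight nu_excess (fun _ => 1) (fun y r => H (INR r * y))); trivial.
- apply Series_ext. intros r. destruct (Nat.le_gt_cases (S r) N) as [h|h].
  + now rewrite prime_weight_nu_excess by lia.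
  + rewrite (vanishes_beyond_dilated H L x (S N)); trivial. ring.
- intros y hy. now apply ex_series_Rabs_dilated with L.
- intros p r y _ _ _. rewrite mult_INR, Rmult_1_l. f_equal. ring.
Qed.

(* The weight [a^-2] of [double_sum] is sieved out by the factors [1 - p^-2 T_p]. *)
Lemma dilated_sum_dilation_op (N : nat) (x : R) : 0 < x -> L <= INR (S N) * x ->
  dilated_sum H x
  = dilation_op (fun p => (-1) * / p ^ 2) (fun _ => 0) N (double_sum H) x.
Proof.
intros hx hN. pose proof (vanishes_beyond_dilated_sum L H L_pos H_vanishes) as Hz.
unfold double_sum. rewrite <- (Series_prime_weight (fun _ => -1) (fun p => / p ^ 2)
  (fun y r => dilated_sum H (INR r * y) / INR r ^ 2)); [| | |easy].
- fold sieve_weight. rewrite (Series_finite_support _ 0).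
  + rewrite sum_O. unfold sieve_weight. rewrite prime_weight_1. simpl INR.
    rewrite !Rmult_1_l, pow1. symmetry. apply Rdiv_1_r.
  + intros m hm. destruct (Nat.le_gt_cases (S m) N) as [h|h].
    * rewrite sieve_weight_0 by lia. ring.
    * rewrite (vanishes_beyond_dilated _ L x (S N)); trivial. unfold Rdiv. ring.
- intros z hz. destruct (exists_cutoff L z hz) as [M hM].
  eexists. apply (is_series_finite_support _ M). intros m hm.
  rewrite (vanishes_beyond_dilated _ L z (S M)); [|easy|easy|easy|lia].
  unfold Rdiv. now rewrite Rmult_0_l, Rabs_R0.
- intros p r z hp hr hz. rewrite mult_INR.
  replace (INR p * INR r * z) with (INR r * (INR p * z)) by ring. field.
  split; apply not_0_INR; lia.
Qed.

Lemma nu_sum_double_sum (N : nat) (x : R) : 0 < x -> L <= INR (S N) * x ->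
  nu_sum H x = dilation_op local_coef1 local_coef2 N (double_sum H) x.
Proof.
intros hx hN. rewrite (nu_sum_dilation_op N) by easy.
rewrite (dilation_op_ext (Rle x) _ _ N (dilated_sum H)
  (dilation_op (fun p => -1 * / p ^ 2) (fun _ => 0) N (double_sum H))).
- apply dilation_op_comp.
- intros p y hp hy. nra.
- intros y hy. apply dilated_sum_dilation_op; [lra|].
  pose proof (pos_INR (S N)). nra.
- apply Rle_refl.
Qed.

End Dilations.

Definition inverse_zeta_upto (N s : nat) : R := prime_product_upto N (fun p => 1 - / p ^ s).

(* The local factors act by scalars on [x^-1], [1] and [x]. *)
Lemma dilation_op_expansion (N : nat) (D eps : R -> R) (a b k : R) :
  (forall y, 0 < y -> D y = a / y + b + y * (eps y + k)) -> forall x, 0 < x ->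
  prime_product_upto N alpha_factor * dilation_op local_coef1 local_coef2 N D x
  = prime_product_upto N gamma_factor
      * (inverse_zeta_upto N 2 * inverse_zeta_upto N 3) * (a / x)
    + prime_product_upto N beta_factor * inverse_zeta_upto N 2 * b
    + inverse_zeta_upto N 2 * (k * x)
    + x * (prime_product_upto N alpha_factor
        * dilation_op (fun p => p * local_coef1 p) (fun p => p ^ 2 * local_coef2 p) N eps x).
Proof.
intros HD x hx.
rewrite (dilation_op_ext (Rlt 0) _ _ N D (fun y => 1 * (/ y * a)
   + 1 * (1 * (1 * b) + 1 * (y * (1 * eps y + 1 * k))))); [| | |exact hx].
2: { intros p y hp hy. nra. }
2: { intros y hy. rewrite HD by easy. field. lra. }
rewrite !dilation_op_linear.
rewrite (dilation_op_homogeneous _ _ Rinv Rinv (fun _ => a)) by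
  (easy || (intros; apply Rinv_mult)).
rewrite (dilation_op_homogeneous _ _ (fun _ => 1) (fun _ => 1) (fun _ => b)) by
  (easy || (intros; ring)).
rewrite (dilation_op_homogeneous _ _ (fun y => y) (fun p => p)
  (fun y => 1 * eps y + 1 * k)) by (easy || (intros; ring)).
rewrite dilation_op_linear, !dilation_op_const.
unfold inverse_zeta_upto.
assert (inverse_factors := prime_product_upto_ext _ _ N local_identity_inverse).
assert (const_factors := prime_product_upto_ext _ _ N local_identity_const).
assert (linear_factors := prime_product_upto_ext _ _ N local_identity_linear).
rewrite <- !prime_product_upto_mult in inverse_factors.
rewrite <- !prime_product_upto_mult in const_factors.
rewrite <- prime_product_upto_mult in linear_factors.
rewrite <- inverse_factors, <- const_factors, <- linear_factors. field. lra.
Qed.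

Lemma is_lim_seq_dilation_op_expansion (u v w : R) :
  is_lim_seq (fun N => prime_product_upto N gamma_factor
      * (inverse_zeta_upto N 2 * inverse_zeta_upto N 3) * u
    + prime_product_upto N beta_factor * inverse_zeta_upto N 2 * v
    + inverse_zeta_upto N 2 * w)
  (prime_product gamma_factor * (/ zeta 2 * / zeta 3) * u
    + prime_product beta_factor * / zeta 2 * v + / zeta 2 * w).
Proof.
assert (lim_beta := is_lim_seq_prime_product _ 4 ltac:(lra) beta_factor_near_1).
assert (lim_gamma := is_lim_seq_prime_product _ 4 ltac:(lra) gamma_factor_near_1).
assert (lim_2 := euler_product 2 ltac:(lia)). assert (lim_3 := euler_product 3 ltac:(lia)).
repeat apply is_lim_seq_plus'; (apply is_lim_seq_mult'; [|apply is_lim_seq_const]).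
- apply is_lim_seq_mult'; [exact lim_gamma|]. now apply is_lim_seq_mult'.
- now apply is_lim_seq_mult'.
- exact lim_2.
Qed.

Section NuSumError.

Variables (L a b k M : R) (H eps : R -> R).
Hypothesis L_pos : 0 < L.
Hypothesis H_vanishes : vanishes_beyond L H.
Hypothesis expansion :
  forall y, 0 < y -> double_sum H y = a / y + b + y * (eps y + k).
Hypothesis eps_bound : forall y, 0 < y -> Rabs (eps y) <= M.
Hypothesis eps_limit : filterlim eps (at_right 0) (locally 0).

Let main (x : R) : R :=
  prime_product gamma_factor * (/ zeta 2 * / zeta 3) * (a / x)
  + prime_product beta_factor * / zeta 2 * b + / zeta 2 * (k * x).

Let error (N : nat) (x : R) : R := prime_product_upto N alpha_factor
  * dilation_op (fun p => p * local_coef1 p) (fun p => p ^ 2 * local_coef2 p) N eps x.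

Local Lemma is_lim_seq_error (x : R) : 0 < x -> is_lim_seq (fun N => error N x)
  ((prime_product alpha_factor * nu_sum H x - main x) / x).
Proof.
intros hx. destruct (exists_cutoff L x hx) as [N1 hN1].
apply (is_lim_seq_ext_loc (fun N => (prime_product_upto N alpha_factor * nu_sum H x
  - (prime_product_upto N gamma_factor
      * (inverse_zeta_upto N 2 * inverse_zeta_upto N 3) * (a / x)
    + prime_product_upto N beta_factor * inverse_zeta_upto N 2 * b
    + inverse_zeta_upto N 2 * (k * x))) * / x)).
- exists N1. intros N hN. rewrite (nu_sum_double_sum L H L_pos H_vanishes N); [|easy|].
  + rewrite (dilation_op_expansion N _ _ _ _ _ expansion x hx). unfold error. field. lra.
  + apply Rle_trans with (1 := hN1). apply Rmult_le_compat_r; [lra|]. apply le_INR. lia.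
- apply is_lim_seq_mult'; [|apply is_lim_seq_const].
  apply is_lim_seq_minus'; [|apply is_lim_seq_dilation_op_expansion].
  apply is_lim_seq_mult'; [|apply is_lim_seq_const].
  apply (is_lim_seq_prime_product _ 4); [lra|exact alpha_factor_near_1].
Qed.

Lemma nu_sum_error_vanishing :
  filterlim (fun x => (prime_product alpha_factor * nu_sum H x - main x) / x)
    (at_right 0) (locally 0).
Proof.
assert (M_nonneg : 0 <= M)
  by (pose proof (eps_bound 1 Rlt_0_1); pose proof (Rabs_pos (eps 1)); lra).
destruct (prime_product_upto_bounded alpha_factor 4 ltac:(lra) alpha_factor_near_1)
  as [K [hK BK]].
apply filterlim_locally_Rabs; [typeclasses eauto|]. intros e he.
destruct (dilation_op_vanishing_uniform _ _ 10 ltac:(lra) local_coefs_bounded eps M M_nonneg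
  eps_bound eps_limit (e / K)) as [N0 HN0]; [now apply Rdiv_lt_0_compat|].
revert HN0. unfold at_right, within. apply filter_imp. intros x small hx.
rewrite Rminus_0_r.
apply (is_lim_seq_le_loc (fun N => Rabs (error N x)) (fun _ => e)
  (Rabs ((prime_product alpha_factor * nu_sum H x - main x) / x)) e).
- exists N0. intros N hN. unfold error. rewrite Rabs_mult.
  replace e with (K * (e / K)) by (field; lra).
  apply Rmult_le_compat; try apply Rabs_pos; [apply BK|now apply small].
- apply (is_lim_seq_abs _ (Finite _)). now apply is_lim_seq_error.
- apply is_lim_seq_const.
Qed.

End NuSumError.

Definition nu_sum_main (c h0 kappa x : R) : R :=
  prime_product gamma_factor * c / (zeta 2 * x) - prime_product beta_factor * h0 / 2
  - kappa / (12 * zeta 2) * x.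

Definition nu_sum_error (c kappa : R) (H : R -> R) (x : R) : R :=
  (prime_product alpha_factor * nu_sum H x - nu_sum_main c (H 0) kappa x) / x.

Lemma nu_sum_asymptotics (L kappa : R) (H : R -> R) : 0 < L ->
  has_slope_integral L H kappa ->
  filterlim (nu_sum_error (RInt H 0 L) kappa H) (at_right 0) (locally 0).
Proof.
intros hL [h [HH Ih]].
destruct (double_sum_expansion L H h hL HH) as [eta [C [Beta [lim_eta ED]]]].
set (c := RInt H 0 L : R) in *. rewrite Ih in lim_eta.
pose proof (zeta_pos 2 ltac:(lia)). pose proof (zeta_pos 3 ltac:(lia)).
eapply filterlim_ext_loc; [|apply (nu_sum_error_vanishing L (zeta 3 * c)
  (- (zeta 2 * H 0 / 2)) (- (kappa / 12)) (C + Rabs (kappa / 12)) H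
  (fun x => eta x + kappa / 12) hL)].
- unfold at_right, within. apply filter_forall. intros x hx.
  unfold nu_sum_error, nu_sum_main. field. lra.
- apply HH.
- intros y hy. rewrite ED by easy. field. lra.
- intros x hx. refine (Rle_trans _ _ _ (Rabs_triang _ _) _).
  apply Rplus_le_compat_r. now apply Beta.
- replace 0 with (- (kappa / 12) + kappa / 12) at 2 by ring.
  apply filterlim_Rplus; [typeclasses eauto|exact lim_eta|apply filterlim_const].
Qed.

(** * Parametric integrals *)

Lemma continuity_2d_continuous_snd (f : R -> R -> R) (x t : R) :
  continuity_2d_pt f x t -> continuous (f x) t.
Proof.
intros Hf. apply continuity_pt_filterlim. intros e he.
destruct (Hf (mkposreal e he)) as [d Hd]. exists d. split; [apply cond_pos|].
intros s [_ hs]. apply Hd; [rewrite Rminus_diag, Rabs_R0; apply cond_pos|exact hs].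
Qed.

Lemma continuity_2d_pt_swap (f : R -> R -> R) (x t : R) :
  continuity_2d_pt f x t -> continuity_2d_pt (fun u v => f v u) t x.
Proof. intros Hf e. destruct (Hf e) as [d Hd]. exists d. intros u v hu hv. now apply Hd. Qed.

Lemma continuity_2d_continuous_fst (f : R -> R -> R) (x t : R) :
  continuity_2d_pt f x t -> continuous (fun y => f y t) x.
Proof.
intros Hf. now apply (continuity_2d_continuous_snd (fun t y => f y t)), continuity_2d_pt_swap.
Qed.

Section ParametricIntegral.

Variable f : R -> R -> R.
Hypothesis f_continuous : forall x t, continuity_2d_pt f x t.

Lemma ex_RInt_section (x a b : R) : ex_RInt (f x) a b.
Proof. apply ex_RInt_continuous_R. intros t. now apply continuity_2d_continuous_snd. Qed.

Lemma continuous_RInt_param_le (a b x : R) : a <= b ->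
  continuous (fun y => RInt (f y) a b) x.
Proof.
intros hab. apply continuity_pt_filterlim. intros e he.
assert (he' : 0 < e / 2 / (b - a + 1)) by (apply Rdiv_lt_0_compat; lra).
destruct (uniform_continuity_2d_1d' f a b x (fun t _ => f_continuous x t) (mkposreal _ he'))
  as [d Hd].
simpl in Hd. exists d. split; [apply cond_pos|]. intros y [_ hy].
change (Rabs (y - x) < d) in hy.
change (Rabs (minus (RInt (f y) a b) (RInt (f x) a b)) < e).
rewrite <- (RInt_minus (V := R_CompleteNormedModule)) by apply ex_RInt_section.
apply Rle_lt_trans with ((b - a) * (e / 2 / (b - a + 1))).
- apply abs_RInt_le_const; [exact hab| |].
  + apply (ex_RInt_minus (V := R_NormedModule)); apply ex_RInt_section.
  + intros t ht. left. apply Rabs_def2 in hy.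
    apply (Hd t x t y); trivial; try (pose proof (cond_pos d); lra).
    rewrite Rminus_diag, Rabs_R0. apply cond_pos.
- apply Rle_lt_trans with (e / 2); [|lra].
  unfold Rdiv at 1. rewrite <- Rmult_assoc. apply Rle_div_l; [lra|]. nra.
Qed.

Lemma continuous_RInt_param (a b x : R) : continuous (fun y => RInt (f y) a b) x.
Proof.
destruct (Rle_dec a b) as [h|h]; [now apply continuous_RInt_param_le|].
apply (continuous_ext (fun y => opp (RInt (f y) b a))).
- intros y. apply opp_RInt_swap, ex_RInt_section.
- apply (continuous_opp (V := R_NormedModule)), continuous_RInt_param_le. lra.
Qed.

End ParametricIntegral.

Lemma RInt_exchange (f : R -> R -> R) (a b c d : R) :
  (forall x t, continuity_2d_pt f x t) ->
  RInt (fun x => RInt (f x) a b) c d = RInt (fun t => RInt (fun x => f x t) c d) a b :> R.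
Proof.
intros Hf. assert (Hf' : forall t x, continuity_2d_pt (fun t x => f x t) t x)
  by (intros; now apply continuity_2d_pt_swap).
assert (inner : forall t y, is_derive (fun z => RInt (fun x => f x t) c z) y (f y t)).
{ intros t y. apply (is_derive_RInt_R (fun x => f x t)). intros x.
  now apply continuity_2d_continuous_fst. }
set (G := fun z => RInt (fun t => RInt (fun x => f x t) c z) a b).
assert (DG : forall y, is_derive G y (RInt (f y) a b)).
{ intros y.
  rewrite (RInt_ext (f y) (fun t => Derive (fun z => RInt (fun x => f x t) c z) y))
    by (intros; symmetry; now apply is_derive_unique).
  apply (is_derive_RInt_param (fun z t => RInt (fun x => f x t) c z) a b y).
  - apply filter_forall. intros z t _. eexists. apply inner.
  - intros t ht. apply continuity_2d_pt_ext with f; [|apply Hf].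
    intros u v. symmetry. now apply is_derive_unique.
  - apply filter_forall. intros z. apply ex_RInt_continuous_R. intros t.
    now apply (continuous_RInt_param (fun t x => f x t)). }
rewrite (RInt_of_derivative G (fun y => RInt (f y) a b)); [|exact DG|].
- assert (G0 : G c = 0); [|rewrite G0; apply Rminus_0_r].
  unfold G. rewrite (RInt_ext _ (fun _ => 0)) by (intros; apply RInt_point_R).
  rewrite RInt_const. apply Rmult_0_r.
- intros y. now apply continuous_RInt_param.
Qed.

(** * Chebyshev polynomials of even index *)

Fixpoint chebyshevV (n : nat) (s : R) : R :=
  match n with
  | O => 1
  | S m => match m with
           | O => 4 * s - 1
           | S l => (4 * s - 2) * chebyshevV m s - chebyshevV l s
           end
  end.

Lemma chebyshevV_SS (n : nat) (s : R) :
  chebyshevV (S (S n)) s = (4 * s - 2) * chebyshevV (S n) s - chebyshevV n s.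
Proof. reflexivity. Qed.

Lemma chebyshevU_even (n : nat) (x : R) : chebyshevU (2 * n) x = chebyshevV n (x ^ 2).
Proof.
assert (recurrence : forall m, chebyshevU (S (S m)) x
  = 2 * x * chebyshevU (S m) x - chebyshevU m x) by reflexivity.
revert n. apply Nat.pair_induction; [now intros ? ? ->|reflexivity|simpl; ring|]. intros n IH IHS.
replace (2 * S (S n))%nat with (S (S (S (S (2 * n))))) by lia.
replace (2 * S n)%nat with (S (S (2 * n))) in IHS by lia.
rewrite chebyshevV_SS, <- IH, <- IHS, !recurrence. ring.
Qed.

Lemma chebyshevV_0 (n : nat) : chebyshevV n 0 = (-1) ^ n.
Proof.
revert n. apply Nat.pair_induction; [now intros ? ? ->|reflexivity|simpl; ring|]. intros n IH IHS.
rewrite chebyshevV_SS, IH, IHS. simpl. ring.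
Qed.

Lemma ex_derive_chebyshevV (n : nat) (s : R) : ex_derive (chebyshevV n) s.
Proof.
revert n. apply Nat.pair_induction;
  [now intros ? ? ->|simpl; auto_derive; exact I|simpl; auto_derive; exact I|].
intros n IH IHS.
apply (ex_derive_ext (fun s => (4 * s - 2) * chebyshevV (S n) s - chebyshevV n s));
  [reflexivity|].
now auto_derive.
Qed.

Lemma continuous_chebyshevV (n : nat) (s : R) : continuous (chebyshevV n) s.
Proof. apply ex_derive_continuous_R, ex_derive_chebyshevV. Qed.

Lemma sin_mult_chebyshevV (n : nat) (t : R) :
  sin t * chebyshevV n (cos t ^ 2) = sin ((2 * INR n + 1) * t).
Proof.
revert n. apply Nat.pair_induction; [now intros ? ? ->| | |].
- simpl. rewrite Rmult_1_r. f_equal. ring.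
- simpl. replace ((2 * 1 + 1) * t) with (2 * t + t) by ring.
  rewrite sin_plus, sin_2a, cos_2a_cos. ring.
- intros n IH IHS. rewrite chebyshevV_SS.
  replace (sin t * ((4 * cos t ^ 2 - 2) * chebyshevV (S n) (cos t ^ 2)
      - chebyshevV n (cos t ^ 2)))
    with (2 * (2 * cos t * cos t - 1) * (sin t * chebyshevV (S n) (cos t ^ 2))
      - sin t * chebyshevV n (cos t ^ 2)) by ring.
  rewrite IH, IHS, <- cos_2a_cos, !S_INR.
  set (s := (2 * (INR n + 1) + 1) * t).
  replace ((2 * INR n + 1) * t) with (s - 2 * t) by (unfold s; ring).
  replace ((2 * (INR n + 1 + 1) + 1) * t) with (s + 2 * t) by (unfold s; ring).
  rewrite sin_minus, sin_plus. ring.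
Qed.

Lemma sin_INR_PI (n : nat) : sin (INR n * PI) = 0.
Proof. apply sin_eq_0_1. exists (Z.of_nat n). now rewrite <- INR_IZR_INZ. Qed.

Lemma RInt_sin_mult_sin_odd (n : nat) :
  RInt (fun t => sin t * sin ((2 * INR n + 1) * t)) 0 (PI / 2)
  = (if Nat.eqb n 0 then PI / 4 else 0) :> R.
Proof.
assert (Hc : forall t, continuous (fun t => sin t * sin ((2 * INR n + 1) * t)) t).
{ intros t. apply ex_derive_continuous_R. auto_derive. exact I. }
destruct n as [|n].
- rewrite (RInt_of_derivative (fun t => t / 2 - sin (2 * t) / 4)); [| |exact Hc].
  + simpl. replace (2 * (PI / 2)) with PI by field. rewrite sin_PI, Rmult_0_r, sin_0. field.
  + intros t. auto_derive; [exact I|]. simpl.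
    replace ((2 * 0 + 1) * t) with t by ring. rewrite cos_2a_sin. field.
- rewrite (RInt_of_derivative (fun t => sin (2 * INR (S n) * t) / (4 * INR (S n))
    - sin (2 * (INR (S n) + 1) * t) / (4 * (INR (S n) + 1)))); [| |exact Hc].
  + cbn [Nat.eqb]. rewrite !Rmult_0_r, sin_0.
    replace (2 * INR (S n) * (PI / 2)) with (INR (S n) * PI) by field.
    replace (2 * (INR (S n) + 1) * (PI / 2)) with (INR (S (S n)) * PI)
      by (rewrite (S_INR (S n)); field).
    rewrite !sin_INR_PI. unfold Rdiv. ring.
  + intros t. assert (hn : 0 < INR (S n)) by (apply lt_0_INR; lia).
    revert hn. generalize (INR (S n)). intros q hq. auto_derive; [exact I|].
    set (s := (2 * q + 1) * t).
    replace (2 * q * t) with (s - t) by (unfold s; ring).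
    replace (2 * (q + 1) * t) with (s + t) by (unfold s; ring).
    rewrite cos_minus, cos_plus. field. lra.
Qed.

(** * The smoothed kernel *)

Definition kernel (n : nat) (t x : R) : R := sqrt (t - x ^ 2) * chebyshevV n (x ^ 2 / t).

Lemma kernel_0 (t x : R) : kernel 0 t x = sqrt (t - x ^ 2).
Proof. apply Rmult_1_r. Qed.

Lemma kernel_beyond (n : nat) (t x : R) : t <= x ^ 2 -> kernel n t x = 0.
Proof. intros h. unfold kernel. rewrite sqrt_neg_0 by lra. ring. Qed.

Lemma kernel_at_0 (n : nat) (t : R) : kernel n t 0 = (-1) ^ n * sqrt t.
Proof.
unfold kernel. replace (t - 0 ^ 2) with t by ring.
replace (0 ^ 2 / t) with 0 by (unfold Rdiv; ring). rewrite chebyshevV_0. ring.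
Qed.

Lemma continuity_2d_kernel (n : nat) (t x : R) : 0 < t ->
  continuity_2d_pt (fun x t => kernel n t x) x t.
Proof.
intros ht. assert (sqr : continuity_2d_pt (fun u v => u ^ 2) x t).
{ apply (continuity_1d_2d_pt_comp (fun u => u ^ 2) (fun u _ => u)).
  - apply derivable_continuous_pt, ex_derive_Reals_0. auto_derive. exact I.
  - apply continuity_2d_pt_id1. }
apply continuity_2d_pt_mult.
- apply (continuity_1d_2d_pt_comp sqrt (fun u v => v - u ^ 2)).
  + apply continuity_pt_filterlim, continuous_sqrt.
  + now apply continuity_2d_pt_minus; [apply continuity_2d_pt_id2|].
- apply (continuity_1d_2d_pt_comp (chebyshevV n) (fun u v => u ^ 2 / v)).
  + apply continuity_pt_filterlim, continuous_chebyshevV.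
  + apply (continuity_2d_pt_mult (fun u v => u ^ 2) (fun u v => / v)); [exact sqr|].
    apply (continuity_2d_pt_inv (fun _ v => v)); [apply continuity_2d_pt_id2|lra].
Qed.

Lemma kernel_cos (n : nat) (s v : R) : 0 < s -> 0 <= sin v ->
  kernel n (s * s) (s * cos v) = s * sin ((2 * INR n + 1) * v).
Proof.
intros hs hv. unfold kernel.
replace (s * s - (s * cos v) ^ 2) with ((s * sin v) ^ 2).
2: { pose proof (sin2 v) as e. unfold Rsqr in e. ring [e]. }
rewrite sqrt_pow2 by (apply Rmult_le_pos; lra).
replace ((s * cos v) ^ 2 / (s * s)) with (cos v ^ 2) by (field; lra).
rewrite Rmult_assoc, sin_mult_chebyshevV. reflexivity.
Qed.

(* Substitute [x = sqrt t * cos v]. *)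
Lemma RInt_kernel (n : nat) (t L : R) : 0 < t -> sqrt t <= L ->
  RInt (kernel n t) 0 L = (if Nat.eqb n 0 then PI / 4 else 0) * t :> R.
Proof.
intros ht hL. set (s := sqrt t) in *. pose proof PI_RGT_0.
assert (hs : 0 < s) by now apply sqrt_lt_R0.
assert (hst : t = s * s) by (symmetry; apply sqrt_sqrt; lra).
assert (Ck : forall x, continuous (kernel n t) x).
{ intros x. apply (continuity_2d_continuous_fst (fun x t => kernel n t x)).
  now apply continuity_2d_kernel. }
assert (Cs : forall v, continuous (fun v => sin v * sin ((2 * INR n + 1) * v)) v).
{ intros v. apply ex_derive_continuous_R. auto_derive. exact I. }
assert (subst : RInt (fun v => - (s * sin v) * kernel n t (s * cos v)) (PI / 2) 0
  = RInt (kernel n t) 0 s :> R).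
{ pose proof (RInt_comp (V := R_CompleteNormedModule) (kernel n t) (fun v => s * cos v)
    (fun v => - (s * sin v)) (PI / 2) 0 (fun v _ => Ck _)) as subst.
  cbv beta in subst. rewrite cos_0, cos_PI2, Rmult_0_r, Rmult_1_r in subst. apply subst.
  intros v _. split; [auto_derive; [exact I|ring]|].
  apply ex_derive_continuous_R. auto_derive. exact I. }
rewrite (RInt_support (kernel n t) 0 s 0 L), <- subst;
  [|lra|lra|exact Ck|intros; lra|intros x hx; apply kernel_beyond; nra].
rewrite (RInt_ext _ (fun v => - t * (sin v * sin ((2 * INR n + 1) * v)))).
- rewrite RInt_scal_R by exact Cs. rewrite <- RInt_sin_mult_sin_odd.
  rewrite <- (opp_RInt_swap _ 0 (PI / 2)) by now apply ex_RInt_continuous_R.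
  change (opp ?u) with (- u). ring.
- rewrite Rmin_right, Rmax_left by lra. intros v hv.
  rewrite hst, kernel_cos by (easy || (apply sin_ge_0; lra)). apply Rminus_diag_uniq. ring.
Qed.

Definition bump (hi : R) (phi : R -> R) : Prop :=
  tapered hi phi /\ exists lo, 0 < lo /\ forall t, t < lo -> phi t = 0.

Lemma bump_Derive (hi : R) (phi : R -> R) : bump hi phi -> bump hi (Derive phi).
Proof.
intros [Tphi [lo [hlo Z]]]. split; [now apply tapered_Derive|].
exists lo. split; [exact hlo|]. intros t ht. apply is_derive_unique.
apply is_derive_ext_loc with (fun _ => 0).
- generalize (open_lt lo t ht). apply filter_imp. intros s hs. now rewrite Z.
- apply (is_derive_const (V := R_NormedModule)).
Qed.

Lemma bump_div (hi : R) (phi : R -> R) : bump hi phi -> bump hi (fun t => phi t / t).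
Proof.
intros [[Sphi Zhi] [lo [hlo Zlo]]].
assert (Zlo' : forall t, t < lo -> phi t / t = 0)
  by (intros t ht; rewrite Zlo by easy; unfold Rdiv; ring).
split; [split|now exists lo].
- apply (smooth_glue _ lo hlo Zlo').
  apply smooth_on_mult; [now apply smooth_on_subset with (2 := Sphi)|exact smooth_on_inv].
- intros t ht. rewrite Zhi by easy. unfold Rdiv. ring.
Qed.

Lemma continuity_2d_weighted_kernel (n : nat) (hi : R) (phi : R -> R) (x t : R) :
  bump hi phi -> continuity_2d_pt (fun x t => phi t * kernel n t x) x t.
Proof.
intros [Tphi [lo [hlo Z]]]. destruct (Rlt_dec t lo) as [h|h].
- apply continuity_2d_pt_ext_loc with (fun _ _ => 0); [|apply continuity_2d_pt_const].
  assert (hd : 0 < lo - t) by lra. exists (mkposreal _ hd). simpl.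
  intros u v _ hv. apply Rabs_def2 in hv. rewrite Z by lra. ring.
- apply continuity_2d_pt_mult; [|apply continuity_2d_kernel; lra].
  apply (continuity_1d_2d_pt_comp phi (fun _ v => v)); [|apply continuity_2d_pt_id2].
  now apply continuity_pt_filterlim, tapered_continuous with hi.
Qed.

Lemma continuous_weighted_kernel (n : nat) (hi : R) (phi : R -> R) (x t : R) :
  bump hi phi -> continuous (fun t => phi t * kernel n t x) t.
Proof.
intros Hphi. apply (continuity_2d_continuous_snd (fun x t => phi t * kernel n t x)).
now apply continuity_2d_weighted_kernel with hi.
Qed.

Definition kernel_transform (n : nat) (hi : R) (phi : R -> R) (x : R) : R :=
  RInt (fun t => phi t * kernel n t x) 0 hi.

Definition half_convolution (hi : R) (phi : R -> R) (s : R) : R :=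
  RInt (fun r => phi (s + r) * sqrt r) 0 hi.

Lemma continuity_2d_half_convolution (phi : R -> R) (s r : R) : smooth phi ->
  continuity_2d_pt (fun s r => phi (s + r) * sqrt r) s r.
Proof.
intros Sphi. apply continuity_2d_pt_mult.
- apply (continuity_1d_2d_pt_comp phi (fun u v => u + v)).
  + now apply continuity_pt_filterlim, smooth_continuous.
  + apply continuity_2d_pt_plus; [apply continuity_2d_pt_id1|apply continuity_2d_pt_id2].
- apply (continuity_1d_2d_pt_comp sqrt (fun _ v => v)).
  + apply continuity_pt_filterlim, continuous_sqrt.
  + apply continuity_2d_pt_id2.
Qed.

Lemma is_derive_half_convolution (hi : R) (phi : R -> R) (s : R) : smooth phi ->
  is_derive (half_convolution hi phi) s (half_convolution hi (Derive phi) s).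
Proof.
intros Sphi.
assert (D : forall u v, is_derive (fun z => phi (z + v) * sqrt v) u (Derive phi (u + v) * sqrt v)).
{ intros u v. auto_derive; [now apply smooth_ex_derive|].
  rewrite (is_derive_unique_eta _ _ _ (smooth_is_derive phi (u + v) Sphi)). ring. }
unfold half_convolution.
rewrite (RInt_ext (fun r => Derive phi (s + r) * sqrt r)
  (fun r => Derive (fun z => phi (z + r) * sqrt r) s))
  by (intros; symmetry; now apply is_derive_unique).
apply (is_derive_RInt_param (fun s r => phi (s + r) * sqrt r) 0 hi s).
- apply filter_forall. intros u v _. eexists. apply D.
- intros r _. apply continuity_2d_pt_ext with (fun u v => Derive phi (u + v) * sqrt v).
  + intros u v. symmetry. now apply is_derive_unique.
  + now apply continuity_2d_half_convolution, smooth_Derive.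
- apply filter_forall. intros u. apply (ex_RInt_section (fun s r => phi (s + r) * sqrt r)).
  intros; now apply continuity_2d_half_convolution.
Qed.

Lemma smooth_half_convolution (hi : R) (phi : R -> R) :
  smooth phi -> smooth (half_convolution hi phi).
Proof.
intros Sphi n. revert phi Sphi. induction n as [|n IH]; intros phi Sphi; [exact I|].
exists (half_convolution hi (Derive phi)). split; [|now apply IH, smooth_Derive].
intros s _. now apply is_derive_half_convolution.
Qed.

Lemma has_slope_integral_ext (L : R) (G H : R -> R) (kappa lambda : R) :
  (forall x, H x = G x) -> lambda = kappa ->
  has_slope_integral L G kappa -> has_slope_integral L H lambda.
Proof.
intros e -> [h [[[SG ZG] Th DG] Ih]]. exists h. split; [split|exact Ih].
- split; [apply smooth_ext with (2 := SG); auto|]. intros x hx. rewrite e. now apply ZG.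
- exact Th.
- intros v. rewrite (Derive_ext H G v e). apply DG.
Qed.

Lemma has_slope_integral_linear (L u v kappa lambda : R) (G H : R -> R) :
  has_slope_integral L G kappa -> has_slope_integral L H lambda ->
  has_slope_integral L (fun x => u * G x + v * H x) (u * kappa + v * lambda).
Proof.
intros [g [[TG Tg DG] <-]] [h [[TH Th DH] <-]].
exists (fun x => u * g x + v * h x). split; [split|].
- now apply tapered_plus; apply tapered_scal.
- now apply tapered_plus; apply tapered_scal.
- intros x. rewrite Derive_plus, !Derive_scal, DG, DH; [ring| |];
    apply ex_derive_scal, smooth_ex_derive; [apply TG|apply TH].
- apply RInt_linear; intros; now apply tapered_continuous with L.
Qed.

Lemma has_slope_integral_mul_sqr (L kappa : R) (G : R -> R) : 0 <= L ->
  has_slope_integral L G kappa ->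
  has_slope_integral L (fun x => x ^ 2 * G x) (RInt G 0 L).
Proof.
intros hL [g [[TG Tg DG] _]].
assert (Cg : forall x, continuous (fun x => x * Derive G x) x).
{ intros x. apply tapered_continuous with L.
  apply tapered_mult; [apply smooth_id|now apply tapered_Derive]. }
exists (fun x => 2 * G x + x ^ 2 * g x). split; [split|].
- now apply tapered_mult; [apply smooth_pow|].
- apply tapered_plus; [now apply tapered_scal|now apply tapered_mult; [apply smooth_pow|]].
- intros x. rewrite Derive_mult, DG; [|auto_derive; exact I|apply smooth_ex_derive, TG].
  rewrite Derive_pow by (apply ex_derive_id). rewrite Derive_id. simpl. ring.
- rewrite (RInt_ext_le _ (fun x => 2 * G x + 1 * (x * Derive G x))); [|easy|].
  + rewrite RInt_linear; [|intros; now apply tapered_continuous with L|exact Cg].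
    rewrite RInt_id_mult_Derive by apply TG. rewrite (proj2 TG L) by lra. ring.
  + intros x _. rewrite DG. ring.
Qed.

Section KernelTransform.

Variable hi : R.
Hypothesis hi_pos : 0 < hi.

Lemma kernel_transform_half_convolution (phi : R -> R) (x : R) : bump hi phi ->
  kernel_transform 0 hi phi x = half_convolution hi phi (x ^ 2).
Proof.
intros Hphi. pose proof (proj1 Hphi) as Tphi. set (s := x ^ 2).
assert (hs : 0 <= s) by apply pow2_ge_0.
set (f := fun t => phi t * sqrt (t - s)).
assert (Cf : forall t, continuous f t).
{ intros t. apply continuous_Rmult; [now apply tapered_continuous with hi|].
  apply continuous_sqrt_comp, ex_derive_continuous_R. auto_derive. exact I. }
unfold kernel_transform. rewrite (RInt_ext_le _ f); [|lra|].
2: { intros t _. now rewrite kernel_0. }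
rewrite <- (RInt_support f 0 hi 0 (hi + s)); [|lra|lra|exact Cf|intros; lra|].
2: { intros t ht. unfold f. rewrite (proj2 Tphi) by lra. ring. }
rewrite (RInt_support f s (hi + s) 0 (hi + s)); [|lra|lra|exact Cf| |intros; lra].
2: { intros t ht. unfold f. rewrite sqrt_neg_0 by lra. ring. }
pose proof (RInt_comp_lin f 1 s 0 hi (ex_RInt_continuous_R _ _ _ Cf)) as shift.
rewrite Rmult_0_r, Rplus_0_l, Rmult_1_l in shift. rewrite <- shift.
apply RInt_ext_le; [lra|]. intros r _. unfold f.
change (1 * (phi (1 * r + s) * sqrt (1 * r + s - s)) = phi (s + r) * sqrt r).
rewrite !Rmult_1_l. f_equal; f_equal; ring.
Qed.

Lemma kernel_transform_1 (phi : R -> R) (x : R) : bump hi phi ->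
  kernel_transform 1 hi phi x
  = 4 * (x ^ 2 * kernel_transform 0 hi (fun t => phi t / t) x)
    + -1 * kernel_transform 0 hi phi x.
Proof.
intros Hphi. unfold kernel_transform. rewrite <- Rmult_assoc, <- RInt_linear.
- apply RInt_ext_le; [lra|]. intros t ht. unfold kernel. simpl chebyshevV. field. lra.
- intros t. apply continuous_weighted_kernel with hi. now apply bump_div.
- intros t. now apply continuous_weighted_kernel with hi.
Qed.

Lemma kernel_transform_SS (n : nat) (phi : R -> R) (x : R) : bump hi phi ->
  kernel_transform (S (S n)) hi phi x
  = 4 * (x ^ 2 * kernel_transform (S n) hi (fun t => phi t / t) x)
    + -1 * (2 * kernel_transform (S n) hi phi x + 1 * kernel_transform n hi phi x).
Proof.
intros Hphi. unfold kernel_transform.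
rewrite <- Rmult_assoc, <- !RInt_linear;
  try (intros t; apply continuous_weighted_kernel with hi; now apply bump_div || easy).
- apply RInt_ext_le; [lra|]. intros t ht. unfold kernel. rewrite chebyshevV_SS. field. lra.
- intros t. apply continuous_Rplus;
    (apply continuous_Rmult; [apply continuous_const|now apply continuous_weighted_kernel with hi]).
Qed.

Lemma vanishes_beyond_kernel_transform (n : nat) (phi : R -> R) :
  vanishes_beyond (1 + hi) (kernel_transform n hi phi).
Proof.
intros x hx. apply RInt_zero; [lra|]. intros t ht.
rewrite kernel_beyond by nra. ring.
Qed.

Lemma kernel_transform_at_0 (n : nat) (phi : R -> R) : bump hi phi ->
  kernel_transform n hi phi 0 = (-1) ^ n * RInt (fun t => phi t * sqrt t) 0 hi.
Proof.
intros Hphi. rewrite <- RInt_scal_R.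
- apply RInt_ext_le; [lra|]. intros t _. rewrite kernel_at_0. ring.
- intros t. apply continuous_Rmult; [apply tapered_continuous with hi, Hphi|].
  apply continuous_sqrt.
Qed.

Lemma RInt_kernel_transform (n : nat) (phi : R -> R) : bump hi phi ->
  RInt (kernel_transform n hi phi) 0 (1 + hi)
  = (if Nat.eqb n 0 then PI / 4 else 0) * RInt (fun t => phi t * t) 0 hi :> R.
Proof.
intros Hphi.
transitivity (RInt (fun t => RInt (fun x => phi t * kernel n t x) 0 (1 + hi)) 0 hi : R).
{ apply (RInt_exchange (fun x t => phi t * kernel n t x)).
  intros x t. now apply continuity_2d_weighted_kernel with hi. }
rewrite <- RInt_scal_R.
- apply RInt_ext_le; [lra|]. intros t ht. rewrite RInt_scal_R, RInt_kernel; [ring|lra| |].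
  + pose proof (sqrt_sqrt t ltac:(lra)). pose proof (sqrt_pos t). nra.
  + intros x. apply (continuity_2d_continuous_fst (fun x t => kernel n t x)).
    apply continuity_2d_kernel. lra.
- intros t. apply continuous_Rmult; [apply tapered_continuous with hi, Hphi|].
  apply continuous_id.
Qed.

Lemma smooth_kernel_transform_0 (phi : R -> R) : bump hi phi ->
  smooth (kernel_transform 0 hi phi).
Proof.
intros Hphi. apply smooth_ext with (fun x => half_convolution hi phi (x ^ 2)).
- intros x. symmetry. now apply kernel_transform_half_convolution.
- apply smooth_comp; [apply smooth_half_convolution, Hphi|apply smooth_pow].
Qed.

Lemma tapered_kernel_transform_0 (phi : R -> R) : bump hi phi ->
  tapered (1 + hi) (kernel_transform 0 hi phi).
Proof.
intros Hphi. split; [now apply smooth_kernel_transform_0|].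
apply vanishes_beyond_kernel_transform.
Qed.

Lemma Derive_kernel_transform_0 (phi : R -> R) (x : R) : bump hi phi ->
  Derive (kernel_transform 0 hi phi) x = x * (2 * kernel_transform 0 hi (Derive phi) x).
Proof.
intros Hphi.
rewrite (Derive_ext _ (fun x => half_convolution hi phi (x ^ 2)))
  by (intros; now apply kernel_transform_half_convolution).
rewrite kernel_transform_half_convolution by now apply bump_Derive.
pose proof (is_derive_half_convolution hi phi (x ^ 2) (proj1 (proj1 Hphi))) as D.
apply is_derive_unique. auto_derive; [now eexists; apply D|].
replace (x * (x * 1)) with (x ^ 2) by ring. rewrite (is_derive_unique_eta _ _ _ D). ring.
Qed.

Lemma has_slope_integral_kernel_transform_0 (phi : R -> R) : bump hi phi ->
  has_slope_integral (1 + hi) (kernel_transform 0 hi phi) (- (PI / 2) * RInt phi 0 hi).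
Proof.
intros Hphi. pose proof (bump_Derive _ _ Hphi) as Hphi'.
exists (fun x => 2 * kernel_transform 0 hi (Derive phi) x). split; [split|].
- now apply tapered_kernel_transform_0.
- now apply tapered_scal, tapered_kernel_transform_0.
- intros x. now apply Derive_kernel_transform_0.
- rewrite RInt_scal_R
    by (intros; now apply tapered_continuous with (1 + hi), tapered_kernel_transform_0).
  rewrite RInt_kernel_transform by easy. cbn [Nat.eqb].
  rewrite (RInt_ext_le _ (fun t => t * Derive phi t)) by (lra || (intros; ring)).
  rewrite RInt_id_mult_Derive by apply Hphi. rewrite (proj2 (proj1 Hphi) hi) by lra. field.
Qed.

Lemma has_slope_integral_kernel_transform (n : nat) (phi : R -> R) : bump hi phi ->
  has_slope_integral (1 + hi) (kernel_transform n hi phi)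
    (- ((2 * INR n + 1) * (-1) ^ n * (PI / 2)) * RInt phi 0 hi).
Proof.
assert (hL : 0 <= 1 + hi) by lra.
revert phi. pattern n. revert n. apply Nat.pair_induction; [now intros ? ? ->| | |].
- intros phi Hphi. apply has_slope_integral_ext with (3 :=
    has_slope_integral_kernel_transform_0 phi Hphi); [easy|simpl; ring].
- intros phi Hphi. pose proof (bump_div _ _ Hphi) as Hpsi.
  apply has_slope_integral_ext with (3 := has_slope_integral_linear _ 4 (-1) _ _ _ _
    (has_slope_integral_mul_sqr _ _ _ hL (has_slope_integral_kernel_transform_0 _ Hpsi))
    (has_slope_integral_kernel_transform_0 phi Hphi)).
  + intros x. now apply kernel_transform_1.
  + rewrite RInt_kernel_transform by easy. cbn [Nat.eqb].
    rewrite (RInt_ext_le (fun t => phi t / t * t) phi); [|lra|intros t ht; field; lra].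
    simpl. field.
- intros n IH IHS phi Hphi. pose proof (bump_div _ _ Hphi) as Hpsi.
  apply has_slope_integral_ext with (3 := has_slope_integral_linear _ 4 (-1) _ _ _ _
    (has_slope_integral_mul_sqr _ _ _ hL (IHS _ Hpsi))
    (has_slope_integral_linear _ 2 1 _ _ _ _ (IHS phi Hphi) (IH phi Hphi))).
  + intros x. now apply kernel_transform_SS.
  + rewrite RInt_kernel_transform by easy. cbn [Nat.eqb]. rewrite !S_INR. simpl pow. ring.
Qed.

End KernelTransform.

(** * The smoothed murmuration function *)

Lemma sum_n_m_1_Series (f : nat -> R) (M : nat) : (forall r, (M < r)%nat -> f r = 0) ->
  sum_n_m f 1 M = Series (fun r => f (S r)).
Proof.
intros Hf. rewrite (Series_finite_support _ M) by (intros; apply Hf; lia).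
unfold sum_n. rewrite sum_n_m_S, sum_n_Sm by lia. rewrite Hf by lia.
symmetry. apply Rplus_0_r.
Qed.

Lemma lt_INR_Int_part (z : R) (r : nat) :
  (Z.to_nat (Int_part z) < r)%nat -> z < INR r.
Proof.
intros hr. destruct (base_Int_part z) as [_ h].
assert (hZ : IZR (Int_part z) + 1 <= INR r); [|lra].
rewrite INR_IZR_INZ, <- plus_IZR. apply IZR_le. lia.
Qed.

Lemma murm_summand (n : nat) (y u q : R) : 0 < y -> 0 < u ->
  sqrt (4 * (y / u) - q ^ 2) * chebyshevU (2 * n) (q / (2 * sqrt (y / u)))
  = 2 * sqrt y * kernel n (/ u) (q * / (2 * sqrt y)).
Proof.
intros hy hu. assert (hyu : 0 < y / u) by now apply Rdiv_lt_0_compat.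
pose proof (sqrt_lt_R0 _ hy). pose proof (sqrt_lt_R0 _ hyu).
pose proof (sqrt_sqrt y ltac:(lra)) as ey. pose proof (sqrt_sqrt (y / u) ltac:(lra)) as eyu.
assert (e4 : 4 * (y / u) = 4 * (sqrt y * sqrt y) / u) by (rewrite ey; field; lra).
unfold kernel. rewrite chebyshevU_even.
replace ((q / (2 * sqrt (y / u))) ^ 2) with ((q * / (2 * sqrt y)) ^ 2 / / u).
2: { replace ((q / (2 * sqrt (y / u))) ^ 2)
       with (q ^ 2 / (4 * (sqrt (y / u) * sqrt (y / u)))) by (field; lra).
     rewrite eyu, e4. field. lra. }
replace (4 * (y / u) - q ^ 2)
  with ((2 * sqrt y) ^ 2 * (/ u - (q * / (2 * sqrt y)) ^ 2)).
2: { rewrite e4. field. lra. }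
rewrite sqrt_mult_alt, sqrt_pow2 by (try apply pow2_ge_0; lra). ring.
Qed.

Lemma murm_nu_sum (n : nat) (y u : R) : 0 < y -> 0 < u ->
  murm (2 * n + 2) (y / u)
  = alpha * (-1) ^ n / (2 * INR n + 1) * (2 * sqrt y)
      * nu_sum (kernel n (/ u)) (/ (2 * sqrt y))
    + beta / (2 * INR n + 1) * sqrt y * sqrt (/ u)
    - gamma * (if Nat.eqb n 0 then 1 else 0) * y * / u.
Proof.
intros hy hu. assert (hyu : 0 < y / u) by now apply Rdiv_lt_0_compat.
unfold murm. destruct (Rlt_dec 0 (y / u)) as [_|]; [|easy].
replace (2 * n + 2 - 2)%nat with (2 * n)%nat by lia.
replace ((2 * n + 2) / 2 - 1)%nat with n.
2: { replace (2 * n + 2)%nat with ((n + 1) * 2)%nat by lia. rewrite Nat.div_mul; lia. }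
replace (INR (2 * n + 2) - 1) with (2 * INR n + 1)
  by (rewrite plus_INR, mult_INR; simpl (INR 2); ring).
replace (Nat.eqb (2 * n + 2) 2) with (Nat.eqb n 0)
  by (destruct n; [easy|]; symmetry; apply Nat.eqb_neq; lia).
rewrite sum_n_m_1_Series.
- rewrite (Series_ext _ (fun r => (2 * sqrt y)
    * (nu (S r) * kernel n (/ u) (INR (S r) * / (2 * sqrt y))))).
  + rewrite Series_scal_l. fold (nu_sum (kernel n (/ u)) (/ (2 * sqrt y))).
    replace (sqrt (y / u)) with (sqrt y * sqrt (/ u))
      by (symmetry; apply sqrt_mult_alt; lra).
    unfold Rdiv. ring.
  + intros r. rewrite Rmult_assoc, murm_summand by easy. ring.
- intros r hr. pose proof (sqrt_lt_R0 _ hyu).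
  apply lt_INR_Int_part in hr.
  pose proof (sqrt_sqrt (y / u) ltac:(lra)).
  rewrite (sqrt_neg_0 (4 * (y / u) - INR r ^ 2)) by nra. ring.
Qed.

Lemma continuous_nu_sum (L : R) (f : R -> R) (x : R) : (forall t, continuous f t) ->
  vanishes_beyond L f -> 0 < x -> continuous (nu_sum f) x.
Proof.
intros Cf Zf hx. destruct (exists_cutoff L (x / 2)) as [M hM]; [lra|].
pose proof (pos_INR (S M)).
apply (continuous_ext_loc _ (fun z => sum_n (fun r => nu (S r) * f (INR (S r) * z)) M)).
- assert (hx2 : x / 2 < x) by lra. generalize (open_gt (x / 2) x hx2). apply filter_imp.
  intros z hz. symmetry. apply (nu_sum_finite f L); trivial; nra.
- assert (Ct : forall r, continuous (fun z => nu (S r) * f (INR (S r) * z)) x).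
  { intros r. apply continuous_Rmult; [apply continuous_const|].
    apply (continuous_comp (fun z => INR (S r) * z) f); [|apply Cf].
    apply continuous_Rmult; [apply continuous_const|apply continuous_id]. }
  clear hM H. induction M as [|M IH].
  + apply (continuous_ext (fun z => nu 1 * f (INR 1 * z))); [|apply Ct].
    intros z. symmetry. apply sum_O.
  + eapply continuous_ext; [intros z; symmetry; apply sum_Sn|].
    apply (continuous_plus (V := R_NormedModule)); [exact IH|apply Ct].
Qed.

Lemma is_RInt_sum_n (f : nat -> R -> R) (l : nat -> R) (a b : R) (M : nat) :
  (forall r, is_RInt (f r) a b (l r)) ->
  is_RInt (fun u => sum_n (fun r => f r u) M) a b (sum_n l M).
Proof.
intros Hf. induction M as [|M IH].
- rewrite sum_O. apply (is_RInt_ext (f 0%nat)); [|apply Hf].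
  intros u _. symmetry. apply (sum_O (fun r => f r u)).
- rewrite sum_Sn.
  apply (is_RInt_ext (fun u => plus (sum_n (fun r => f r u) M) (f (S M) u))).
  + intros u _. symmetry. apply (sum_Sn (fun r => f r u)).
  + now apply (is_RInt_plus (V := R_NormedModule)).
Qed.

(* The integral of [murm (2 n + 2) (y / u)] against the weight [phi] in [t = 1 / u]. *)
Definition smoothed_murm (n : nat) (hi : R) (phi : R -> R) (y : R) : R :=
  alpha * (-1) ^ n / (2 * INR n + 1) * (2 * sqrt y)
    * nu_sum (kernel_transform n hi phi) (/ (2 * sqrt y))
  + (beta / (2 * INR n + 1) * RInt (fun t => phi t * sqrt t) 0 hi * sqrt y
     - gamma * (if Nat.eqb n 0 then 1 else 0) * RInt (fun t => phi t * t) 0 hi * y).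

Lemma filterlim_inv_sqrt :
  filterlim (fun y => / (2 * sqrt y)) (Rbar_locally p_infty) (at_right 0).
Proof.
intros P [d Hd]. pose proof (cond_pos d) as hd.
exists ((/ d) ^ 2). intros y hy.
assert (hsqrt : / d < sqrt y).
{ rewrite <- (sqrt_pow2 (/ d)) by (left; now apply Rinv_0_lt_compat).
  apply sqrt_lt_1_alt. split; [apply pow2_ge_0|easy]. }
pose proof (Rinv_0_lt_compat d hd).
assert (hx : 0 < / (2 * sqrt y)) by (apply Rinv_0_lt_compat; lra).
apply Hd; [|exact hx]. change (Rabs (/ (2 * sqrt y) - 0) < d).
rewrite Rminus_0_r, Rabs_pos_eq, <- (Rinv_inv d) by lra.
apply Rinv_lt_contravar; [apply Rmult_lt_0_compat|]; lra.
Qed.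

Section SmoothedMurm.

Variables (n : nat) (hi : R) (phi : R -> R).
Hypothesis hi_pos : 0 < hi.
Hypothesis phi_bump : bump hi phi.

Lemma continuous_smoothed_murm (y : R) : 0 < y -> continuous (smoothed_murm n hi phi) y.
Proof.
intros hy. pose proof (sqrt_lt_R0 y hy).
assert (dilation : continuous (fun y => / (2 * sqrt y)) y)
  by (apply ex_derive_continuous_R; auto_derive; lra).
apply continuous_Rplus.
- apply continuous_Rmult; [apply continuous_Rmult; [apply continuous_const|]|].
  + apply continuous_Rmult; [apply continuous_const|apply continuous_sqrt].
  + apply (continuous_comp (fun y => / (2 * sqrt y))); [exact dilation|].
    destruct (has_slope_integral_kernel_transform hi hi_pos n phi phi_bump) as [h [HH _]].
    apply (continuous_nu_sum (1 + hi)).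
    * intros t. apply tapered_continuous with (1 + hi), HH.
    * now apply vanishes_beyond_kernel_transform.
    * apply Rinv_0_lt_compat. lra.
- apply ex_derive_continuous_R.
  generalize (beta / (2 * INR n + 1)) (gamma * (if Nat.eqb n 0 then 1 else 0))
    (RInt (fun t => phi t * sqrt t) 0 hi) (RInt (fun t => phi t * t) 0 hi).
  intros c1 c2 I1 I2. auto_derive. exact hy.
Qed.

Lemma smoothed_murm_decomposition (y : R) : 0 < y ->
  smoothed_murm n hi phi y = 2 * PI * (-1) ^ n / (2 * INR n + 1)
    * nu_sum_error (RInt (kernel_transform n hi phi) 0 (1 + hi))
        (- ((2 * INR n + 1) * (-1) ^ n * (PI / 2)) * RInt phi 0 hi)
        (kernel_transform n hi phi) (/ (2 * sqrt y))
    + / 2 * RInt phi 0 hi.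
Proof.
intros hy. pose proof PI_RGT_0. pose proof (sqrt_lt_R0 y hy). pose proof (pos_INR n).
unfold smoothed_murm, nu_sum_error, nu_sum_main.
rewrite RInt_kernel_transform, kernel_transform_at_0, zeta_2 by easy.
change alpha with (2 * PI * prime_product alpha_factor).
change beta with (2 * PI * prime_product beta_factor).
change gamma with (12 * prime_product gamma_factor).
set (W := nu_sum _ _). rewrite <- (sqrt_sqrt y) at 3 by lra.
assert (sign : (-1) ^ n * (-1) ^ n = 1).
{ rewrite <- Rpow_mult_distr. replace (-1 * -1) with 1 by ring. apply pow1. }
assert (delta : Nat.eqb n 0 = true -> INR n = 0 /\ (-1) ^ n = 1).
{ intros e. apply Nat.eqb_eq in e. now rewrite e. }
set (sg := (-1) ^ n) in *. clearbody sg W.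
assert (hsg : sg = 1 \/ sg = -1).
{ assert (e : (sg - 1) * (sg + 1) = 0) by lra.
  apply Rmult_integral in e. destruct e; [left|right]; lra. }
destruct (Nat.eqb n 0).
- destruct (delta eq_refl) as [-> ->]. field. lra.
- destruct hsg as [-> | ->]; field; lra.
Qed.

Lemma smoothed_murm_limit :
  filterlim (smoothed_murm n hi phi) (Rbar_locally p_infty) (locally (/ 2 * RInt phi 0 hi)).
Proof.
pose proof (nu_sum_asymptotics (1 + hi) _ (kernel_transform n hi phi) ltac:(lra)
  (has_slope_integral_kernel_transform hi hi_pos n phi phi_bump)) as error_limit.
apply (filterlim_comp _ _ _ _ _ _ _ _ filterlim_inv_sqrt) in error_limit.
apply (filterlim_Rscal _ (2 * PI * (-1) ^ n / (2 * INR n + 1))) in error_limit.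
pose proof (filterlim_Rplus _ _ _ _ _ error_limit
  (filterlim_const (/ 2 * RInt phi 0 hi))) as sum_limit.
rewrite Rmult_0_r, Rplus_0_l in sum_limit. apply filterlim_ext_loc with (2 := sum_limit).
exists 0. intros y hy. symmetry. now apply smoothed_murm_decomposition.
Qed.

End SmoothedMurm.

Definition test_weight (A B : R) (F : R -> R) : Prop :=
  smooth_on (fun u => 0 < u) F /\ forall u, 0 < u -> u <= A \/ B < u -> F u = 0.

Definition inverted_weight (F : R -> R) (t : R) : R :=
  if Rlt_dec 0 t then F (/ t) * (/ t * (/ t * / t)) else 0.

Section InvertedWeight.

Variables (F : R -> R) (A B : R).
Hypothesis A_pos : 0 < A.
Hypothesis A_lt_B : A < B.
Hypothesis F_weight : test_weight A B F.

Let phi : R -> R := inverted_weight F.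

Lemma inverted_weight_below (t : R) : t < / B -> phi t = 0.
Proof.
intros ht. unfold phi, inverted_weight. destruct (Rlt_dec 0 t) as [h|h]; [|easy].
rewrite (proj2 F_weight); [ring|now apply Rinv_0_lt_compat|]. right.
rewrite <- (Rinv_inv B). apply Rinv_lt_contravar; [|easy].
apply Rmult_lt_0_compat; [easy|apply Rinv_0_lt_compat; lra].
Qed.

Lemma bump_inverted_weight : bump (/ A) phi.
Proof.
assert (hB : 0 < / B) by (apply Rinv_0_lt_compat; lra).
split; [split|exists (/ B); split; [exact hB|exact inverted_weight_below]].
- apply smooth_glue with (/ B); [easy|exact inverted_weight_below|].
  apply smooth_on_ext with (fun t => F (/ t) * (/ t * (/ t * / t))).
  + apply open_gt.
  + intros t ht. unfold phi, inverted_weight. now destruct (Rlt_dec 0 t).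
  + pose proof smooth_on_inv as smooth_inv.
    repeat apply smooth_on_mult; trivial. intros m.
    apply derivable_upto_comp with (fun u => 0 < u); [|apply F_weight|apply smooth_inv].
    intros t ht. now apply Rinv_0_lt_compat.
- intros t ht. unfold phi, inverted_weight. destruct (Rlt_dec 0 t) as [h|h]; [|easy].
  rewrite (proj2 F_weight); [ring|now apply Rinv_0_lt_compat|]. left.
  rewrite <- (Rinv_inv A). apply Rinv_le_contravar; [now apply Rinv_0_lt_compat|easy].
Qed.

Lemma continuous_inverted_weight_mult (K : R -> R) (t : R) :
  (forall s, 0 < s -> continuous K s) -> continuous (fun t => phi t * K t) t.
Proof.
intros HK. assert (hB : 0 < / B) by (apply Rinv_0_lt_compat; lra).
destruct (Rlt_dec t (/ B)) as [h|h].
- apply (continuous_ext_loc _ (fun _ => 0)); [|apply continuous_const].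
  generalize (open_lt (/ B) t h). apply filter_imp. intros s hs.
  now rewrite inverted_weight_below, Rmult_0_l.
- apply continuous_Rmult; [|apply HK; lra].
  apply tapered_continuous with (/ A), bump_inverted_weight.
Qed.

Lemma is_RInt_inversion (K : R -> R) : (forall t, 0 < t -> continuous K t) ->
  is_RInt (fun u => F u * u * K (/ u)) A B (RInt (fun t => phi t * K t) 0 (/ A)).
Proof.
intros HK. pose proof (fun t => continuous_inverted_weight_mult K t HK) as Cf.
assert (hB : 0 < / B) by (apply Rinv_0_lt_compat; lra).
assert (hBA : / B <= / A) by (apply Rinv_le_contravar; lra).
rewrite (RInt_support (fun t => phi t * K t) (/ B) (/ A) 0 (/ A));
  [|lra|lra|exact Cf| |intros; lra].
2: { intros t ht. rewrite inverted_weight_below by lra. ring. }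
rewrite <- (opp_RInt_swap (V := R_CompleteNormedModule)) by now apply ex_RInt_continuous_R.
apply (is_RInt_ext (fun u => opp (scal (- (/ u * / u)) (phi (/ u) * K (/ u))))).
- rewrite Rmin_left, Rmax_right by lra. intros u hu.
  change (- (- (/ u * / u) * (phi (/ u) * K (/ u))) = F u * u * K (/ u)).
  unfold phi, inverted_weight. destruct (Rlt_dec 0 (/ u)) as [h|h].
  + rewrite Rinv_inv. field. lra.
  + exfalso. apply h, Rinv_0_lt_compat. lra.
- apply (is_RInt_opp (V := R_NormedModule)).
  apply (is_RInt_comp (V := R_CompleteNormedModule) (fun t => phi t * K t) Rinv
    (fun u => - (/ u * / u))); rewrite Rmin_left, Rmax_right by lra; intros u hu.
  + apply Cf.
  + split; [auto_derive; [lra|field; lra]|].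
    apply ex_derive_continuous_R. auto_derive. lra.
Qed.

Lemma is_RInt_weight : is_RInt (fun u => F u * u) A B (RInt phi 0 (/ A)).
Proof.
rewrite (RInt_ext phi (fun t => phi t * 1)) by (intros; symmetry; apply Rmult_1_r).
apply (is_RInt_ext (fun u => F u * u * 1)); [intros; apply Rmult_1_r|].
apply (is_RInt_inversion (fun _ => 1)). intros t _. apply continuous_const.
Qed.

Lemma is_RInt_nu_sum_kernel (n : nat) (x : R) : 0 < x ->
  is_RInt (fun u => F u * u * nu_sum (kernel n (/ u)) x) A B
    (nu_sum (kernel_transform n (/ A) phi) x).
Proof.
intros hx. set (L := 1 + / A). destruct (exists_cutoff L x hx) as [M hM].
assert (hA : 0 < / A) by now apply Rinv_0_lt_compat.
rewrite (nu_sum_finite _ L x M); [|now apply vanishes_beyond_kernel_transform|easy|easy].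
apply (is_RInt_ext (fun u => sum_n (fun r =>
  nu (S r) * (F u * u * kernel n (/ u) (INR (S r) * x))) M)).
- rewrite Rmin_left, Rmax_right by lra. intros u hu.
  assert (hu' : / u <= / A) by (apply Rinv_le_contravar; lra).
  rewrite (nu_sum_finite _ L x M); [|intros v hv; apply kernel_beyond; unfold L in hv; nra
    |easy|easy].
  rewrite <- (sum_n_mult_l (K := R_Ring)). apply sum_n_ext. intros r.
  change (nu (S r) * (F u * u * kernel n (/ u) (INR (S r) * x))
    = F u * u * (nu (S r) * kernel n (/ u) (INR (S r) * x))). ring.
- apply is_RInt_sum_n. intros r. apply (is_RInt_scal (V := R_NormedModule)).
  apply (is_RInt_inversion (fun t => kernel n t (INR (S r) * x))). intros t ht.
  apply (continuity_2d_continuous_snd (fun x t => kernel n t x)).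
  now apply continuity_2d_kernel.
Qed.

Lemma is_RInt_murm (n : nat) (y : R) : 0 < y ->
  is_RInt (fun u => murm (2 * n + 2) (y / u) * (F u * u)) A B (smoothed_murm n (/ A) phi y).
Proof.
intros hy. pose proof (sqrt_lt_R0 y hy). unfold smoothed_murm.
set (c1 := alpha * (-1) ^ n / (2 * INR n + 1) * (2 * sqrt y)).
set (c2 := beta / (2 * INR n + 1)). set (c3 := gamma * (if Nat.eqb n 0 then 1 else 0)).
set (x := / (2 * sqrt y)).
apply (is_RInt_ext (fun u => c1 * (F u * u * nu_sum (kernel n (/ u)) x)
  + (c2 * sqrt y * (F u * u * sqrt (/ u)) + - (c3 * y) * (F u * u * / u)))).
- rewrite Rmin_left, Rmax_right by lra. intros u hu. rewrite murm_nu_sum by lra.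
  fold c1 c2 c3 x. apply Rminus_diag_uniq. ring.
- set (Ihalf := RInt (fun t => phi t * sqrt t) 0 (/ A)).
  set (Ione := RInt (fun t => phi t * t) 0 (/ A)).
  replace (c2 * Ihalf * sqrt y - c3 * Ione * y)
    with (c2 * sqrt y * Ihalf + - (c3 * y) * Ione) by ring.
  apply (is_RInt_plus (V := R_NormedModule));
    [|apply (is_RInt_plus (V := R_NormedModule))];
    apply (is_RInt_scal (V := R_NormedModule)).
  + apply is_RInt_nu_sum_kernel. apply Rinv_0_lt_compat. lra.
  + apply is_RInt_inversion. intros t _. apply continuous_sqrt.
  + apply (is_RInt_inversion (fun t => t)). intros t _. apply continuous_id.
Qed.

End InvertedWeight.

(** * Complex-valued weights *)

Lemma is_derive_C_fst (f : R -> C) (x : R) (l : C) :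
  @is_derive R_AbsRing C_R_NormedModule f x l -> is_derive (fun t => fst (f t)) x (fst l).
Proof.
intros Df.
apply (filterdiff_comp' (U := R_NormedModule)
  (V := prod_NormedModule R_AbsRing R_NormedModule R_NormedModule) (W := R_NormedModule)
  f fst x (fun y => scal y l) fst Df).
apply filterdiff_linear, is_linear_fst.
Qed.

Lemma is_derive_C_snd (f : R -> C) (x : R) (l : C) :
  @is_derive R_AbsRing C_R_NormedModule f x l -> is_derive (fun t => snd (f t)) x (snd l).
Proof.
intros Df.
apply (filterdiff_comp' (U := R_NormedModule)
  (V := prod_NormedModule R_AbsRing R_NormedModule R_NormedModule) (W := R_NormedModule)
  f snd x (fun y => scal y l) snd Df).
apply filterdiff_linear, is_linear_snd.
Qed.

Lemma smooth_on_pos_component (Phi : R -> C) (pr : C -> R) :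
  (forall (f : R -> C) (x : R) (l : C), @is_derive R_AbsRing C_R_NormedModule f x l ->
     is_derive (fun t => pr (f t)) x (pr l)) ->
  smooth_on_pos Phi -> smooth_on (fun u => 0 < u) (fun u => pr (Phi u)).
Proof.
intros hpr [D [D0 DS]].
apply smooth_on_ext with (fun u => pr (D 0%nat u)); [apply open_gt| |].
- intros u hu. now rewrite D0.
- intros n. generalize 0%nat. induction n as [|n IH]; intros m; [exact I|].
  exists (fun u => pr (D (S m) u)). split; [|apply IH].
  intros u hu. now apply hpr, DS.
Qed.

Lemma filterlim_C_pair {T : Type} (F : (T -> Prop) -> Prop) {FF : Filter F}
  (f g : T -> R) (l m : R) :
  filterlim f F (locally l) -> filterlim g F (locally m) ->
  filterlim (fun y => (f y, g y) : C) F (locally ((l, m) : C)).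
Proof.
intros Hf Hg P [e He].
specialize (Hf _ (locally_ball l e)). specialize (Hg _ (locally_ball m e)).
unfold filtermap in *. generalize (filter_and _ _ Hf Hg). apply filter_imp.
intros y [hf hg]. apply He. now split.
Qed.

Lemma is_RInt_C_zero (f : R -> C) (a b : R) : a <= b ->
  (forall t, a < t < b -> f t = RtoC 0) -> @is_RInt C_R_NormedModule f a b (RtoC 0).
Proof.
intros hab Hf. apply (is_RInt_ext (V := C_R_NormedModule) (fun _ => RtoC 0)).
- rewrite Rmin_left, Rmax_right by easy. intros t ht. symmetry. now apply Hf.
- pose proof (is_RInt_const (V := C_R_NormedModule) a b (RtoC 0)) as h.
  replace (scal (b - a) (RtoC 0 : C_R_NormedModule)) with (RtoC 0) in h; [exact h|].
  symmetry. apply (scal_zero_r (V := C_R_NormedModule)).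
Qed.

Lemma integral_pos_support (f : R -> C) (A B : R) (l1 l2 : R) : 0 < A -> A <= B ->
  (forall u, 0 < u -> u <= A \/ B < u -> f u = RtoC 0) ->
  is_RInt (fun u => fst (f u)) A B l1 -> is_RInt (fun u => snd (f u)) A B l2 ->
  integral_pos f = (l1, l2).
Proof.
intros hA hAB Hf int_fst int_snd. unfold integral_pos.
apply (is_RInt_gen_unique (V := C_R_CompleteNormedModule)).
pose proof (is_RInt_fct_extend_pair (U := R_NormedModule) (V := R_NormedModule)
  f A B l1 l2 int_fst int_snd) as middle.
intros P HP. apply (Filter_prod _ _ _ (fun u => 0 < u < A) (fun v => B < v)).
- unfold at_right, within. generalize (open_lt A 0 hA). apply filter_imp.
  intros u hu hu0. now split.
- now exists B.
- intros u v hu hv. exists ((l1, l2) : C). split; [|now apply locally_singleton].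
  replace ((l1, l2) : C) with (plus (plus (RtoC 0 : C_R_NormedModule) (l1, l2)) (RtoC 0))
    by (apply injective_projections; unfold plus; simpl; unfold plus; simpl; ring).
  apply (is_RInt_Chasles (V := C_R_NormedModule) f u B v).
  + apply (is_RInt_Chasles (V := C_R_NormedModule) f u A B); [|exact middle].
    apply is_RInt_C_zero; simpl; [lra|]. intros t ht. apply Hf; lra.
  + apply is_RInt_C_zero; simpl; [lra|]. intros t ht. apply Hf; lra.
Qed.

Section ComplexWeight.

Variables (Phi : R -> C) (A B : R) (n : nat).
Hypothesis A_pos : 0 < A.
Hypothesis A_lt_B : A < B.
Hypothesis Phi_smooth : smooth_on_pos Phi.
Hypothesis Phi_support : forall u, 0 < u -> u <= A \/ B < u -> Phi u = RtoC 0.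

Let phi_re : R -> R := inverted_weight (fun u => fst (Phi u)).

Let phi_im : R -> R := inverted_weight (fun u => snd (Phi u)).

Local Lemma test_weight_fst : test_weight A B (fun u => fst (Phi u)).
Proof.
split; [exact (smooth_on_pos_component Phi fst is_derive_C_fst Phi_smooth)|].
intros u hu h. now rewrite Phi_support.
Qed.

Local Lemma test_weight_snd : test_weight A B (fun u => snd (Phi u)).
Proof.
split; [exact (smooth_on_pos_component Phi snd is_derive_C_snd Phi_smooth)|].
intros u hu h. now rewrite Phi_support.
Qed.

Definition weight_mass : C := (RInt phi_re 0 (/ A), RInt phi_im 0 (/ A)).

Definition murm_numerator (y : R) : C :=
  (smoothed_murm n (/ A) phi_re y, smoothed_murm n (/ A) phi_im y).

Lemma integral_pos_weight :
  integral_pos (fun u => (Phi u * RtoC (u ^ 2 / u))%C) = weight_mass.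
Proof.
apply (integral_pos_support _ A B); [easy|lra| | |].
- intros u hu h. rewrite Phi_support by easy. apply Cmult_0_l.
- apply (is_RInt_ext (fun u => fst (Phi u) * u)).
  + rewrite Rmin_left by lra. intros u hu. simpl. field. lra.
  + apply is_RInt_weight; trivial. exact test_weight_fst.
- apply (is_RInt_ext (fun u => snd (Phi u) * u)).
  + rewrite Rmin_left by lra. intros u hu. simpl. field. lra.
  + apply is_RInt_weight; trivial. exact test_weight_snd.
Qed.

Lemma integral_pos_murm (y : R) : 0 < y ->
  integral_pos (fun u => (RtoC (murm (2 * n + 2) (y / u)) * Phi u * RtoC (u ^ 2 / u))%C)
  = murm_numerator y.
Proof.
intros hy. apply (integral_pos_support _ A B); [easy|lra| | |].
- intros u hu h. rewrite Phi_support by easy. now rewrite Cmult_0_r, Cmult_0_l.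
- apply (is_RInt_ext (fun u => murm (2 * n + 2) (y / u) * (fst (Phi u) * u))).
  + rewrite Rmin_left by lra. intros u hu. generalize (murm (2 * n + 2) (y / u)).
    intros m. simpl. field. lra.
  + apply is_RInt_murm; trivial. exact test_weight_fst.
- apply (is_RInt_ext (fun u => murm (2 * n + 2) (y / u) * (snd (Phi u) * u))).
  + rewrite Rmin_left by lra. intros u hu. generalize (murm (2 * n + 2) (y / u)).
    intros m. simpl. field. lra.
  + apply is_RInt_murm; trivial. exact test_weight_snd.
Qed.

Lemma murm_avg_numerator (y : R) : 0 < y ->
  murm_avg (2 * n + 2) Phi y = scal (V := C_NormedModule) (/ weight_mass)%C (murm_numerator y).
Proof.
intros hy. unfold murm_avg. rewrite integral_pos_murm, integral_pos_weight by easy.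
apply Cmult_comm.
Qed.

Lemma continuous_murm_numerator (y : R) : 0 < y -> continuous murm_numerator y.
Proof.
intros hy. assert (hA : 0 < / A) by now apply Rinv_0_lt_compat.
apply (filterlim_C_pair (locally y)); apply continuous_smoothed_murm; trivial;
  apply (bump_inverted_weight _ A B); trivial.
- exact test_weight_fst.
- exact test_weight_snd.
Qed.

Lemma filterlim_murm_numerator :
  filterlim murm_numerator (Rbar_locally p_infty) (locally (RtoC (1 / 2) * weight_mass)%C).
Proof.
assert (hA : 0 < / A) by now apply Rinv_0_lt_compat.
replace (RtoC (1 / 2) * weight_mass)%C
  with ((/ 2 * RInt phi_re 0 (/ A), / 2 * RInt phi_im 0 (/ A)) : C).
- apply (filterlim_C_pair (Rbar_locally p_infty)); apply smoothed_murm_limit; trivial;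
    apply (bump_inverted_weight _ A B); trivial.
  + exact test_weight_fst.
  + exact test_weight_snd.
- unfold weight_mass. apply injective_projections; simpl; field.
Qed.

Lemma continuous_murm_avg (y : R) : 0 < y -> continuous (murm_avg (2 * n + 2) Phi) y.
Proof.
intros hy. eapply continuous_ext_loc.
- generalize (open_gt 0 y hy). apply filter_imp. intros z hz. symmetry.
  now apply murm_avg_numerator.
- apply (continuous_comp murm_numerator); [now apply continuous_murm_numerator|].
  apply (filterlim_scal_r (V := C_NormedModule)).
Qed.

Lemma filterlim_murm_avg : weight_mass <> RtoC 0 ->
  filterlim (murm_avg (2 * n + 2) Phi) (Rbar_locally p_infty) (locally (RtoC (1 / 2))).
Proof.
intros hmass. replace (RtoC (1 / 2)) with
  (scal (V := C_NormedModule) (/ weight_mass)%C (RtoC (1 / 2) * weight_mass)%C).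
- apply filterlim_ext_loc with
    (fun y => scal (V := C_NormedModule) (/ weight_mass)%C (murm_numerator y)).
  + exists 0. intros y hy. symmetry. now apply murm_avg_numerator.
  + apply (filterlim_comp _ _ _ murm_numerator _ _ _ _ filterlim_murm_numerator).
    apply (filterlim_scal_r (V := C_NormedModule)).
- change (/ weight_mass * (RtoC (1 / 2) * weight_mass) = RtoC (1 / 2))%C. now field.
Qed.

End ComplexWeight.

Lemma murm_avg_0 (k : nat) (Phi : R -> C) : murm_avg k Phi 0 = RtoC 0.
Proof.
unfold murm_avg. rewrite (integral_pos_support _ 1 1 0 0); [apply Cmult_0_l|lra|lra| | |].
- intros u _ _. unfold murm. replace (0 / u) with 0 by (unfold Rdiv; ring).
  destruct (Rlt_dec 0 0); [lra|]. now rewrite !Cmult_0_l.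
- apply (is_RInt_point (V := R_NormedModule)).
- apply (is_RInt_point (V := R_NormedModule)).
Qed.

Lemma compact_support_bounds (Phi : R -> C) : compact_support_in_pos Phi ->
  exists A B, 0 < A /\ A < B /\ forall u, 0 < u -> u <= A \/ B < u -> Phi u = RtoC 0.
Proof.
intros [a [b [ha [hab supp]]]]. exists (a / 2), b. split; [lra|split; [lra|]].
intros u hu h. destruct (Ceq_dec (Phi u) (RtoC 0)) as [e|ne]; [exact e|].
specialize (supp u hu ne). lra.
Qed.

Theorem theorem5 (k : nat) (Phi : R -> C)
  (hk2 : (2 <= k)%nat) (hkeven : Nat.Even k)
  (hsmooth : smooth_on_pos Phi)
  (hsupp : compact_support_in_pos Phi)
  (hint : integral_pos (fun u => (Phi u * RtoC (u ^ 2 / u))%C) <> RtoC 0) :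
  (forall y : R, 0 < y -> continuous (murm_avg k Phi) y) /\
  murm_avg k Phi 0 = RtoC 0 /\
  filterlim (murm_avg k Phi) (Rbar_locally p_infty) (locally (RtoC (1 / 2))).
Proof.
destruct (compact_support_bounds Phi hsupp) as [A [B [hA [hAB supp]]]].
rewrite (integral_pos_weight Phi A B) in hint by easy.
assert (hn : exists n, k = (2 * n + 2)%nat).
{ destruct hkeven as [m ->]. exists (m - 1)%nat. lia. }
destruct hn as [n ->]. split; [|split].
- intros y hy. now apply (continuous_murm_avg Phi A B).
- apply murm_avg_0.
- now apply (filterlim_murm_avg Phi A B).
Qed.
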